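(* Let $1<p<\infty$ and let $w$ be a nonnegative weight function in the class $D_p$ on $I=[0,\alpha)$, $\alpha\in\{1,\infty\}$. The following statements are equivalent. (i) $\Gamma_{p,w}$ is approximatively compact. (ii) $\Gamma_{p,w}$ is reflexive and strictly $K$-monotone. (iii) $\Gamma_{p,w}$ is reflexive and $W$ is strictly increasing, where $W(t)=\int_0^t w(s)\,ds$.
   Context: Let $I=[0,\alpha)$, $\alpha=1$ or $\alpha=\infty$, with Lebesgue measure $\mu$, and $L^0$ the set of (classes of) extended real valued measurable functions on $I$. For $x\in L^0$: $d_x(\lambda)=\mu\{s\in I:|x(s)|>\lambda\}$, $x^*(t)=\inf\{\lambda>0:d_x(\lambda)\le t\}$, $x^{**}(t)=\frac1t\int_0^t x^*(s)\,ds$; $x\prec y$ means $x^{**}(t)\le y^{**}(t)$ for all $t>0$. For a nonnegative measurable weight $w$, $\Gamma_{p,w}=\{x\in L^0:\|x\|_{\Gamma_{p,w}}=(\int_0^\alpha (x^{**}(t))^p w(t)\,dt)^{1/p}<\infty\}$. The weight $w$ belongs to the class $D_p$ if $W(s)=\int_0^s w(t)\,dt<\infty$ and $W_p(s)=s^p\int_s^\alpha t^{-p}w(t)\,dt<\infty$ for all $0<s\le1$ if $\alpha=1$ and for all $0<s<\infty$ if $\alpha=\infty$. A Banach space $X$ is approximatively compact if every (nonempty) closed convex $C\subset X$ has the property that for any $x\in X$ and any $(x_n)\subset C$ with $\|x_n-x\|_X\to\inf_{y\in C}\|y-x\|_X$, the sequence $(x_n)$ has a Cauchy subsequence. A Banach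 function space $E$ is order continuous if for every $x\in E$ and every sequence of nonnegative $x_n\in E$ with $x_n\le|x|$ and $x_n\to0$ a.e. one has $\|x_n\|_E\to0$; it is reflexive if $E$ and its associate space $E'=\{y\in L^0:\int_I|xy|\,d\mu<\infty\ \forall x\in E\}$ (with norm $\sup\{\int_I|xy|\,d\mu:\|x\|_E\le1\}$) are both order continuous (for spaces with the Fatou property, such as $\Gamma_{p,w}$, this is the usual reflexivity). A symmetric (rearrangement invariant) space $E$ is strictly $K$-monotone if $x,y\in E$, $x\prec y$, $x^*\ne y^*$ imply $\|x\|_E<\|y\|_E$. *)

(* Defs.v *)
From HB Require Import structures.
From mathcomp Require Import all_boot all_order all_algebra.
From mathcomp Require Import all_classical all_reals all_analysis.
From mathcomp Require Import measurable_realfun.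

Set Implicit Arguments.
Unset Strict Implicit.
Unset Printing Implicit Defensive.

Import Order.TTheory GRing.Theory Num.Theory.
Import numFieldNormedType.Exports.

Local Open Scope classical_set_scope.
Local Open Scope ring_scope.
Local Open Scope ereal_scope.

(* [0, alpha), where alpha may be +oo. *)
Definition itvI (R : realType) (alpha : \bar R) : set R :=
  [set s | (0 <= s)%R /\ s%:E < alpha].

Section function_spaces.
Context (R : realType) (alpha : \bar R).
Implicit Types (x y : R -> \bar R) (s t : R).

Local Notation mu := (@lebesgue_measure R).
Local Notation I := (itvI alpha).

(* Elements of L^0 are represented by functions on R of which only the values
   on I matter; two representatives of the same class are related by aeqI.
   Measurability is Borel measurability: every class of Lebesgue measurable
   functions has a Borel representative. *)
Definition L0 : set (R -> \bar R) := [set x : R -> \bar R | measurable_fun I x].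

Definition aeI (P : R -> Prop) : Prop := {ae mu, forall s, I s -> P s}.

Definition aeqI x y : Prop := aeI (fun s => x s = y s).

Definition distr_fun x (lambda : R) : \bar R :=
  mu [set s | I s /\ lambda%:E < `|x s|].

Definition rearr x t : \bar R :=
  ereal_inf [set lambda%:E | lambda in
    [set lambda : R | (0 < lambda)%R /\ distr_fun x lambda <= t%:E]].

Definition max_rearr x t : \bar R :=
  (t^-1)%:E * \int[mu]_(s in `[0%R, t[) rearr x s.

Definition maj x y : Prop :=
  forall t, (0 < t)%R -> max_rearr x t <= max_rearr y t.

(* A space of (classes of) functions on I: its elements and its norm.  The
   values of the norm outside the carrier are irrelevant. *)
Record fspace := FSpace {
  carrier : set (R -> \bar R);
  fnorm : (R -> \bar R) -> \bar R }.

Implicit Type X : fspace.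

Definition fscale (c : R) x : R -> \bar R := fun s => c%:E * x s.

Definition cauchy_seq X (u : nat -> R -> \bar R) : Prop :=
  forall e : R, (0 < e)%R -> exists N : nat, forall m n,
    (N <= m)%N -> (N <= n)%N -> fnorm X (u m \- u n) < e%:E.

(* In \bar R the sum -oo + +oo is -oo; as the elements are required to be
   a.e. finite, this affects pointwise sums only on null sets. *)
Record banach_space X : Prop := BanachSpace {
  bs_L0 : carrier X `<=` L0;
  bs_fin : forall x, carrier X x -> aeI (fun s => x s \is a fin_num);
  bs_zero : carrier X (cst 0);
  bs_add : forall x y, carrier X x -> carrier X y -> carrier X (x \+ y);
  bs_scale : forall c x, carrier X x -> carrier X (fscale c x);
  bs_norm_fin : forall x, carrier X x -> 0 <= fnorm X x < +oo;
  bs_norm_eq0 : forall x, carrier X x -> (fnorm X x = 0 <-> aeqI x (cst 0));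
  bs_norm_scale : forall c x, carrier X x ->
    fnorm X (fscale c x) = `|c|%:E * fnorm X x;
  bs_norm_add : forall x y, carrier X x -> carrier X y ->
    fnorm X (x \+ y) <= fnorm X x + fnorm X y;
  bs_complete : forall u : nat -> R -> \bar R, (forall n, carrier X (u n)) ->
    cauchy_seq X u ->
    exists2 x, carrier X x & fnorm X (u n \- x) @[n --> \oo] --> 0 }.

Definition convex_in (C : set (R -> \bar R)) : Prop :=
  forall x y (c : R), C x -> C y -> (0 <= c <= 1)%R ->
    C (fscale c x \+ fscale (1 - c) y).

(* C contains every point of X adherent to it; in particular C is then stable
   under a.e. equality, i.e. it is a set of classes. *)
Definition closed_in X (C : set (R -> \bar R)) : Prop :=
  forall x, carrier X x ->
    (forall e : R, (0 < e)%R -> exists2 y, C y & fnorm X (y \- x) < e%:E) ->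
    C x.

Definition dist_to X (C : set (R -> \bar R)) x : \bar R :=
  ereal_inf [set fnorm X (y \- x) | y in C].

(* The notion only makes sense for Banach spaces; being one is not automatic
   for Gamma p w below, whose norm vanishes identically when w = 0 a.e. *)
Definition approx_compact X : Prop :=
  banach_space X /\
  forall C : set (R -> \bar R),
    C `<=` carrier X -> C !=set0 -> convex_in C -> closed_in X C ->
    forall x (u : nat -> R -> \bar R), carrier X x -> (forall n, C (u n)) ->
      fnorm X (u n \- x) @[n --> \oo] --> dist_to X C x ->
      exists phi : nat -> nat,
        {homo phi : m n / (m < n)%N} /\ cauchy_seq X (u \o phi).

Definition order_continuous X : Prop :=
  forall x (u : nat -> R -> \bar R), carrier X x ->
    (forall n, carrier X (u n)) ->
    (forall n, aeI (fun s => 0 <= u n s <= `|x s|)) ->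
    aeI (fun s => u n s @[n --> \oo] --> 0) ->
    fnorm X (u n) @[n --> \oo] --> 0.

Definition associate X : fspace := FSpace
  [set y | L0 y /\
     forall x, carrier X x -> \int[mu]_(s in I) `|x s * y s| < +oo]
  (fun y => ereal_sup [set \int[mu]_(s in I) `|x s * y s| |
     x in [set x | carrier X x /\ fnorm X x <= 1]]).

(* Reflexivity of a Banach function space with the Fatou property, in its
   lattice form. *)
Definition reflexive_space X : Prop :=
  order_continuous X /\ order_continuous (associate X).

Definition strictly_K_monotone X : Prop :=
  forall x y, carrier X x -> carrier X y -> maj x y ->
    (exists2 t, (0 <= t)%R & rearr x t <> rearr y t) ->
    fnorm X x < fnorm X y.

Section weighted.
Variables (p : R) (w : R -> R).

Definition W s : \bar R := \int[mu]_(t in `[0%R, s[) (w t)%:E.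

Definition Wp s : \bar R :=
  (s `^ p)%:E *
  \int[mu]_(t in [set t | (s <= t)%R /\ t%:E < alpha]) (t `^ (- p) * w t)%:E.

Definition class_D : Prop :=
  forall s, (0 < s)%R -> s%:E <= alpha -> W s < +oo /\ Wp s < +oo.

Definition Gamma_norm x : \bar R :=
  (\int[mu]_(t in I) (max_rearr x t `^ p * (w t)%:E)) `^ p^-1.

Definition Gamma : fspace :=
  FSpace [set x | L0 x /\ Gamma_norm x < +oo] Gamma_norm.

End weighted.

End function_spaces.

(* Main.v *)
(* Let K x t be the integral of x^* over [0, t), so that x ** = K x t / t.  Splitting
   x^* at a level gives K x t <= l t + int (|x| - l)^+, with equality at l = x^*(t);
   all the facts needed about rearrangements follow from this formula.

   Call w good if W is finite and strictly increasing, W is unbounded when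
   alpha = oo, and the integral of t^-p w diverges at 0.  All the conditions of the
   theorem are equivalent to w being good.

   If w is good, let u_n be bounded with midpoints asymptotically as long as the u_n.
   Uniform convexity of L^p(w), applied to u_n **, gives convergence of K u_n t and
   K u_m t + K u_n t - K (u_m + u_n) t -> 0 for every t.  The second defect controls
   u_m - u_n: if two reals a and b differ, some level l of a finite grid separates
   |a| from |b| or sees a and b with opposite signs, so that
   (|a| - l)^+ + (|b| - l)^+ - (|a + b| - 2 l)^+ is bounded below.  Dominated
   convergence then shows that u_n is Cauchy.  So minimizing sequences of convex sets are Cauchy, which gives
   approximative compactness, and also the order continuity of the associate space,
   because almost norm-minimal elements of {z >= 0 : int z V_n >= e} are Cauchy,
   hence have a dominated subsequence.

   Conversely, bumps with unbounded height or support contradict (i) or reflexivity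
   when W is bounded or t^-p w is integrable at 0.  If W is flat on [a, b], the
   functions equal to 2 on [0, a) and to 1 + r on [a, b), with r of mean 0, all have
   the same norm and lie on a supporting hyperplane: this contradicts strict
   K-monotonicity and, with r a sequence of cosine waves, approximative
   compactness. *)
Require Import Defs.
From HB Require Import structures.
From mathcomp Require Import all_boot all_order all_algebra.
From mathcomp Require Import all_classical all_reals all_analysis.
From mathcomp Require Import measurable_realfun ring lra zify.
Import Order.TTheory GRing.Theory Num.Theory.
Import numFieldNormedType.Exports.
Set Implicit Arguments.
Unset Strict Implicit.
Unset Printing Implicit Defensive.
Local Open Scope classical_set_scope.
Local Open Scope ring_scope.

(** * Rearrangements and the K-functional *)

(** Uniform convexity is available only for the functions [x **], and many x share the same [x **]:
    convergence of [u_n **] in L^p(w) says nothing yet about u_m - u_n. The way back uses that K x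
    (in t) and the excess (in l) are Legendre transforms of each other: the norm sees K x, while the
    excess is the integral of a pointwise quantity and can see signs and values. Only finitely many
    times and levels can be handled at once, and each clause of a good weight cuts off one end.
    Strict increase of W turns convergence in L^p(w) into convergence at each t; divergence of the
    integral of t^-p w makes K x t small near 0 uniformly on balls, which disposes of high levels;
    unboundedness of W makes K x t / t small for large t, which disposes of large times. Conversely,
    closed convex sets with a computable minimal norm have to be exhibited. For integrable t^-p w
    and for flat W they are half-spaces of the positive cone, cut by a function for which Young's
    inequality is sharp in the limit. For bounded W no integral functional sees mass escaping to
    infinity, and the set is described by asymptotic behaviour instead. *)

Section layer_cake.
Context (R : realType).
Local Open Scope ereal_scope.
Local Notation mu := (@lebesgue_measure R).

Lemma measurable_itvI (c : \bar R) : measurable (itvI c).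
Proof.
apply: is_interval_measurable => s t [s0 sc] [t0 tc] r /andP[sr rt]; split.
  exact: le_trans sr.
by rewrite (le_lt_trans _ tc)// lee_fin.
Qed.

Lemma lebesgue_measure_itvI (c : \bar R) : 0 <= c -> mu (itvI c) = c.
Proof.
case: c => [c||]// c0.
- rewrite (_ : itvI _ = `[0%R, c[%classic); last first.
    by apply/seteqP; split=> s; rewrite /itvI/= in_itv/= lte_fin => /andP.
  rewrite lebesgue_measure_itv/= lte_fin oppr0 adde0.
  by case: ltP => // c_le0; congr EFin; apply/esym/le_anti; rewrite c_le0 -lee_fin.
- rewrite (_ : itvI _ = `[0%R, +oo[%classic); last first.
    apply/seteqP; split=> s; rewrite /itvI/= in_itv/= andbT ?ltry; first by case.
    by split.
  by rewrite lebesgue_measure_itv/= ltry oppr0 addye.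
Qed.

(** Superlevel sets of a monotone function on an interval are intervals. *)
Lemma nonincreasing_emeasurable (D : set R) (f : R -> \bar R) :
  is_interval D -> (forall s t, D s -> D t -> (s <= t)%R -> f t <= f s) ->
  measurable_fun D f.
Proof.
move=> iD df mD; apply: (measurability _ (ErealGenOInfty.measurableE R)) => //.
move=> _ [_ [x ->] <-]; apply: is_interval_measurable => s t [Ds /= xs] [Dt xt].
move=> r rst; have Dr := iD _ _ Ds Dt _ rst.
split => //=; move: xs xt; rewrite !in_itv/= !andbT => xs xt.
by apply: lt_le_trans xt _; apply: df => //; case/andP: rst.
Qed.

(* Tonelli applied to the indicator of the subgraph of f. *)
Lemma ge0_integral_layer_cake (D : set R) (f : R -> \bar R) :
  measurable D -> measurable_fun D f -> (forall s, D s -> 0 <= f s) ->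
  \int[mu]_(s in D) f s =
  \int[mu]_(u in `[0%R, +oo[) mu (D `&` [set s | u%:E < f s]).
Proof.
move=> mD mf f0.
pose B : set (R * R) := [set z | D z.1 /\ (0 <= z.2)%R /\ z.2%:E < (f \_ D) z.1].
have mB : measurable B.
  have -> : B = (D `*` `[0%R, +oo[) `&`
      [set z | (EFin \o snd) z < ((f \_ D) \o fst) z].
    apply/seteqP; split => [[s u]/= [Ds [u0 us]]|[s u]/=].
      by rewrite in_itv/= andbT.
    by rewrite in_itv/= andbT => -[[Ds u0]].
  apply: measurable_lte; first by apply: measurableX.
    by apply: measurable_funTS; apply: measurableT_comp => //; exact: measurable_snd.
  apply: measurable_funTS; apply: measurableT_comp => //.
  exact/(measurable_restrictT _ mD).
rewrite integral_mkcond [RHS]integral_mkcond.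
transitivity (\int[mu]_x fubini_F mu (EFin \o \1_B) x).
  rewrite indic_fubini_tonelli_FE//; apply: eq_integral => s _ /=.
  rewrite patchE; case: ifPn => [/set_mem Ds|sD].
    rewrite -[LHS](@lebesgue_measure_itvI (f s)) ?f0//; congr (mu _).
    apply/seteqP; split=> [u [u0 us]|u]; rewrite /xsection/= inE /B/= patchE mem_set//.
    by case=> _ [].
  rewrite (_ : xsection _ _ = set0) ?measure0//.
  by apply/seteqP; split => u//; rewrite /xsection/= inE => -[/= Ds]; rewrite mem_set in sD.
rewrite indic_fubini_tonelli//.
rewrite indic_fubini_tonelli_GE//; apply: eq_integral => u _ /=.
rewrite patchE; case: ifPn => [|uD].
  rewrite inE/= in_itv/= andbT => u0; congr (mu _).
  apply/seteqP; split=> [s|s [Ds us]]; rewrite /ysection/= inE /B/= patchE.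
    by case=> Ds [_]; rewrite mem_set.
  by rewrite mem_set.
rewrite (_ : ysection _ _ = set0) ?measure0//.
apply/seteqP; split => s//; rewrite /ysection/= inE => -[/= Ds [u0 _]].
by rewrite notin_setE/= in_itv/= andbT in uD.
Qed.

Lemma eq_distr_integral (D1 D2 : set R) (f1 f2 : R -> \bar R) :
  measurable D1 -> measurable D2 -> measurable_fun D1 f1 -> measurable_fun D2 f2 ->
  (forall s, D1 s -> 0 <= f1 s) -> (forall s, D2 s -> 0 <= f2 s) ->
  (forall u : R, (0 <= u)%R -> mu (D1 `&` [set s | u%:E < f1 s]) =
                mu (D2 `&` [set s | u%:E < f2 s])) ->
  \int[mu]_(s in D1) f1 s = \int[mu]_(s in D2) f2 s.
Proof.
move=> mD1 mD2 mf1 mf2 f10 f20 f12.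
rewrite [LHS]ge0_integral_layer_cake// [RHS]ge0_integral_layer_cake//.
by apply: eq_integral => u; rewrite inE/= in_itv/= andbT => /f12.
Qed.

End layer_cake.

Section rearrangement.
Context (R : realType) (alpha : \bar R).
Local Open Scope ereal_scope.
Local Notation mu := (@lebesgue_measure R).
Local Notation I := (itvI alpha).
Implicit Types (x y : R -> \bar R) (s t l : R).

Definition excess l x : \bar R := \int[mu]_(s in I) maxe (`|x s| - l%:E) 0.

(* The K-functional of x for the couple (L^1, L^oo). *)
Definition Kfun x t : \bar R := \int[mu]_(s in `[0%R, t[) rearr alpha x s.

Lemma max_rearrE x t : max_rearr alpha x t = (t^-1)%:E * Kfun x t.
Proof. by []. Qed.

Lemma measurable_distr x l : L0 alpha x -> measurable [set s | I s /\ l%:E < `|x s|].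
Proof.
move=> mx; apply: (emeasurable_fun_o_infty (D := I) (f := abse \o x)).
  exact: measurable_itvI.
exact: measurableT_comp.
Qed.

Lemma distr_le x l l' : L0 alpha x -> (l <= l')%R ->
  distr_fun alpha x l' <= distr_fun alpha x l.
Proof.
move=> mx ll; apply: le_measure; rewrite ?inE; try exact: measurable_distr.
by move=> s [Is ls]; split => //; apply: le_lt_trans ls; rewrite lee_fin.
Qed.

(** Continuity of the measure from below along the levels l + 1 / (n + 1), whose superlevel sets
    exhaust that of l. *)
Lemma distr_right_cont x l t : L0 alpha x -> t%:E < distr_fun alpha x l ->
  exists2 l', (l < l')%R & t%:E < distr_fun alpha x l'.
Proof.
move=> mx tl.
pose F n := [set s | I s /\ (l + n.+1%:R^-1)%:E < `|x s|].
have FE : \bigcup_n F n = [set s | I s /\ l%:E < `|x s|].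
  apply/seteqP; split => [s [n _ [Is ls]]|s [Is ls]].
    by split => //; apply: lt_trans ls; rewrite lte_fin ltrDl.
  have [e e0 le] : exists2 e, (0 < e)%R & (l + e)%:E < `|x s|.
    move: ls; case: `|x s| => [r||]//; last by exists 1%R; rewrite ?ltry.
    rewrite lte_fin => lr; exists ((r - l) / 2)%R; first by rewrite divr_gt0// subr_gt0.
    by rewrite lte_fin; lra.
  have [n] := ltr_add_invr e0; rewrite add0r => ne.
  exists n => //; split => //; apply: lt_trans le.
  by rewrite lte_fin ltrD2l.
have ndF : {homo F : n m / (n <= m)%N >-> (n <= m)%O}.
  move=> m n mn; rewrite subsetEset => s [Is ls]; split => //.
  by apply: le_lt_trans ls; rewrite lee_fin lerD2l lef_pV2 ?posrE// ler_nat.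
have Fcvg : (mu \o F) n @[n --> \oo] --> mu (\bigcup_n F n).
  apply: nondecreasing_cvg_mu => //; first by move=> n; exact: measurable_distr.
  by rewrite FE; exact: measurable_distr.
have nd : {homo mu \o F : n m / (n <= m)%N >-> n <= m}.
  move=> m n mn; apply: le_measure; rewrite ?inE; try exact: measurable_distr.
  exact/subsetPset/ndF.
have := cvg_unique _ Fcvg (ereal_nondecreasing_cvgn nd); rewrite FE => E.
have /ereal_sup_gt[_ [n _ <-] tn] : t%:E < ereal_sup (range (mu \o F)).
  by rewrite -E.
by exists (l + n.+1%:R^-1)%R => //; rewrite ltrDl.
Qed.

Lemma rearr_ge0 x t : 0 <= rearr alpha x t.
Proof. by apply/ereal_infP => _ [l [l0 _] <-]; rewrite lee_fin ltW. Qed.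

Lemma rearr_le x l t : (0 < l)%R -> distr_fun alpha x l <= t%:E ->
  rearr alpha x t <= l%:E.
Proof. by move=> l0 lt; apply: ge_ereal_inf; exists l%:E => //; exists l. Qed.

(** The infimum defining x^* inverts the distribution function, strict inequalities included,
    because the latter is right continuous. The level 0 needs care, since the infimum runs over
    positive levels only. *)
Lemma lt_rearr x l t : L0 alpha x -> (0 <= l)%R ->
  (l%:E < rearr alpha x t) = (t%:E < distr_fun alpha x l).
Proof.
move=> mx l0; apply/idP/idP.
  apply: contraTT; rewrite -!leNgt => dt.
  have [l_gt0|] := ltP 0%R l; first exact: rearr_le.
  move=> l_le0; have {l_le0}l0E : l = 0%R by apply/le_anti; rewrite l0 l_le0.
  subst l; apply/lee_addgt0Pr => e e0; rewrite add0e; apply: rearr_le => //.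
  by apply: le_trans dt; apply: distr_le => //; exact: ltW.
move=> tl; have [l' ll' tl'] := distr_right_cont mx tl.
apply: (@lt_le_trans _ _ l'%:E); first by rewrite lte_fin.
apply/ereal_infP => _ [m [m0 mt] <-]; rewrite lee_fin leNgt; apply/negP => ml'.
have := lt_le_trans tl' (le_trans (distr_le mx (ltW ml')) mt).
by rewrite ltxx.
Qed.

Lemma rearr_leE x l t : L0 alpha x -> (0 <= l)%R ->
  (rearr alpha x t <= l%:E) = (distr_fun alpha x l <= t%:E).
Proof. by move=> mx l0; rewrite !leNgt lt_rearr. Qed.

Lemma rearr_nincr x s t : (s <= t)%R -> rearr alpha x t <= rearr alpha x s.
Proof.
move=> st; apply: le_ereal_inf => _ [l [l0 ls] <-]; exists l => //; split => //.
by apply: (le_trans ls); rewrite lee_fin.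
Qed.

Lemma measurable_rearr x (D : set R) : is_interval D -> measurable_fun D (rearr alpha x).
Proof. by move=> iD; apply: nonincreasing_emeasurable => // s t _ _; exact: rearr_nincr. Qed.

Lemma measurable_excess_fun x l : L0 alpha x ->
  measurable_fun I (fun s => maxe (`|x s| - l%:E) 0).
Proof.
move=> mx; apply: measurable_maxe => //; apply: emeasurable_funB => //.
exact: (measurableT_comp (f := abse)).
Qed.

(** Equimeasurability of x^* and |x|: by [lt_rearr], the set where x^* exceeds u + l is the interval
    [0, d_x(u + l)), whose length is again d_x(u + l). *)
Lemma integral_rearr_excess x l : L0 alpha x -> (0 <= l)%R ->
  \int[mu]_(s in `[0%R, +oo[) maxe (rearr alpha x s - l%:E) 0 = excess l x.
Proof.
move=> mx l0; apply: eq_distr_integral => //.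
- exact: measurable_itvI.
- apply: measurable_maxe => //; apply: emeasurable_funB => //.
  apply: measurable_rearr; exact: interval_is_interval.
- exact: measurable_excess_fun.
- by move=> *; rewrite le_max lexx orbT.
- by move=> *; rewrite le_max lexx orbT.
move=> u u0; transitivity (distr_fun alpha x (u + l)).
  rewrite -[RHS]lebesgue_measure_itvI ?measure_ge0//; congr (mu _).
  apply/seteqP; split => s; rewrite /itvI/= in_itv/= andbT lt_max;
      rewrite [X in _ || X](lte_fin u) [X in _ || X]ltNge u0 orbF ?EFinN lteBrDr// -EFinD lt_rearr// ?addr_ge0//.
congr (mu _); apply/seteqP; split => s/=; rewrite lt_max lte_fin [X in _ || X]ltNge u0 orbF ?EFinN lteBrDr//.
Qed.

(* Split x^* at the level l, which it crosses at t. *)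
Lemma Kfun_eq x l t : L0 alpha x -> (0 <= l)%R -> (0 <= t)%R ->
  (forall s, (0 <= s < t)%R -> l%:E <= rearr alpha x s) ->
  (forall s, (t <= s)%R -> rearr alpha x s <= l%:E) ->
  Kfun x t = (l * t)%:E + excess l x.
Proof.
move=> mx l0 t0 ge_l le_l.
have mr (D : set R) : is_interval D -> measurable_fun D (fun s => maxe (rearr alpha x s - l%:E) 0).
  move=> iD; apply: measurable_maxe => //; apply: emeasurable_funB => //.
  exact: measurable_rearr.
have r0 s : 0 <= maxe (rearr alpha x s - l%:E) 0 by rewrite le_max lexx orbT.
rewrite -integral_rearr_excess//.
rewrite (_ : `[0%R, +oo[%classic = `[0%R, t[ `|` `[t, +oo[); last first.
  by rewrite -itv_bndbnd_setU// bnd_simp.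
rewrite ge0_integral_setU//=; first last.
- by apply/disj_setPRL => s /=; rewrite !in_itv/= andbT => ts; rewrite ltNge ts andbF.
- by rewrite -itv_bndbnd_setU ?bnd_simp//; apply: mr; exact: interval_is_interval.
rewrite [X in _ + (_ + X)]integral0_eq ?adde0; last first.
  move=> s /=; rewrite in_itv/= andbT => ts; apply/max_idPr.
  by rewrite ?EFinN sube_le0 le_l.
transitivity (\int[mu]_(s in `[0%R, t[) (l%:E + maxe (rearr alpha x s - l%:E) 0)).
  apply: eq_integral => s; rewrite inE/= in_itv/= => s0t.
  by rewrite ?EFinN (max_idPl _) ?sube_ge0 ?ge_l//  addeC subeK.
rewrite ge0_integralD//=; last first.
  Show. apply: mr; exact: interval_is_interval.
rewrite integral_cst//= lebesgue_measure_itv/= lte_fin.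
case: ltP => t0'; first by rewrite oppr0 adde0.
by rewrite (_ : t = 0%R) ?mulr0 ?mule0//; apply/le_anti; rewrite t0 t0'.
Qed.

End rearrangement.

Section Kfunctional.
Context (R : realType) (alpha : \bar R).
Local Open Scope ereal_scope.
Local Notation mu := (@lebesgue_measure R).
Local Notation I := (itvI alpha).
Local Notation L0 := (@L0 R alpha).
Local Notation rearr := (rearr alpha).
Local Notation Kfun := (Kfun alpha).
Local Notation excess := (excess alpha).
Implicit Types (x y : R -> \bar R) (s t l : R).

Lemma excess_part_ge0 (a : \bar R) l : 0 <= maxe (a - l%:E) 0.
Proof. by rewrite le_max lexx orbT. Qed.

Lemma le_excess_part (a : \bar R) l : a <= l%:E + maxe (a - l%:E) 0.
Proof. by rewrite addeC -leeBlDr// le_max lexx. Qed.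

Lemma excess_part_le (a b : \bar R) l : 0 <= b -> a <= l%:E + b -> maxe (a - l%:E) 0 <= b.
Proof. by move=> b0 ab; rewrite ge_max b0 andbT leeBlDr// addeC. Qed.

Lemma excess_ge0 x l : 0 <= excess l x.
Proof. by apply: integral_ge0 => *; exact: excess_part_ge0. Qed.

Lemma Kfun_ge0 x t : 0 <= Kfun x t.
Proof. by apply: integral_ge0 => *; exact: rearr_ge0. Qed.

Lemma Kfun_nd x s t : (s <= t)%R -> Kfun x s <= Kfun x t.
Proof.
move=> st; apply: ge0_subset_integral => //=.
- apply: measurable_rearr; exact: interval_is_interval.
- by move=> *; exact: rearr_ge0.
- by move=> r /=; rewrite !in_itv/= => /andP[-> rs]; exact: lt_le_trans rs st.
Qed.

Lemma Kfun0 x : Kfun x 0 = 0.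
Proof. by rewrite /Kfun set_itvco0 integral_set0. Qed.

Lemma integral_itv_cst l t : (0 <= t)%R -> \int[mu]_(s in `[0%R, t[) l%:E = (l * t)%:E.
Proof.
move=> t0; rewrite integral_cst//= lebesgue_measure_itv/= lte_fin.
case: ltP => t0'; first by rewrite oppr0 adde0.
by rewrite (_ : t = 0%R) ?mulr0 ?mule0//; apply/le_anti; rewrite t0 t0'.
Qed.

(** x^* <= l + (x^* - l)^+ is integrated over [0, t), and the last term is enlarged to the whole
    half-line. *)
Lemma Kfun_le x l t : L0 x -> (0 <= l)%R -> (0 <= t)%R ->
  Kfun x t <= (l * t)%:E + excess l x.
Proof.
move=> mx l0 t0.
have mr (D : set R) : is_interval D -> measurable_fun D (fun s => maxe (rearr x s - l%:E) 0).
  move=> iD; apply: measurable_maxe => //; apply: emeasurable_funB => //.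
  exact: measurable_rearr.
have mrt : measurable_fun `[0%R, t[ (fun s => maxe (rearr x s - l%:E) 0).
  by apply: mr; exact: interval_is_interval.
apply: (@le_trans _ _ (\int[mu]_(s in `[0%R, t[) (l%:E + maxe (rearr x s - l%:E) 0))).
  apply: ge0_le_integral => //=.
  - by move=> *; exact: rearr_ge0.
  - by apply: measurable_rearr; exact: interval_is_interval.
  - exact: emeasurable_funD.
  - by move=> s _; exact: le_excess_part.
rewrite ge0_integralD//=; last by move=> *; exact: excess_part_ge0.
rewrite integral_itv_cst// leeD2l// -integral_rearr_excess//.
apply: ge0_subset_integral => //=.
- by apply: mr; exact: interval_is_interval.
- by move=> *; exact: excess_part_ge0.
- by move=> r /=; rewrite !in_itv/= andbT => /andP[].
Qed.

Lemma Kfun_fin_rearr x t : (0 < t)%R -> Kfun x t < +oo ->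
  exists2 l, (0 <= l)%R & rearr x t = l%:E.
Proof.
move=> t0 Kf.
have : rearr x t * t%:E <= Kfun x t.
  have -> : t%:E = mu `[0%R, t[.
    by rewrite lebesgue_measure_itv/= lte_fin t0 oppr0 adde0.
  rewrite -integral_cst//; apply: ge0_le_integral => //=.
  - by move=> *; exact: rearr_ge0.
  - by apply: measurable_rearr; exact: interval_is_interval.
  - by move=> s; rewrite /= in_itv/= => /andP[_ /ltW]; exact: rearr_nincr.
have := rearr_ge0 alpha x t; case: (rearr x t) => [l||]// l0 lK; first by exists l.
by move: lK; rewrite gt0_mulye ?lte_fin// leye_eq => /eqP E; rewrite E ltxx in Kf.
Qed.

Lemma Kfun_rearr x l t : L0 x -> (0 <= l)%R -> (0 <= t)%R -> rearr x t = l%:E ->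
  Kfun x t = (l * t)%:E + excess l x.
Proof.
move=> mx l0 t0 xl; apply: Kfun_eq => // s; rewrite -xl; last exact: rearr_nincr.
by case/andP=> _ /ltW; exact: rearr_nincr.
Qed.

(** K x t is thus a minimum over levels, reached at x^*(t). The bounds on K below come from testing
    [Kfun_le] at a level that is optimal for another time or another function. *)
Lemma Kfun_attained x t : L0 x -> (0 < t)%R -> Kfun x t < +oo ->
  exists l, [/\ (0 <= l)%R, rearr x t = l%:E & Kfun x t = (l * t)%:E + excess l x].
Proof.
move=> mx t0 /(Kfun_fin_rearr t0)[l l0 xl]; exists l; split => //.
by apply: Kfun_rearr => //; exact: ltW.
Qed.

(** Here the level is prescribed, and t = d_x(l) is the time at which x^* crosses it: the optimal
    time in the dual formula for the excess. *)
Lemma Kfun_distr x l t : L0 x -> (0 <= l)%R -> (0 <= t)%R -> distr_fun alpha x l = t%:E ->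
  Kfun x t = (l * t)%:E + excess l x.
Proof.
move=> mx l0 t0 xl; apply: Kfun_eq => // s st.
  by apply: ltW; rewrite lt_rearr// xl lte_fin; case/andP: st.
by rewrite rearr_leE// xl lee_fin.
Qed.

(** K x is concave and vanishes at 0, so K x t / t decreases; concretely, the level optimal at s is
    tested at t. *)
Lemma Kfun_ratio x s t : L0 x -> (0 < s)%R -> (s <= t)%R ->
  Kfun x t <= (t / s)%:E * Kfun x s.
Proof.
move=> mx s0 st; have t0 := lt_le_trans s0 st.
have [E|] := eqVneq (Kfun x s) +oo.
  by rewrite E gt0_muley ?leey// lte_fin divr_gt0.
rewrite -ltey => /(Kfun_attained mx s0)[l [l0 _ ->]].
apply: (le_trans (Kfun_le mx l0 (ltW t0))).
rewrite ge0_muleDr ?excess_ge0 ?lee_fin ?mulr_ge0 ?(ltW s0)//.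
rewrite -EFinM; apply: leeD.
  by rewrite lee_fin le_eqVlt; apply/orP; left; apply/eqP; field; rewrite gt_eqF.
rewrite -[leLHS]mul1e; apply: lee_pmul => //; rewrite ?excess_ge0// lee_fin.
by rewrite ler_pdivlMr// mul1r.
Qed.

Lemma excess_nincr x l l' : L0 x -> (l <= l')%R -> excess l' x <= excess l x.
Proof.
move=> mx ll; apply: ge0_le_integral; first exact: measurable_itvI.
- by move=> *; exact: excess_part_ge0.
- exact: measurable_excess_fun.
- exact: measurable_excess_fun.
- move=> s _; apply: excess_part_le; first exact: excess_part_ge0.
  by apply: (le_trans (le_excess_part _ l)); rewrite leeD2r// lee_fin.
Qed.

Lemma Kfun_le_level x l t : L0 x -> (0 < t)%R -> Kfun x t <= (l * t)%:E ->
  rearr x t <= l%:E.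
Proof.
move=> mx t0 Kl; have [|m [m0 -> E]] := Kfun_attained mx t0; first exact: le_lt_trans Kl (ltry _).
rewrite lee_fin -(ler_pM2r t0) -lee_fin; apply: le_trans Kl.
by rewrite E leeDl// excess_ge0.
Qed.

(** The hypothesis puts x^*(t) below l, and the excess at the level x^*(t) is a part of K x t. *)
Lemma excess_le_Kfun x l t : L0 x -> (0 < t)%R -> Kfun x t <= (l * t)%:E ->
  excess l x <= Kfun x t.
Proof.
move=> mx t0 Kl; have [|m [m0 xm E]] := Kfun_attained mx t0; first exact: le_lt_trans Kl (ltry _).
have := Kfun_le_level mx t0 Kl; rewrite xm lee_fin => /(excess_nincr mx) h.
by apply: (le_trans h); rewrite E leeDr// lee_fin mulr_ge0// ltW.
Qed.

Lemma distr_le_Kfun x l t : L0 x -> (0 <= l)%R -> (0 < t)%R -> Kfun x t <= (l * t)%:E ->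
  distr_fun alpha x l <= t%:E.
Proof. by move=> mx l0 t0 Kl; rewrite -rearr_leE//; exact: Kfun_le_level. Qed.

(* The Legendre transform [excess l x = sup_t (Kfun x t - l t)] evaluated on a
   grid; the mesh costs at most [l * e]. *)
Lemma excess_grid x l (e : R) J : L0 x -> (0 <= l)%R -> (0 < e)%R -> (0 < J)%N ->
  distr_fun alpha x l <= (J%:R * e)%:E ->
  exists2 j, (0 < j <= J)%N &
    excess l x + (l * (j%:R * e))%:E <= Kfun x (j%:R * e) + (l * e)%:E.
Proof.
move=> mx l0 e0 J0 dJ.
have [t [t0 xt]] : exists t, (0 <= t)%R /\ distr_fun alpha x l = t%:E.
  have d0 : 0 <= distr_fun alpha x l by exact: measure_ge0.
  by move: dJ d0; case: (distr_fun _ _ _) => // t _ t0; exists t.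
rewrite xt lee_fin in dJ.
(* The first positive grid point to the right of the crossing time t; K x can only grow by rounding
   up. *)
have [j [j1 jJ tj jt]] : exists j, [/\ (0 < j)%N, (j <= J)%N, (t <= j%:R * e)%R & (j%:R * e <= t + e)%R].
  have ex : exists j, (0 < j)%N && (t <= j%:R * e)%R by exists J; rewrite J0.
  case: (ex_minnP ex) => m /andP[m0 tm] min.
  exists m; split => //; first by apply: min; rewrite J0.
  have [->|m_neq1] := eqVneq m 1%N; first by rewrite mul1r lerDr.
  rewrite leNgt; apply/negP => lt_m.
  suff /min : (0 < m.-1)%N && (t <= m.-1%:R * e)%R by lia.
  apply/andP; split; first by lia.
  have -> : (m.-1%:R = m%:R - 1 :> R)%R by rewrite -subn1 natrB.
  by rewrite mulrBl mul1r; lra.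
exists j; first by rewrite j1.
have := Kfun_nd x tj; rewrite (Kfun_distr mx l0 t0 xt) => h.
apply: (@le_trans _ _ ((l * t)%:E + excess l x + (l * e)%:E)); last exact: leeD2r.
rewrite addeC addeAC leeD2r// -EFinD lee_fin -mulrDr ler_wpM2l//.
Qed.

(** Hardy-Littlewood inequality: |x| <= l + (|x| - l)^+ is integrated over A, at the level optimal
    for t. *)
Lemma integral_le_Kfun x t (A : set R) : L0 x -> (0 < t)%R -> measurable A ->
  A `<=` I -> mu A <= t%:E -> \int[mu]_(s in A) `|x s| <= Kfun x t.
Proof.
move=> mx t0 mA AI At.
have [->|] := eqVneq (Kfun x t) +oo; first by rewrite leey.
rewrite -ltey => /(Kfun_attained mx t0)[l [l0 _ ->]].
have mxA : measurable_fun A x by apply: measurable_funS mx => //; exact: measurable_itvI.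
have mxA' : measurable_fun A (abse \o x) by exact: (measurableT_comp (f := abse)).
have mxE : measurable_fun A (fun s => maxe (`|x s| - l%:E) 0).
  by apply: measurable_maxe => //; apply: emeasurable_funB.
apply: (@le_trans _ _ (\int[mu]_(s in A) (l%:E + maxe (`|x s| - l%:E) 0))).
  apply: ge0_le_integral => //=; first exact: emeasurable_funD.
  by move=> s _; exact: le_excess_part.
rewrite ge0_integralD//=; last by move=> *; exact: excess_part_ge0.
rewrite integral_cst//=; apply: leeD; first by rewrite EFinM lee_pmul.
apply: ge0_subset_integral => //; [exact: measurable_itvI | exact: measurable_excess_fun|].
by move=> *; exact: excess_part_ge0.
Qed.

End Kfunctional.

(** * Subadditivity and midpoint defects *)

Section separation.
Context (R : realType).
Implicit Types (a b e l u : R) (k n : nat).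

Definition excr l u : R := Num.max (`|u| - l) 0.

(* The defect, at level l, of the triangle inequality for excesses at a + b. *)
Definition gap l a b : R := excr l a + excr l b - excr (2 * l) (a + b).

Lemma excr_ge0 l u : 0 <= excr l u.
Proof. by rewrite le_max lexx orbT. Qed.

Lemma excrE l u : (excr l u = `|u| - l /\ l <= `|u|) \/ (excr l u = 0 /\ `|u| <= l).
Proof.
rewrite /excr; have [h|/ltW h] := lerP l `|u|; [left|right]; split => //.
  by rewrite max_l ?subr_ge0.
by rewrite max_r ?subr_le0.
Qed.

Lemma gap_ge0 l a b : 0 <= gap l a b.
Proof.
have := ler_normD a b; rewrite /gap.
by case: (excrE l a) (excrE l b) (excrE (2 * l) (a + b)) => -[-> ?] [] [-> ?] [] [-> ?]; lra.
Qed.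

Lemma gapC l a b : gap l a b = gap l b a.
Proof. by rewrite /gap [a + b]addrC [_ a + _]addrC. Qed.

(** a exceeds l by at least e, while |a + b| - 2 l <= |a| - l - e because b stays e below l. *)
Lemma gap_crossing l e a b : `|b| + e <= l -> l <= `|a| - e -> e <= gap l a b.
Proof.
have := ler_normD a b; rewrite /gap.
by case: (excrE l a) (excrE l b) (excrE (2 * l) (a + b)) => -[-> ?] [] [-> ?] [] [-> ?]; lra.
Qed.

(** The equation on |a - b| encodes opposite signs; then |a + b| is only the difference of |a| and
    |b|, and this cancellation creates the gap. *)
Lemma gap_opposite l a b : 0 < l -> `|a - b| = `|a| + `|b| -> 2 * l <= `|a| -> 2 * l <= `|b| ->
  l <= gap l a b.
Proof.
move=> l0 ab la lb; rewrite /gap.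
have E : `|a + b| = `| `|a| - `|b| |.
  move: ab; case: (ger0P a) => ?; case: (ger0P b) => ?; case: (ger0P (a - b)) => ?;
    do ?[case: ger0P => ?]; lra.
have ha : `|a| - l <= excr l a by rewrite le_max lexx.
have hb : `|b| - l <= excr l b by rewrite le_max lexx.
have [] := excrE (2 * l) (a + b); rewrite {}E; case: ger0P => ? -[-> _]; lra.
Qed.

(* If |a - b| >= 7 e and |b| is not close to n e, then either some level k e separates
   |a| from |b|, or a and b have opposite signs and the level e sees both of them.
   Such a level contributes at least e to the sum of the gaps. *)
Lemma separation_wlog e a b n : 0 < e -> (0 < n)%N -> `|b| <= `|a| ->
  excr (7 * e) (a - b) <= 2 * n%:R * (\sum_(1 <= k < n.+1) gap (k%:R * e) a b)
     + 2 * excr (n%:R * e) a.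
Proof.
move=> e0 n0 ba.
have S0 : 0 <= \sum_(1 <= k < n.+1) gap (k%:R * e) a b.
  by apply: sumr_ge0 => k _; exact: gap_ge0.
have n1 : 0 <= 2 * n%:R :> R by rewrite mulr_ge0.
have en0 := excr_ge0 (n%:R * e) a.
have ne0 : 0 <= n%:R * e by rewrite mulr_ge0// ltW.
have dab : `|a - b| <= `|a| + `|b| by rewrite (le_trans (ler_normB _ _)).
(* One gap of size e suffices: multiplied by 2 n it pays for 2 n e, and the rest of |a - b| <= 2 |a|
   is paid by twice the excess of a over n e. *)
have big k : (0 < k <= n)%N -> e <= gap (k%:R * e) a b ->
    excr (7 * e) (a - b) <= 2 * n%:R * (\sum_(1 <= k < n.+1) gap (k%:R * e) a b)
     + 2 * excr (n%:R * e) a.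
  move=> kn ek.
  have eS : e <= \sum_(1 <= k < n.+1) gap (k%:R * e) a b.
    rewrite (bigD1_seq k) ?iota_uniq//= ?mem_index_iota//.
    apply: (le_trans ek); rewrite lerDl; apply: sumr_ge0 => j _; exact: gap_ge0.
  have h : 2 * n%:R * e <= 2 * n%:R * (\sum_(1 <= k < n.+1) gap (k%:R * e) a b).
    exact: ler_wpM2l.
  have [[E1 ?]|[E1 ?]] := excrE (7 * e) (a - b); have [[E2 ?]|[E2 ?]] := excrE (n%:R * e) a;
    rewrite E1 E2; lra.
(* Origin of the 7: in the worst remaining case b has the sign opposite to a, |b| < 2 e and |a| <
   |b| + 3 e, so that |a - b| < 7 e. *)
have small : `|a - b| <= 7 * e + excr (n%:R * e) a ->
    excr (7 * e) (a - b) <= 2 * n%:R * (\sum_(1 <= k < n.+1) gap (k%:R * e) a b)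
     + 2 * excr (n%:R * e) a.
  move=> h; have : 0 <= 2 * n%:R * (\sum_(1 <= k < n.+1) gap (k%:R * e) a b).
    by rewrite mulr_ge0.
  by have [[E1 ?]|[E1 ?]] := excrE (7 * e) (a - b); rewrite E1; lra.
have [/andP[hb ha]|] := boolP ((`|b| <= n%:R * e - 2 * e) && (`|b| + 3 * e <= `|a|)).
  have : 0 <= `|b| / e by rewrite divr_ge0// ltW.
  move=> /truncn_itv /andP[kb bk].
  move: kb bk; set k := Num.truncn _; rewrite ler_pdivlMr// ltr_pdivrMr// => kb bk.
  rewrite -natr1 mulrDl mul1r in bk.
  (* As k is the integer part of |b| / e, the level (k + 2) e lies at least e above |b|, and at
     least e below |a| >= |b| + 3 e. *)
  apply: (big k.+2).
    rewrite /= -(ler_nat R) -(ler_pM2r e0) -natr1 -natr1; lra.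
  by apply: gap_crossing; rewrite -natr1 -natr1; lra.
rewrite negb_and -!ltNge => cases.
have [E|] := boolP ((`|a - b| == `|a| + `|b|) && (2 * e <= `|b|)).
  case/andP: E => /eqP E be; apply: (big 1%N) => //.
  by rewrite mul1r; apply: gap_opposite => //; lra.
rewrite negb_and -ltNge => sg; apply: small.
have sgn : `|a - b| = `|a| - `|b| \/ (`|a - b| = `|a| + `|b| /\ `|b| < 2 * e).
  have : `|a - b| = `|a| - `|b| \/ `|a - b| = `|a| + `|b|.
    move: ba; case: (ger0P a) => ?; case: (ger0P b) => ?; case: (ger0P (a - b)) => ? ?;
      solve [left; lra | right; lra].
  by case=> E; [left|right; rewrite E eqxx in sg].
by have [[E2 ?]|[E2 ?]] := excrE (n%:R * e) a; rewrite E2;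
  case: sgn => [->|[-> ?]]; case/orP: cases => ?; lra.
Qed.

Lemma separation e a b n : 0 < e -> (0 < n)%N ->
  excr (7 * e) (a - b) <= 2 * n%:R * (\sum_(1 <= k < n.+1) gap (k%:R * e) a b)
     + 2 * (excr (n%:R * e) a + excr (n%:R * e) b).
Proof.
move=> e0 n0; have [ba|/ltW ab] := lerP `|b| `|a|.
  by have := separation_wlog e0 n0 ba; have := excr_ge0 (n%:R * e) b; lra.
have := separation_wlog e0 n0 ab; have := excr_ge0 (n%:R * e) a.
rewrite [in excr _ (b - a)]/excr distrC -/(excr _ _).
under eq_bigr do rewrite gapC.
lra.
Qed.

End separation.

#[global] Instance ae_lebesgue_filter (R : realType) :
  Filter (almost_everywhere (@lebesgue_measure R)).
Proof. exact: (ae_filter_ringOfSetsType (@lebesgue_measure R)). Qed.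

Section subadditivity.
Context (R : realType) (alpha : \bar R).
Local Open Scope ereal_scope.
Local Notation mu := (@lebesgue_measure R).
Local Notation I := (itvI alpha).
Local Notation L0 := (@L0 R alpha).
Local Notation Kfun := (Kfun alpha).
Local Notation excess := (excess alpha).
Local Notation aeI := (aeI alpha).
Implicit Types (x y z : R -> \bar R) (s t l : R).

Lemma L0_add x y : L0 x -> L0 y -> L0 (x \+ y).
Proof. exact: emeasurable_funD. Qed.

Lemma L0_sub x y : L0 x -> L0 y -> L0 (x \- y).
Proof. exact: emeasurable_funB. Qed.

Lemma L0_scale c x : L0 x -> L0 (fscale c x).
Proof. by move=> mx; apply: emeasurable_funM. Qed.

Lemma L0_abs x : L0 x -> L0 (fun s => `|x s|).
Proof. by move=> mx; exact: (measurableT_comp (f := abse)). Qed.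

Lemma aeI_all (P : R -> Prop) : (forall s, I s -> P s) -> aeI P.
Proof. by move=> h; apply: aeW => s /h. Qed.

Lemma aeIS (P Q : R -> Prop) : (forall s, I s -> P s -> Q s) -> aeI P -> aeI Q.
Proof. by rewrite /Defs.aeI => PQ; apply: filterS => s Ps Is; apply: PQ => //; exact: Ps. Qed.

Lemma aeIS2 (P P' Q : R -> Prop) : (forall s, I s -> P s -> P' s -> Q s) ->
  aeI P -> aeI P' -> aeI Q.
Proof.
rewrite /Defs.aeI => PQ; apply: filterS2 => s Ps Ps' Is.
by apply: PQ => //; [exact: Ps|exact: Ps'].
Qed.

Lemma excessD x y z l m : L0 x -> L0 y -> L0 z ->
  aeI (fun s => `|z s| <= `|x s| + `|y s|) ->
  excess (l + m) z <= excess l x + excess m y.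
Proof.
move=> mx my mz zxy.
rewrite /excess -ge0_integralD//=; first last.
- exact: measurable_excess_fun.
- by move=> *; exact: excess_part_ge0.
- exact: measurable_excess_fun.
- by move=> *; exact: excess_part_ge0.
- exact: measurable_itvI.
apply: ae_ge0_le_integral.
- exact: measurable_itvI.
- by move=> *; exact: excess_part_ge0.
- exact: measurable_excess_fun.
- by move=> *; rewrite adde_ge0// excess_part_ge0.
- by apply: emeasurable_funD; exact: measurable_excess_fun.
move: zxy; apply: aeIS => s Is zs; apply: excess_part_le.
  by rewrite adde_ge0// excess_part_ge0.
apply: (le_trans zs); rewrite EFinD addeACA.
by apply: leeD; exact: le_excess_part.
Qed.

(** K is subadditive although x^* is not: the optimal levels l of x and m of y at t combine into the
    level l + m for z. *)
Lemma KfunD x y z t : L0 x -> L0 y -> L0 z -> (0 <= t)%R ->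
  aeI (fun s => `|z s| <= `|x s| + `|y s|) ->
  Kfun z t <= Kfun x t + Kfun y t.
Proof.
move=> mx my mz; rewrite le_eqVlt => /predU1P[<- _|t0 zxy]; first by rewrite !Kfun0 adde0.
have [->|] := eqVneq (Kfun x t) +oo.
  by rewrite addye ?leey// gt_eqF// (lt_le_trans _ (Kfun_ge0 _ _ _)).
rewrite -ltey => /(Kfun_attained mx t0)[l [l0 _ ->]].
have [->|] := eqVneq (Kfun y t) +oo.
  rewrite addey ?leey// gt_eqF// (lt_le_trans (ltNye 0))// adde_ge0 ?excess_ge0//.
  by rewrite lee_fin mulr_ge0// ltW.
rewrite -ltey => /(Kfun_attained my t0)[m [m0 _ ->]].
apply: (le_trans (Kfun_le (l := l + m) mz _ (ltW t0))); first by rewrite addr_ge0.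
apply: (le_trans (leeD2l _ (excessD l m mx my mz zxy))).
by rewrite mulrDl EFinD addeACA.
Qed.

Lemma L0_0 : L0 (cst 0).
Proof. exact: measurable_cst. Qed.

Lemma excess0 l : (0 <= l)%R -> excess l (cst 0) = 0.
Proof.
move=> l0; apply: integral0_eq => s _ /=; apply/max_idPr.
by rewrite normr0 add0e lee_fin oppr_le0.
Qed.

Lemma Kfun_cst0 t : (0 <= t)%R -> Kfun (cst 0) t = 0.
Proof.
move=> t0; apply/le_anti; rewrite Kfun_ge0 andbT.
by apply: (le_trans (Kfun_le L0_0 (lexx _) t0)); rewrite excess0// mul0r adde0.
Qed.

Lemma le_Kfun x y t : L0 x -> L0 y -> (0 <= t)%R ->
  aeI (fun s => `|x s| <= `|y s|) -> Kfun x t <= Kfun y t.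
Proof.
move=> mx my t0 xy; rewrite -[leRHS]adde0 -(Kfun_cst0 t0); apply: KfunD => //.
  exact: L0_0.
by move: xy; apply: aeIS => s Is; rewrite /= normr0 adde0.
Qed.

Lemma eq_Kfun x y t : L0 x -> L0 y -> (0 <= t)%R ->
  aeI (fun s => `|x s| = `|y s|) -> Kfun x t = Kfun y t.
Proof.
move=> mx my t0 xy; apply/le_anti/andP; split; apply: le_Kfun => //;
  by move: xy; apply: aeIS => s Is ->.
Qed.

Lemma excess_scale x (c : R) l : (0 <= c)%R -> L0 x ->
  excess (c * l) (fscale c x) = c%:E * excess l x.
Proof.
move=> c0 mx; rewrite -ge0_integralZl//; first last.
- by move=> *; exact: excess_part_ge0.
- exact: measurable_excess_fun.
- exact: measurable_itvI.
apply: eq_integral => s _; rewrite /fscale abseM gee0_abs// maxe_pMr//.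
by rewrite mule0 muleBr// fin_num_adde_defl.
Qed.

Lemma Kfun_scale_le x (c : R) t : L0 x -> (0 <= t)%R -> (0 <= c)%R ->
  Kfun (fscale c x) t <= c%:E * Kfun x t.
Proof.
move=> mx; rewrite le_eqVlt => /predU1P[<- _|t0]; first by rewrite !Kfun0 mule0.
rewrite le_eqVlt => /predU1P[<-|c0].
  rewrite mul0e -(Kfun_cst0 (ltW t0)); apply: le_Kfun => //.
  - exact: L0_scale.
  - exact: L0_0.
  - exact: ltW.
  - by apply: aeI_all => s _; rewrite /fscale mul0e.
have [->|] := eqVneq (Kfun x t) +oo; first by rewrite gt0_muley ?leey.
rewrite -ltey => /(Kfun_attained mx t0)[l [l0 _ ->]].
apply: (le_trans (Kfun_le (l := c * l) (L0_scale c mx) _ (ltW t0))).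
  by rewrite mulr_ge0// ltW.
rewrite excess_scale ?(ltW c0)// (@ge0_muleDr _ _ (l * t)%:E) ?excess_ge0// ?lee_fin ?mulr_ge0 ?(ltW t0)//.
by rewrite -EFinM mulrA.
Qed.

Lemma Kfun_scale x c t : L0 x -> (0 <= t)%R ->
  Kfun (fscale c x) t = `|c|%:E * Kfun x t.
Proof.
move=> mx t0; transitivity (Kfun (fscale `|c| x) t).
  apply: eq_Kfun => //; [exact: L0_scale | exact: L0_scale | apply: aeI_all => s _].
  by rewrite /fscale !abseM/= normr_id.
apply/le_anti; rewrite Kfun_scale_le//=.
have [->|c0] := eqVneq c 0%R; first by rewrite normr0 mul0e Kfun_ge0.
have := Kfun_scale_le (L0_scale `|c| mx) t0 (c := `|c|^-1%R).
rewrite (_ : fscale _ (fscale _ x) = x); last first.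
  by apply/funext => s; rewrite /fscale muleA -EFinM mulVf ?normr_eq0// mul1e.
rewrite invr_ge0 => /(_ (normr_ge0 _)) h.
apply: (le_trans (lee_pmul _ _ (lexx _) h)) => //; first exact: Kfun_ge0.
by rewrite muleA -EFinM mulfV ?normr_eq0// mul1e.
Qed.

(** Countable subadditivity, tested at the sum of the optimal levels of the terms; this sum is
    finite because t times it is at most the series on the right. *)
Lemma Kfun_series (d : nat -> R -> \bar R) z t : (forall n, L0 (d n)) -> L0 z -> (0 <= t)%R ->
  aeI (fun s => `|z s| <= \sum_(n <oo) `|d n s|) ->
  Kfun z t <= \sum_(n <oo) Kfun (d n) t.
Proof.
move=> md mz; rewrite le_eqVlt => /predU1P[<- _|t0 zd].
  by rewrite Kfun0 nneseries_ge0// => *; rewrite Kfun_ge0.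
have [->|] := eqVneq (\sum_(n <oo) Kfun (d n) t) +oo; first by rewrite leey.
rewrite -ltey => Sfin.
have K0 n : 0 <= Kfun (d n) t by exact: Kfun_ge0.
have Kfin n : Kfun (d n) t < +oo.
  apply: le_lt_trans Sfin; apply: le_trans (nneseries_lim_ge n.+1 _) => //.
  by rewrite big_mkord big_ord_recr/= leeDr// sume_ge0.
have /choice[l lP] n := Kfun_attained (md n) t0 (Kfin n).
have l0 n : (0 <= l n)%R by have [] := lP n.
have KE n : Kfun (d n) t = t%:E * (l n)%:E + excess (l n) (d n).
  by have [_ _ ->] := lP n; rewrite -EFinM mulrC.
have KS : \sum_(n <oo) Kfun (d n) t =
    t%:E * \sum_(n <oo) (l n)%:E + \sum_(n <oo) excess (l n) (d n).
  rewrite -nneseriesZl; last by move=> *; rewrite lee_fin.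
  rewrite -nneseriesD; first exact: eq_eseriesr.
    by move=> *; rewrite mule_ge0// lee_fin// ltW.
  by move=> *; exact: excess_ge0.
have eS0 : 0 <= \sum_(n <oo) excess (l n) (d n).
  by apply: nneseries_ge0 => *; exact: excess_ge0.
have [L L0' LE] : exists2 L, (0 <= L)%R & \sum_(n <oo) (l n)%:E = L%:E.
  have : 0 <= \sum_(n <oo) (l n)%:E by apply: nneseries_ge0 => *; rewrite lee_fin.
  move: Sfin; rewrite KS; case: (\sum_(n <oo) (l n)%:E) => [L _ L0'||]//.
    by exists L.
  by rewrite gt0_muley ?lte_fin// addye// gt_eqF// (lt_le_trans (ltNye 0)).
rewrite KS LE -EFinM mulrC; apply: (le_trans (Kfun_le mz L0' (ltW t0))).
rewrite leeD2l// /excess -integral_nneseries//; first last.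
- by move=> *; exact: excess_part_ge0.
- by move=> n; exact: measurable_excess_fun.
- exact: measurable_itvI.
have mS : measurable_fun I (fun s => \sum_(n <oo) maxe (`|d n s| - (l n)%:E) 0).
  apply: (ge0_emeasurable_sum (P := xpredT)) => [n s _ _|n _]; first exact: excess_part_ge0.
  exact: measurable_excess_fun.
have S0 s : 0 <= \sum_(n <oo) maxe (`|d n s| - (l n)%:E) 0.
  by apply: nneseries_ge0 => *; exact: excess_part_ge0.
apply: ae_ge0_le_integral => //.
- exact: measurable_itvI.
- by move=> *; exact: excess_part_ge0.
- exact: measurable_excess_fun.
move: zd; apply: aeIS => s Is zs; apply: excess_part_le => //.
apply: (le_trans zs); rewrite -LE -nneseriesD; last 2 first.
  by move=> *; rewrite lee_fin.
  by move=> *; exact: excess_part_ge0.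
  by apply: lee_nneseries => // n _; exact: le_excess_part.
Qed.

(** [separation] applied to x s and y s, and integrated. The gaps are differences of excesses that
    may be infinite, so their negative parts are moved to the other side. *)
Lemma excess_separation x y (e : R) n : L0 x -> L0 y ->
  aeI (fun s => x s \is a fin_num) -> aeI (fun s => y s \is a fin_num) ->
  (0 < e)%R -> (0 < n)%N ->
  excess (7 * e) (x \- y) +
    (2 * n%:R)%:E * \sum_(1 <= k < n.+1) excess (2 * (k%:R * e)) (x \+ y) <=
  (2 * n%:R)%:E * \sum_(1 <= k < n.+1) (excess (k%:R * e) x + excess (k%:R * e) y) +
    2%:E * (excess (n%:R * e) x + excess (n%:R * e) y).
Proof.
move=> mx my fx fy e0 n0.
have mI : measurable I by exact: measurable_itvI.
have mD := L0_add mx my; have mB := L0_sub mx my.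
pose f (l : R) (z : R -> \bar R) s := maxe (`|z s| - l%:E) 0.
have f0 l z s : 0 <= f l z s by exact: excess_part_ge0.
have mf l z : L0 z -> measurable_fun I (f l z) by move=> mz; exact: measurable_excess_fun.
pose S g z s := \sum_(1 <= k < n.+1) f (g k) z s.
have S0 g z s : 0 <= S g z s by apply: sume_ge0.
have mS g z : L0 z -> measurable_fun I (S g z).
  by move=> mz; apply: emeasurable_sum => k; exact: mf.
have SE g z : L0 z -> \sum_(1 <= k < n.+1) excess (g k) z = \int[mu]_(s in I) S g z s.
  by move=> mz; rewrite ge0_integral_sum// => k; exact: mf.
have n2 : 0 <= (2 * n%:R)%:E :> \bar R by rewrite lee_fin mulr_ge0.
have two0 : 0 <= 2%:E :> \bar R by rewrite lee_fin.
have EE l z : excess l z = \int[mu]_(s in I) f l z s by [].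
rewrite [X in _ <= _ * X + _]big_split/=.
pose g1 (k : nat) : R := (2 * (k%:R * e))%R; pose g2 (k : nat) : R := (k%:R * e)%R.
have E1 : \sum_(1 <= k < n.+1) excess (2 * (k%:R * e)) (x \+ y) =
  \int[mu]_(s in I) S g1 (x \+ y) s := SE g1 _ mD.
have E2 z : L0 z -> \sum_(1 <= k < n.+1) excess (k%:R * e) z = \int[mu]_(s in I) S g2 z s := SE g2 z.
rewrite E1 (E2 _ mx) (E2 _ my) {E1 E2 SE}.
rewrite !EE {EE}.
have -> : \int[mu]_(s in I) f (7 * e)%R (x \- y) s + (2 * n%:R)%:E * \int[mu]_(s in I) S g1 (x \+ y) s =
  \int[mu]_(s in I) (f (7 * e)%R (x \- y) s + (2 * n%:R)%:E * S g1 (x \+ y) s).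
  rewrite ge0_integralD//; first by rewrite ge0_integralZl//; exact: mS.
  - exact: mf.
  - by move=> *; rewrite mule_ge0.
  - by apply: emeasurable_funM => //; exact: mS.
have -> : (2 * n%:R)%:E * (\int[mu]_(s in I) S g2 x s + \int[mu]_(s in I) S g2 y s) +
   2 * (\int[mu]_(s in I) f (n%:R * e)%R x s + \int[mu]_(s in I) f (n%:R * e)%R y s) =
  \int[mu]_(s in I) ((2 * n%:R)%:E * (S g2 x s + S g2 y s) + 2 * (f (n%:R * e)%R x s + f (n%:R * e)%R y s)).
  rewrite ge0_integralD//; first last.
  - apply: emeasurable_funM => //; apply: emeasurable_funD; exact: mf.
  - by move=> *; rewrite mule_ge0// adde_ge0.
  - apply: emeasurable_funM => //; apply: emeasurable_funD; exact: mS.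
  - by move=> *; rewrite mule_ge0// adde_ge0.
  rewrite ge0_integralZl//; first last.
  - by move=> *; rewrite adde_ge0.
  - by apply: emeasurable_funD; exact: mS.
  rewrite ge0_integralZl//; first last.
  - by move=> *; rewrite adde_ge0.
  - by apply: emeasurable_funD; exact: mf.
  rewrite ge0_integralD//; [|exact: mS|exact: mS].
  by rewrite ge0_integralD//; exact: mf.
apply: ae_ge0_le_integral => //.
- by move=> *; rewrite adde_ge0// mule_ge0.
- apply: emeasurable_funD; first exact: mf.
  by apply: emeasurable_funM => //; exact: mS.
- by move=> *; rewrite adde_ge0// mule_ge0// adde_ge0.
- apply: emeasurable_funD; apply: emeasurable_funM => //; apply: emeasurable_funD;
    solve [exact: mf | exact: mS].
move: fx fy; apply: aeIS2 => s Is.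
have fE l (z : R -> \bar R) r : z s = r%:E -> f l z s = (excr l r)%:E.
  by move=> zr; rewrite /f zr /= -EFinB -EFin_max.
case xE : (x s) => [a||]// _; case yE : (y s) => [b||]// _.
have SE g (z : R -> \bar R) r : z s = r%:E -> S g z s = (\sum_(1 <= k < n.+1) excr (g k) r)%:E.
  by move=> zr; rewrite /S -sumEFin; apply: eq_bigr => k _; exact: fE.
have xyD : (x \+ y) s = (a + b)%:E by rewrite /= xE yE.
have xyB : (x \- y) s = (a - b)%:E by rewrite /= xE yE.
rewrite !(fE _ _ _ xyB) !(SE _ _ _ xyD) !(SE _ _ _ xE) !(SE _ _ _ yE) !(fE _ _ _ xE) !(fE _ _ _ yE).
rewrite -!(EFinD, EFinM) lee_fin.
have := separation a b e0 n0; rewrite /gap sumrB big_split/=.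
rewrite /g1 /g2; lra.
Qed.

End subadditivity.

Lemma exists_uniform (Q : nat -> nat -> Prop) J :
  (forall j N N', (N <= N')%N -> Q j N -> Q j N') ->
  (forall j, (0 < j <= J)%N -> exists N, Q j N) ->
  exists N, forall j, (0 < j <= J)%N -> Q j N.
Proof.
move=> Qle; elim: J => [|J IH] QJ; first by exists 0%N => j; case: j.
have [|N HN] := IH; first by move=> j jJ; apply: QJ; lia.
have [|N' HN'] := QJ J.+1; first by lia.
exists (maxn N N') => j /andP[j0]; rewrite leq_eqVlt => /predU1P[->|jJ].
  by apply: Qle HN'; exact: leq_maxr.
by apply: Qle (HN j _); [exact: leq_maxl|rewrite j0].
Qed.

Opaque Defs.L0 Kfun excess.

(** * Differences controlled by the K-functionals of terms and of sums *)

Section convergence.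
Context (R : realType) (alpha : \bar R).
Local Open Scope ereal_scope.
Local Notation L0 := (@L0 R alpha).
Local Notation Kfun := (Kfun alpha).
Local Notation excess := (excess alpha).
Local Notation aeI := (aeI alpha).
Implicit Types (x y z : R -> \bar R) (s t l h : R).

Lemma ge0_fin_real (a : \bar R) : 0 <= a -> a < +oo -> exists2 r : R, (0 <= r)%R & a = r%:E.
Proof. by case: a => // r r0 _; exists r. Qed.

(** The grid times j and i that nearly attain the two excesses are different. Since K x and K y
    nearly agree, i can be traded for j, where the midpoint inequality for K applies. Three
    comparisons of K cost h each, and three uses of the mesh cost l e each. *)
Lemma excess_add_grid x y (l e h : R) J : L0 x -> L0 y -> (0 <= l)%R -> (0 < e)%R -> (0 < J)%N ->
  (forall t, (0 < t)%R -> Kfun x t < +oo) -> (forall t, (0 < t)%R -> Kfun y t < +oo) ->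
  distr_fun alpha x l <= (J%:R * e)%:E -> distr_fun alpha y l <= (J%:R * e)%:E ->
  (forall j, (0 < j <= J)%N -> [/\ Kfun y (j%:R * e) <= Kfun x (j%:R * e) + h%:E,
     Kfun x (j%:R * e) <= Kfun y (j%:R * e) + h%:E &
     Kfun x (j%:R * e) + Kfun y (j%:R * e) <= Kfun (x \+ y) (j%:R * e) + h%:E]) ->
  excess l x + excess l y <= excess (2 * l) (x \+ y) + (3 * h + 3 * (l * e))%:E.
Proof.
move=> mx my l0 e0 J0 Kx Ky dx dy H.
have mxy := L0_add mx my.
have [j jJ Hj] := excess_grid mx l0 e0 J0 dx.
have [i iJ Hi] := excess_grid my l0 e0 J0 dy.
have jt : (0 < j%:R * e)%R by case/andP: jJ => j0 _; rewrite mulr_gt0// ltr0n.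
have it : (0 < i%:R * e)%R by case/andP: iJ => i0 _; rewrite mulr_gt0// ltr0n.
have [H1 H2 H3] := H _ jJ; have [G1 G2 G3] := H _ iJ.
have Li := Kfun_le mx l0 (ltW it).
have Lj := Kfun_le mxy (mulr_ge0 (ler0n R 2) l0) (ltW jt).
move: (excess_ge0 alpha (x \+ y) (2 * l)) Hj Hi H1 H2 H3 G1 G2 G3 Li Lj.
have [r r0 ->] := ge0_fin_real (Kfun_ge0 alpha x _) (Kx _ jt).
have [r' r'0 ->] := ge0_fin_real (Kfun_ge0 alpha x _) (Kx _ it).
have [q q0 ->] := ge0_fin_real (Kfun_ge0 alpha y _) (Ky _ jt).
have [q' q'0 ->] := ge0_fin_real (Kfun_ge0 alpha y _) (Ky _ it).
case: (excess (2 * l) (x \+ y)) => [E||]//; last first.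
  by move=> *; rewrite addye// leey.
move=> E0.
have := excess_ge0 alpha x l; case: (excess l x) => [Ex||]// Ex0.
have := excess_ge0 alpha y l; case: (excess l y) => [Ey||]// Ey0.
rewrite -!EFinD !lee_fin.
case: (Kfun (x \+ y) (j%:R * e)) => [z||]//; rewrite -?EFinD ?lee_fin.
move=> *; lra.
Qed.

(* [excess_separation] bounds |u m - u n| by defects of excesses in the midpoint
   inequality, which [excess_add_grid] bounds by those of finitely many
   K-functionals. *)
Lemma Kfun_sub_cvg (u : nat -> R -> \bar R) :
  (forall n, L0 (u n)) -> (forall n, aeI (fun s => u n s \is a fin_num)) ->
  (forall n t, (0 < t)%R -> Kfun (u n) t < +oo) ->
  (forall h, (0 < h)%R -> exists2 t : R, (0 < t)%R & forall n, Kfun (u n) t <= h%:E) ->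
  (forall l, (0 < l)%R -> exists2 t : R, (0 < t)%R & forall n, Kfun (u n) t <= (l * t)%:E) ->
  (forall t h, (0 < t)%R -> (0 < h)%R -> exists N, forall m n, (N <= m)%N -> (N <= n)%N ->
     Kfun (u m) t <= Kfun (u n) t + h%:E) ->
  (forall t h, (0 < t)%R -> (0 < h)%R -> exists N, forall m n, (N <= m)%N -> (N <= n)%N ->
     Kfun (u m) t + Kfun (u n) t <= Kfun (u m \+ u n) t + h%:E) ->
  forall t h, (0 < t)%R -> (0 < h)%R -> exists N, forall m n, (N <= m)%N -> (N <= n)%N ->
     Kfun (u m \- u n) t <= h%:E.
Proof.
move=> mu_ fu Kfin near0 nearoo Kcauchy Kmid.
have gapA l h : (0 < l)%R -> (0 < h)%R -> exists N, forall m n, (N <= m)%N -> (N <= n)%N ->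
    excess l (u m) + excess l (u n) <= excess (2 * l) (u m \+ u n) + h%:E.
  move=> l0 h0; have [T T0 HT] := nearoo l l0.
  (* This number of grid points makes the mesh e = T / J satisfy 6 l e <= h, so that the error 3 (h
     / 6) + 3 l e of [excess_add_grid] is at most h. *)
  have q0 : (0 <= 6 * l * T / h)%R by rewrite !mulr_ge0 ?invr_ge0// ltW.
  have /andP[_ ] := truncn_itv q0; set J := (Num.truncn _).+1 => HJ.
  have J0 : (0 < J%:R :> R)%R by rewrite ltr0n.
  pose e := (T / J%:R)%R; have e0 : (0 < e)%R by rewrite divr_gt0.
  have JeT : (J%:R * e = T)%R by rewrite /e mulrC divfK// gt_eqF.
  have le_h : (6 * (l * e) <= h)%R.
    rewrite /e; move: HJ; rewrite ltr_pdivrMr// => HJ.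
    by rewrite !mulrA ler_pdivrMr// ltW// [ltRHS]mulrC.
  have h6 : (0 < h / 6)%R by rewrite divr_gt0.
  have [||N HN] := @exists_uniform (fun j N => forall m n, (N <= m)%N -> (N <= n)%N ->
      [/\ Kfun (u n) (j%:R * e) <= Kfun (u m) (j%:R * e) + (h / 6)%:E,
     Kfun (u m) (j%:R * e) <= Kfun (u n) (j%:R * e) + (h / 6)%:E &
     Kfun (u m) (j%:R * e) + Kfun (u n) (j%:R * e) <=
       Kfun (u m \+ u n) (j%:R * e) + (h / 6)%:E]) J.
  - by move=> j N N' NN HN m n Nm Nn; apply: HN; exact: leq_trans NN _.
  - move=> j /andP[j0 _]; have t0 : (0 < j%:R * e)%R by rewrite mulr_gt0// ltr0n.
    have [N1 H1] := Kcauchy _ _ t0 h6; have [N2 H2] := Kmid _ _ t0 h6.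
    exists (maxn N1 N2) => m n; rewrite !geq_max => /andP[? ?] /andP[? ?].
    by split; [exact: H1|exact: H1|exact: H2].
  exists N => m n Nm Nn.
  have d k : distr_fun alpha (u k) l <= (J%:R * e)%:E.
    by rewrite JeT; apply: distr_le_Kfun => //; exact: ltW.
  apply: (le_trans (excess_add_grid (h := h / 6) (e := e) (J := J) _ _ (ltW l0) e0 _ _ _ _ _ _)) => //.
  - by move=> *; exact: Kfin.
  - by move=> *; exact: Kfin.
  - by move=> j jJ; exact: HN.
  - by rewrite leeD2l// lee_fin; lra.
have exfin l n : (0 < l)%R -> excess l (u n) < +oo.
  move=> l0; have [T T0 HT] := nearoo l l0.
  apply: (le_lt_trans (excess_le_Kfun (mu_ n) T0 (HT n))); exact: Kfin.
move=> t h t0 h0.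
(* The bound h is split into h / 2 for the term 7 e t, h / 4 for the gaps at the K levels and h / 4
   for the excesses above the top level K e. *)
pose e := (h / (14 * t))%R; have e0 : (0 < e)%R by rewrite divr_gt0// mulr_gt0.
have h16 : (0 < h / 16)%R by rewrite divr_gt0.
have [r r0 Hr] := near0 _ h16.
have q0 : (0 <= h / 16 / r / e)%R by rewrite !mulr_ge0 ?invr_ge0// ltW.
have /andP[_ ] := truncn_itv q0; set K := (Num.truncn _).+1 => HK.
have K0 : (0 < K%:R :> R)%R by rewrite ltr0n.
rewrite ltr_pdivrMr// ltr_pdivrMr// in HK.
pose d := (h / (8 * K%:R * K%:R))%R; have d0 : (0 < d)%R by rewrite divr_gt0// !mulr_gt0.
have [||N HN] := @exists_uniform (fun k N => forall m n, (N <= m)%N -> (N <= n)%N ->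
   excess (k%:R * e) (u m) + excess (k%:R * e) (u n) <=
      excess (2 * (k%:R * e)) (u m \+ u n) + d%:E) K.
- by move=> j N N' NN HN m n Nm Nn; apply: HN; exact: leq_trans NN _.
- by move=> k /andP[k0 _]; apply: gapA => //; rewrite mulr_gt0// ltr0n.
exists N => m n Nm Nn.
have mB := L0_sub (mu_ m) (mu_ n).
have e7 : (0 <= 7 * e)%R by rewrite mulr_ge0// ltW.
apply: (le_trans (Kfun_le mB e7 (ltW t0))).
have -> : (7 * e * t = h / 2)%R by rewrite /e; field; rewrite gt_eqF.
(* K was chosen with K e r >= h / 16 >= [Kfun (u k) r], which is what [excess_le_Kfun] asks of the
   level K e. *)
have exM k : excess (K%:R * e) (u k) <= (h / 16)%:E.
  apply: (@le_trans _ _ (Kfun (u k) r)); last exact: Hr.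
  apply: excess_le_Kfun => //; apply: (le_trans (Hr k)).
  by rewrite lee_fin ltW.
have := excess_separation (mu_ m) (mu_ n) (fu m) (fu n) e0 (isT : (0 < K)%N).
set S := \sum_(1 <= k < K.+1) excess _ (_ \+ _).
set S' := \sum_(1 <= k < K.+1) (_ + _).
have SS : S' <= S + (K%:R * d)%:E.
  have -> : (K%:R * d)%:E = \sum_(1 <= k < K.+1) d%:E.
    by rewrite sumEFin big_const_nat iter_addr_0 subSS subn0 mulr_natl.
  rewrite /S /S' -big_split/= !big_nat; apply: lee_sum => k kK; exact: HN.
have S0 : 0 <= S by apply: sume_ge0 => *; exact: excess_ge0.
have S'0 : 0 <= S' by apply: sume_ge0 => *; apply: adde_ge0; exact: excess_ge0.
have Sfin : S < +oo.
  rewrite /S big_nat; apply: lte_sum_pinfty => k /andP[k0 _].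
  have ke0 : (0 < k%:R * e)%R by rewrite mulr_gt0// ltr0n.
  apply: (@le_lt_trans _ _ (excess (k%:R * e) (u m) + excess (k%:R * e) (u n))).
    rewrite mulr_natl mulr2n; apply: excessD => //; first exact: L0_add.
    by apply: aeI_all => s _; exact: lee_abs_add.
  by rewrite lte_add_pinfty// exfin.
move: S S' SS S0 S'0 Sfin => S S' SS S0 S'0 Sfin.
have [a a0 aE] := ge0_fin_real S0 Sfin.
have [b b0 bE] : exists2 b : R, (0 <= b)%R & S' = b%:E.
  by apply: ge0_fin_real => //; apply: (le_lt_trans SS); rewrite aE -EFinD ltry.
have [f f0 fE] : exists2 b : R, (0 <= b)%R & excess (K%:R * e) (u m) = b%:E.
  by apply: ge0_fin_real; [exact: excess_ge0|apply: exfin; rewrite mulr_gt0].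
have [g g0 gE] : exists2 b : R, (0 <= b)%R & excess (K%:R * e) (u n) = b%:E.
  by apply: ge0_fin_real; [exact: excess_ge0|apply: exfin; rewrite mulr_gt0].
have := exM m; have := exM n; rewrite fE gE !lee_fin => gh fh.
move: SS; rewrite aE bE.
have := excess_ge0 alpha (u m \- u n) (7 * e).
case: (excess (7 * e) (u m \- u n)) => [E||]// E0; rewrite -!(EFinM,EFinD) !lee_fin ?leye_eq//.
have Kd : (2 * K%:R * (K%:R * d) = h / 4)%R by rewrite /d; field; rewrite gt_eqF.
have K2 : (0 <= 2 * K%:R :> R)%R by rewrite mulr_ge0// ltW.
move=> ba; have := ler_wpM2l K2 ba; rewrite mulrDr Kd.
lra.
Qed.

End convergence.

Transparent Defs.L0 Kfun excess.

(** * Uniform convexity of the weighted integral *)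

Section real_powers.
Context (R : realType) (p : R).
Hypothesis p_gt1 : 1 < p.
Implicit Types (a b c s t u : R).

Let p_gt0 : 0 < p. Proof. by rewrite (lt_trans _ p_gt1). Qed.

(** Strict Bernoulli inequality: with u = exp y it follows from exp ((p - 1) y) > 1 + (p - 1) y and
    exp (- y) >= 1 - y. *)
Lemma powR_gt_tangent1 u : 0 <= u -> u != 1 -> 1 + p * (u - 1) < u `^ p.
Proof.
rewrite le_eqVlt => /predU1P[<- _|u0 u1].
  by rewrite powR0 ?gt_eqF// sub0r mulrN1 subr_lt0.
have [y uE] : exists y, u = expR y by exists (ln u); rewrite lnK.
have y0 : y != 0 by apply: contra_neq u1 => y0; rewrite uE y0 expR0.
have -> : u `^ p = u * expR ((p - 1) * y).
  by rewrite /powR gt_eqF// uE expRK -expRD; congr expR; lra.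
have h1 : 1 + (p - 1) * y < expR ((p - 1) * y).
  by apply: expR_gt1Dx; rewrite mulf_neq0// subr_eq0 gt_eqF.
have h2 : u * (1 - y) <= 1.
  have := expR_ge1Dx (- y); rewrite expRN -uE => h.
  by rewrite -ler_pdivlMl// mulr1.
have : u * (1 + (p - 1) * y) < u * expR ((p - 1) * y) by rewrite ltr_pM2l.
have : (p - 1) * (u * (1 - y)) <= (p - 1) * 1 by rewrite ler_pM2l// subr_gt0.
lra.
Qed.

Lemma powR_ge_tangent a c : 0 <= a -> 0 <= c ->
  c `^ p + p * c `^ (p - 1) * (a - c) <= a `^ p.
Proof.
move=> a0; rewrite le_eqVlt => /predU1P[<-|c0].
  have p10 : p - 1 != 0 by rewrite subr_eq0 gt_eqF.
  rewrite (powR0 p10) powR0 ?gt_eqF//.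
  by rewrite mulr0 mul0r addr0 powR_ge0.
have aE : a `^ p = c `^ p * (a / c) `^ p.
  by rewrite -powRM ?divr_ge0 ?(ltW c0)// mulrC divfK// gt_eqF.
have cE : c `^ p = c * c `^ (p - 1) by rewrite mulr_powRB1 ?ltW.
have h : 1 + p * (a / c - 1) <= (a / c) `^ p.
  have [->|ac] := eqVneq (a / c) 1; first by rewrite powR1; lra.
  by apply/ltW/powR_gt_tangent1 => //; rewrite divr_ge0// ltW.
have : c `^ p * (1 + p * (a / c - 1)) <= a `^ p by rewrite aE ler_wpM2l ?powR_ge0.
apply: le_trans; rewrite le_eqVlt; apply/orP; left; apply/eqP.
rewrite cE; field; exact: lt0r_neq0.
Qed.

Lemma powR_conv s a b : 0 <= s <= 1 -> 0 <= a -> 0 <= b ->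
  (s * a + (1 - s) * b) `^ p <= s * a `^ p + (1 - s) * b `^ p.
Proof.
move=> /andP[s0 s1] a0 b0; set c := s * a + (1 - s) * b.
have c0 : 0 <= c by rewrite addr_ge0// mulr_ge0// subr_ge0.
have ha := powR_ge_tangent a0 c0; have hb := powR_ge_tangent b0 c0.
have s1' : 0 <= 1 - s by rewrite subr_ge0.
have := lerD (ler_wpM2l s0 ha) (ler_wpM2l s1' hb).
apply: le_trans; set d := _ `^ (p - 1); rewrite /c; lra.
Qed.

(** On [0, 1] the p-th power lies below the identity; this is used at a / (a + b) and b / (a +
    b). *)
Lemma powRD_super a b : 0 <= a -> 0 <= b -> a `^ p + b `^ p <= (a + b) `^ p.
Proof.
move=> a0 b0; have [ab0|] := eqVneq (a + b) 0.
  have [-> ->] : a = 0 /\ b = 0 by split; lra.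
  by rewrite addr0 powR0 ?gt_eqF// addr0.
move=> abn; have ab0 : 0 < a + b by rewrite lt_neqAle eq_sym abn addr_ge0.
have h c : 0 <= c -> c <= a + b -> c `^ p <= (c / (a + b)) * (a + b) `^ p.
  move=> c0 cab; rewrite -{1}(@divfK _ (a + b) _ c)// powRM ?divr_ge0 ?(ltW ab0)//.
  rewrite ler_wpM2r ?powR_ge0//.
  have [->|cn0] := eqVneq c 0; first by rewrite mul0r powR0 ?gt_eqF.
  apply: ge1r_powR; last exact: ltW.
  by rewrite ler_pdivrMr// mul1r cab andbT divr_gt0// lt_neqAle eq_sym cn0.
have := lerD (h a a0 _) (h b b0 _).
rewrite -mulrDl -mulrDl mulfV// mul1r; apply; lra.
Qed.

Lemma powR2D a b : 0 <= a -> 0 <= b -> (a + b) `^ p <= 2 `^ (p - 1) * (a `^ p + b `^ p).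
Proof.
move=> a0 b0; have h : 0 <= (2^-1 : R) <= 1 by lra.
have := powR_conv h a0 b0.
have -> : 2^-1 * a + (1 - 2^-1) * b = 2^-1 * (a + b) by lra.
have -> : 2^-1 * a `^ p + (1 - 2^-1) * b `^ p = 2^-1 * (a `^ p + b `^ p) by lra.
rewrite powRM ?addr_ge0// -!(powR_inv1 (ler0n _ 2)) -powRrM mulN1r.
move=> /(ler_wpM2l (powR_ge0 2 p)); rewrite mulrA -powRD ?subrr ?powRr0 ?mul1r; last first.
  by rewrite pnatr_eq0 implybT.
by rewrite mulrA -powRD// pnatr_eq0 implybT.
Qed.

Let mid s := (1 + s `^ p) / 2 - ((1 + s) / 2) `^ p.

Lemma mid_gt0 s : 0 <= s -> s < 1 -> 0 < mid s.
Proof.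
move=> s0 s1; rewrite /mid subr_gt0; set m := (1 + s) / 2.
have m0 : 0 < m by rewrite divr_gt0//; lra.
have h1 := powR_gt_tangent1 (u := 1 / m) (divr_ge0 ler01 (ltW m0)).
have h2 := powR_gt_tangent1 (u := s / m) (divr_ge0 s0 (ltW m0)).
have div1 c : c != m -> c / m != 1.
  by apply: contra_neq => /(congr1 ( *%R^~ m)); rewrite divfK ?gt_eqF// mul1r.
have e1 : 1 / m != 1 by apply: div1; rewrite gt_eqF// /m; lra.
have e2 : s / m != 1 by apply: div1; rewrite lt_eqF// /m; lra.
have := ltrD (h1 e1) (h2 e2).
have -> : 1 + p * (1 / m - 1) + (1 + p * (s / m - 1)) = 2 + p * ((1 + s) / m - 2) by lra.
have -> : (1 + s) / m = 2 by rewrite /m; field; rewrite gt_eqF//; lra.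
rewrite subrr mulr0 addr0 => h.
have mp : 0 < m `^ p by rewrite powR_gt0.
have : 2 * m `^ p < ((1 / m) `^ p + (s / m) `^ p) * m `^ p by rewrite ltr_pM2r.
have -> : ((1 / m) `^ p + (s / m) `^ p) * m `^ p = 1 + s `^ p.
  have E c : 0 <= c -> (c / m) `^ p * m `^ p = c `^ p.
    move=> c0; rewrite -powRM; [by rewrite divfK// gt_eqF|by rewrite divr_ge0// ltW|exact: ltW].
  by rewrite mulrDl !E// powR1.
lra.
Qed.

(* s, (1+t)/2, (1+t)/2 majorizes t, (1+s)/2, (1+s)/2. *)
Lemma mid_nincr s t : 0 <= s -> s <= t -> t < 1 -> mid t <= mid s.
Proof.
move=> s0 st t1; rewrite /mid; set m := (1 + t) / 2.
have ms : 0 < m - s by rewrite /m; lra.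
pose A := (m - t) / (m - s); pose B := ((t - s) / 2) / (m - s).
have AB : A + 2 * B = 1.
  rewrite /A /B /m; field; move: ms; rewrite /m => ms; apply: lt0r_neq0; lra.
have A0 : 0 <= A by rewrite divr_ge0// /m; lra.
have B0 : 0 <= B by rewrite !divr_ge0//; lra.
have m0 : 0 <= m by rewrite /m; lra.
have tE : t = A * s + (1 - A) * m.
  by rewrite /A; field; rewrite gt_eqF.
have mE : (1 + s) / 2 = B * s + (1 - B) * m.
  by rewrite /B /m; field; move: ms; rewrite /m => ms; apply: lt0r_neq0; lra.
have A01 : 0 <= A <= 1 by lra.
have B01 : 0 <= B <= 1 by lra.
have h1 := powR_conv A01 s0 m0; have h2 := powR_conv B01 s0 m0.
rewrite -tE in h1; rewrite -mE in h2.
have AE : A = 1 - 2 * B by lra.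
rewrite AE in h1; lra.
Qed.

(** By homogeneity only s = b / a <= 1 matters. If s <= 1 - d, the defect is at least a fixed
    multiple of a^p, by monotonicity of [mid]; otherwise |a - b| <= d a and the first term suffices,
    as d^p <= d <= e. The cap 1 / 2 keeps 1 - d in the range of [mid_gt0]. *)
Lemma powR_unif_convex e : 0 < e -> exists2 C, 0 <= C &
  forall a b, 0 <= a -> 0 <= b -> `|a - b| `^ p <=
    e * (a `^ p + b `^ p) + C * ((a `^ p + b `^ p) / 2 - ((a + b) / 2) `^ p).
Proof.
move=> e0; pose d := Num.min e 2^-1.
have d0 : 0 < d by rewrite lt_min e0/=; lra.
have de : d <= e by rewrite ge_min lexx.
have d1 : d <= 2^-1 by rewrite ge_min lexx orbT.
have m0 : 0 < mid (1 - d) by apply: mid_gt0; lra.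
exists (mid (1 - d))^-1; first by rewrite invr_ge0 ltW.
suff W a b : 0 <= b -> b <= a -> `|a - b| `^ p <=
    e * (a `^ p + b `^ p) + (mid (1 - d))^-1 * ((a `^ p + b `^ p) / 2 - ((a + b) / 2) `^ p).
  move=> a b a0 b0; have [ba|/ltW ab] := leP b a; first exact: W.
  by rewrite distrC [a `^ p + _]addrC [a + b]addrC; exact: W.
move=> b0 ba; have [a0|an0] := eqVneq a 0.
  have -> : b = 0 by lra.
  rewrite a0 subrr normr0 powR0 ?gt_eqF// !addr0 mulr0 mul0r powR0 ?gt_eqF//; lra.
have a0 : 0 < a by rewrite lt_neqAle eq_sym an0 (le_trans b0).
pose s := b / a; have bE : b = a * s by rewrite /s mulrC divfK.
have s0 : 0 <= s by rewrite divr_ge0// ltW.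
have s1 : s <= 1 by rewrite ler_pdivrMr// mul1r.
have gE : (a `^ p + b `^ p) / 2 - ((a + b) / 2) `^ p = a `^ p * mid s.
  have -> : (a + b) / 2 = a * ((1 + s) / 2) by rewrite bE; lra.
  by rewrite bE (powRM _ (ltW a0) s0) (powRM _ (ltW a0)) ?divr_ge0 ?addr_ge0// /mid; field.
have ap0 := powR_ge0 a p; have bp0 := powR_ge0 b p.
have ep0 : 0 <= e * (a `^ p + b `^ p) by rewrite mulr_ge0 ?addr_ge0// ltW.
rewrite gE ger0_norm ?subr_ge0//.
have [sd|sd] := lerP s (1 - d).
  have : 1 <= (mid (1 - d))^-1 * mid s.
    by rewrite mulrC ler_pdivlMr// mul1r mid_nincr//; lra.
  move=> /(ler_wpM2l ap0); rewrite mulr1 => h.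
  apply: (@le_trans _ _ (a `^ p)); last lra.
  by rewrite ge0_ler_powR ?nnegrE ?subr_ge0// ?(ltW p_gt0) ?(ltW a0)//; lra.
have mid0 : 0 <= mid s.
  have [s1'|s1'] := ltP s 1; first exact/ltW/mid_gt0.
  have -> : s = 1 by lra.
  by rewrite /mid powR1 divff// powR1 subrr.
have : 0 <= (mid (1 - d))^-1 * (a `^ p * mid s) by rewrite !mulr_ge0// invr_ge0 ltW.
have : (a - b) `^ p <= e * a `^ p.
  apply: (@le_trans _ _ ((d * a) `^ p)).
    by rewrite ge0_ler_powR ?nnegrE ?subr_ge0// ?(ltW p_gt0) ?mulr_ge0 ?(ltW a0) ?(ltW d0)// bE; nra.
  rewrite powRM ?(ltW a0) ?(ltW d0)// ler_wpM2r//.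
  by apply: le_trans de; apply: ge1r_powR; [lra|exact: ltW].
have : 0 <= e * b `^ p by rewrite mulr_ge0// ltW.
lra.
Qed.

Lemma powR_young a c : 0 <= a -> 0 <= c -> p * (c `^ (p - 1) * a) <= a `^ p + (p - 1) * c `^ p.
Proof.
move=> a0 c0; have := powR_ge_tangent a0 c0.
rewrite -(mulr_powRB1 c0 p_gt0); set q := c `^ (p - 1); lra.
Qed.

End real_powers.

Opaque Kfun excess.

(** * The maximal function and its weighted p-th powers *)

Section max_rearrangement.
Context (R : realType) (alpha : \bar R).
Local Open Scope ereal_scope.
Local Notation mu := (@lebesgue_measure R).
Local Notation I := (itvI alpha).
Local Notation L0 := (@L0 R alpha).
Local Notation Kfun := (Kfun alpha).
Local Notation max_rearr := (max_rearr alpha).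
Local Notation aeI := (aeI alpha).
Implicit Types (x y z : R -> \bar R) (s t l : R).

Lemma max_rearr_ge0 x t : (0 <= t)%R -> 0 <= max_rearr x t.
Proof. by move=> t0; rewrite max_rearrE mule_ge0 ?Kfun_ge0// lee_fin invr_ge0. Qed.

Lemma max_rearr0 x : max_rearr x 0 = 0.
Proof. by rewrite max_rearrE invr0 mul0e. Qed.

Lemma Kfun_max_rearr x t : (0 < t)%R -> Kfun x t = t%:E * max_rearr x t.
Proof. by move=> t0; rewrite max_rearrE muleA -EFinM mulfV ?gt_eqF// mul1e. Qed.

Lemma max_rearr_nincr x s t : L0 x -> (0 < s)%R -> (s <= t)%R ->
  max_rearr x t <= max_rearr x s.
Proof.
move=> mx s0 st; have t0 := lt_le_trans s0 st.
rewrite !max_rearrE lee_pdivrMl//; apply: (le_trans (Kfun_ratio mx s0 st)).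
by rewrite muleA -EFinM.
Qed.

Lemma max_rearr_quasi x s t : (0 < s)%R -> (s <= t)%R ->
  s%:E * max_rearr x s <= t%:E * max_rearr x t.
Proof.
move=> s0 st; rewrite -!Kfun_max_rearr ?(lt_le_trans s0 st)//; exact: Kfun_nd.
Qed.

Lemma measurable_max_rearr x : L0 x -> measurable_fun I (max_rearr x).
Proof.
move=> mx; have mI := measurable_itvI alpha.
have -> : I = (I `&` [set 0%R]) `|` (I `\ 0%R).
  apply/seteqP; split => [s Is|s [[]|[]]//].
  by have [s0|s0] := pselect (s = 0%R); [left|right].
apply/measurable_funU; [exact: measurableI|exact: measurableD|split].
  apply: (@eq_measurable_fun _ _ _ _ _ (cst 0)) => [s|]; last exact: measurable_cst.
  by rewrite inE => -[_ ->]; rewrite max_rearr0.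
apply: nonincreasing_emeasurable => [s t [[s0 sa] /= /eqP sn] [[t0 ta] _] r /andP[sr rt]|s t].
  split; first by split; [exact: le_trans sr|apply: le_lt_trans ta; rewrite lee_fin].
  by move=> /= rE; rewrite rE in sr; move: sn; rewrite eq_le s0 sr.
move=> [[s0 _] /= /eqP sn] _ st; apply: max_rearr_nincr => //.
by rewrite lt_neqAle eq_sym sn.
Qed.

Lemma max_rearrD x y z t : L0 x -> L0 y -> L0 z -> (0 <= t)%R ->
  aeI (fun s => `|z s| <= `|x s| + `|y s|) ->
  max_rearr z t <= max_rearr x t + max_rearr y t.
Proof.
move=> mx my mz t0 zxy; rewrite !max_rearrE -muleDr//; last by rewrite ge0_adde_def// inE Kfun_ge0.
apply: lee_wpmul2l; first by rewrite lee_fin invr_ge0.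
exact: KfunD.
Qed.

Lemma le_max_rearr x y t : L0 x -> L0 y -> (0 <= t)%R ->
  aeI (fun s => `|x s| <= `|y s|) -> max_rearr x t <= max_rearr y t.
Proof.
move=> mx my t0 xy; rewrite !max_rearrE.
apply: lee_wpmul2l; first by rewrite lee_fin invr_ge0.
exact: le_Kfun.
Qed.

Lemma eq_max_rearr x y t : L0 x -> L0 y -> (0 <= t)%R ->
  aeI (fun s => `|x s| = `|y s|) -> max_rearr x t = max_rearr y t.
Proof. by move=> mx my t0 xy; rewrite !max_rearrE (eq_Kfun mx my t0 xy). Qed.

Lemma max_rearr_scale x c t : L0 x -> (0 <= t)%R ->
  max_rearr (fscale c x) t = `|c|%:E * max_rearr x t.
Proof. by move=> mx t0; rewrite !max_rearrE Kfun_scale// muleCA. Qed.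

Lemma max_rearr_series (d : nat -> R -> \bar R) z t : (forall n, L0 (d n)) -> L0 z -> (0 <= t)%R ->
  aeI (fun s => `|z s| <= \sum_(n <oo) `|d n s|) ->
  max_rearr z t <= \sum_(n <oo) max_rearr (d n) t.
Proof.
move=> md mz t0 zd; rewrite nneseriesZl; last by move=> *; exact: Kfun_ge0.
apply: lee_wpmul2l; first by rewrite lee_fin invr_ge0.
exact: Kfun_series.
Qed.

(** Beyond the measure of the interval x^* vanishes, so the level 0 is optimal. *)
Lemma Kfun_end x (a t : R) : L0 x -> alpha = a%:E -> (0 < a)%R -> (a <= t)%R ->
  Kfun x t = Kfun x a.
Proof.
move=> mx aE a0 at_; apply/le_anti; rewrite (Kfun_nd _ _ at_) andbT.
have ra : rearr alpha x a = 0%:E.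
  apply/le_anti; rewrite rearr_ge0 andbT; rewrite rearr_leE//.
  have <- : mu I = a%:E by rewrite lebesgue_measure_itvI aE// lee_fin ltW.
  apply: le_measure; rewrite ?inE; [exact: measurable_distr|exact: measurable_itvI|].
  by move=> s [].
rewrite (Kfun_rearr mx (lexx _) (ltW a0) ra) mul0r add0e.
apply: (le_trans (Kfun_le mx (lexx _) (le_trans (ltW a0) at_))).
by rewrite mul0r add0e.
Qed.

End max_rearrangement.

Transparent Kfun excess.

Section weighted_integral.
Context (R : realType) (alpha : \bar R) (p : R) (w : R -> R).
Hypothesis p_gt1 : (1 < p)%R.
Hypothesis w_meas : measurable_fun (itvI alpha) w.
Hypothesis w_ge0 : forall t, itvI alpha t -> (0 <= w t)%R.
Local Open Scope ereal_scope.
Local Notation mu := (@lebesgue_measure R).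
Local Notation I := (itvI alpha).
Implicit Types (f g h : R -> \bar R) (s t c : R).

Let p_gt0 : (0 < p)%R. Proof. by rewrite (lt_trans _ p_gt1). Qed.

(** The p-th power of the norm of L^p(w), without the root, so that pointwise inequalities between
    p-th powers integrate directly. *)
Definition wint f : \bar R := \int[mu]_(t in I) (f t `^ p * (w t)%:E).

Lemma measurable_wint f : measurable_fun I f ->
  measurable_fun I (fun t => f t `^ p * (w t)%:E).
Proof.
move=> mf; apply: emeasurable_funM; last exact/measurable_EFinP.
exact: (measurableT_comp (measurable_poweR p)).
Qed.

Lemma wint_part_ge0 f t : I t -> 0 <= f t `^ p * (w t)%:E.
Proof. by move=> It; rewrite mule_ge0 ?poweR_ge0// lee_fin w_ge0. Qed.

Lemma wint_ge0 f : 0 <= wint f.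
Proof. by apply: integral_ge0 => t It; exact: wint_part_ge0. Qed.

Lemma le_poweR (a b : \bar R) : 0 <= a -> a <= b -> a `^ p <= b `^ p.
Proof.
move=> a0 ab; apply: gt0_ler_poweR => //; rewrite ?in_itv/= ?leey ?andbT//.
  exact: ltW.
exact: le_trans ab.
Qed.

Lemma le_wint f g : measurable_fun I f -> measurable_fun I g ->
  (forall t, I t -> 0 <= f t) -> (forall t, I t -> f t <= g t) -> wint f <= wint g.
Proof.
move=> mf mg f0 fg; apply: ge0_le_integral.
- exact: measurable_itvI.
- by move=> t It; exact: wint_part_ge0.
- exact: measurable_wint.
- exact: measurable_wint.
- by move=> t It; rewrite lee_wpmul2r ?lee_fin ?w_ge0// le_poweR ?f0 ?fg.
Qed.

Lemma wintZ (a : \bar R) f : measurable_fun I f -> 0 <= a -> (forall t, I t -> 0 <= f t) ->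
  wint (fun t => a * f t) = a `^ p * wint f.
Proof.
move=> mf a0 f0; rewrite /wint -ge0_integralZl//; first last.
- by rewrite poweR_ge0.
- by move=> t It; exact: wint_part_ge0.
- exact: measurable_wint.
- exact: measurable_itvI.
by apply: eq_integral => t; rewrite inE => It; rewrite poweRM ?f0// muleA.
Qed.

Lemma wint_lower f (A : set R) (a : \bar R) : measurable_fun I f -> measurable A -> A `<=` I ->
  0 <= a -> (forall t, A t -> a <= f t) -> a `^ p * \int[mu]_(t in A) (w t)%:E <= wint f.
Proof.
move=> mf mA AI a0 af; have mI := measurable_itvI alpha.
have mwA : measurable_fun A (EFin \o w).
  by apply/measurable_EFinP; exact: measurable_funS w_meas.
rewrite -ge0_integralZl ?poweR_ge0//; last by move=> t /AI It; rewrite lee_fin w_ge0.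
apply: (@le_trans _ _ (\int[mu]_(t in A) (f t `^ p * (w t)%:E))).
  apply: ge0_le_integral => //.
  - by move=> t /AI It; rewrite mule_ge0 ?poweR_ge0// lee_fin w_ge0.
  - exact: emeasurable_funM.
  - by apply: (measurable_funS mI AI); exact: measurable_wint.
  - by move=> t At; rewrite lee_wpmul2r ?lee_fin ?w_ge0 ?le_poweR ?af//; exact: AI.
apply: ge0_subset_integral => //; first exact: measurable_wint.
by move=> t It; exact: wint_part_ge0.
Qed.

(** The common passage from pointwise inequalities to L^p(w): the uniform convexity, defect,
    Minkowski and strictness bounds below all have this shape. *)
Lemma wint_lin2 (a b c d : R) f1 f2 f3 f4 :
  measurable_fun I f1 -> measurable_fun I f2 -> measurable_fun I f3 -> measurable_fun I f4 ->
  (0 <= a)%R -> (0 <= b)%R -> (0 <= c)%R -> (0 <= d)%R ->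
  (forall t, I t -> a%:E * f1 t `^ p + b%:E * f2 t `^ p <= c%:E * f3 t `^ p + d%:E * f4 t `^ p) ->
  a%:E * wint f1 + b%:E * wint f2 <= c%:E * wint f3 + d%:E * wint f4.
Proof.
move=> m1 m2 m3 m4 a0 b0 c0 d0 H; have mI := measurable_itvI alpha.
have g0 (e : R) f t : (0 <= e)%R -> I t -> 0 <= e%:E * (f t `^ p * (w t)%:E).
  by move=> e0 It; rewrite mule_ge0 ?lee_fin// wint_part_ge0.
have mg (e : R) f : measurable_fun I f -> measurable_fun I (fun t => e%:E * (f t `^ p * (w t)%:E)).
  by move=> mf; apply: emeasurable_funM => //; exact: measurable_wint.
have E (e1 e2 : R) f f' : (0 <= e1)%R -> (0 <= e2)%R -> measurable_fun I f -> measurable_fun I f' ->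
    e1%:E * wint f + e2%:E * wint f' = \int[mu]_(t in I)
      (e1%:E * (f t `^ p * (w t)%:E) + e2%:E * (f' t `^ p * (w t)%:E)).
  move=> e10 e20 mf mf'; rewrite ge0_integralD//; first last.
  - exact: mg.
  - by move=> t It; exact: g0.
  - exact: mg.
  - by move=> t It; exact: g0.
  rewrite ge0_integralZl ?lee_fin//; first last.
  - by move=> t It; exact: wint_part_ge0.
  - exact: measurable_wint.
  rewrite ge0_integralZl ?lee_fin//; first last.
  - by move=> t It; exact: wint_part_ge0.
  - exact: measurable_wint.
rewrite (E _ _ _ _ a0 b0 m1 m2) (E _ _ _ _ c0 d0 m3 m4).
apply: ge0_le_integral => //.
- by move=> t It; rewrite adde_ge0// g0.
- by apply: emeasurable_funD; exact: mg.
- by apply: emeasurable_funD; exact: mg.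
- move=> t It; have := H _ It; move/(lee_wpmul2r (_ : 0 <= (w t)%:E)).
  rewrite !muleA => h; rewrite -!muleDl; first apply: h; rewrite ?lee_fin ?w_ge0//.
  all: by rewrite ge0_adde_def// inE mule_ge0 ?poweR_ge0// lee_fin.
Qed.

Lemma poweR_pty : (+oo : \bar R) `^ p = +oo.
Proof. by rewrite poweRyr// gt_eqF. Qed.

Lemma poweRD_super (a b : \bar R) : 0 <= a -> 0 <= b -> a `^ p + b `^ p <= (a + b) `^ p.
Proof.
case: a => [a||]// a0; last by move=> b0; rewrite addye ?gt_eqF ?(lt_le_trans (ltNye 0))// poweR_pty leey.
case: b => [b||]// b0; last by rewrite addey// poweR_pty leey.
by rewrite -[a%:E + b%:E]EFinD !poweR_EFin -!EFinD lee_fin powRD_super.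
Qed.

Lemma poweR2D (a b : \bar R) : 0 <= a -> 0 <= b ->
  (a + b) `^ p <= (2 `^ (p - 1))%:E * (a `^ p + b `^ p).
Proof.
have c0 : (0 < 2 `^ (p - 1) :> R)%R by rewrite powR_gt0.
case: a => [a||]// a0; last first.
  move=> b0; rewrite poweR_pty [+oo + b `^ p]addye ?gt0_muley ?leey ?lte_fin//.
  by rewrite gt_eqF// (lt_le_trans (ltNye 0))// poweR_ge0.
case: b => [b||]// b0; last by rewrite poweR_pty addey// gt0_muley ?lte_fin// leey.
by rewrite -[a%:E + b%:E]EFinD !poweR_EFin -!EFinD lee_fin powR2D.
Qed.

Lemma wintD f g : measurable_fun I f -> measurable_fun I g ->
  (forall t, I t -> 0 <= f t) -> (forall t, I t -> 0 <= g t) ->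
  wint (f \+ g) <= (2 `^ (p - 1))%:E * (wint f + wint g).
Proof.
move=> mf mg f0 g0.
suff : 1%:E * wint (f \+ g) + 0%:E * wint f <=
    (2 `^ (p - 1))%:E * wint f + (2 `^ (p - 1))%:E * wint g.
  by rewrite mul1e mul0e adde0 => H; rewrite (ge0_muleDr _ (wint_ge0 f) (wint_ge0 g)).
apply: wint_lin2; rewrite ?powR_ge0//; first exact: emeasurable_funD.
move=> t It; rewrite mul1e mul0e adde0 -ge0_muleDr ?poweR_ge0//.
by apply: poweR2D; [exact: f0|exact: g0].
Qed.

End weighted_integral.

Section ereal_sequences.
Context (R : realType).
Local Open Scope ereal_scope.

Lemma cvge0P (a : nat -> \bar R) : (forall n, 0 <= a n) ->
  (a n @[n --> \oo] --> 0) <->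
  (forall e : R, (0 < e)%R -> exists N, forall n, (N <= n)%N -> a n <= e%:E).
Proof.
move=> a0; split => [/fine_cvgP[[M _ fM] /cvgrPdist_le h] e e0|H].
  have [N _ HN] := h e e0; exists (maxn M N) => n; rewrite geq_max => /andP[Mn Nn].
  have := HN n Nn; rewrite /= sub0r normrN ger0_norm ?fine_ge0// => ae.
  by rewrite -(fineK (fM n Mn)) lee_fin.
have fin N e : (forall n, (N <= n)%N -> a n <= e%:E) -> forall n, (N <= n)%N -> a n \is a fin_num.
  move=> HN n Nn; rewrite ge0_fin_numE//; exact: le_lt_trans (HN n Nn) (ltry _).
apply/fine_cvgP; split.
  by have [N HN] := H _ ltr01; exists N => // n /= Nn; exact: fin HN n Nn.
apply/cvgrPdist_le => e e0; have [N HN] := H e e0; exists N => // n /= Nn.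
rewrite sub0r normrN ger0_norm ?fine_ge0// -lee_fin fineK; last exact: fin HN n Nn.
exact: HN.
Qed.

End ereal_sequences.

Opaque Kfun excess.

Section gamma_functional.
Context (R : realType) (alpha : \bar R) (p : R) (w : R -> R).
Hypothesis p_gt1 : (1 < p)%R.
Hypothesis w_meas : measurable_fun (itvI alpha) w.
Hypothesis w_ge0 : forall t, itvI alpha t -> (0 <= w t)%R.
Local Open Scope ereal_scope.
Local Notation mu := (@lebesgue_measure R).
Local Notation I := (itvI alpha).
Local Notation L0 := (@L0 R alpha).
Local Notation Kfun := (Kfun alpha).
Local Notation max_rearr := (max_rearr alpha).
Local Notation aeI := (aeI alpha).
Local Notation wint := (wint alpha p w).
Local Notation W := (W w).
Implicit Types (f g h x y : R -> \bar R) (s t c : R).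

Let p_gt0 : (0 < p)%R. Proof. by rewrite (lt_trans _ p_gt1). Qed.
Let mI : measurable I. Proof. exact: measurable_itvI. Qed.

(* The p-th power of the norm. *)
Definition gint x := wint (max_rearr x).

Lemma sub_itvI (t : R) : t%:E <= alpha -> `[0%R, t[ `<=` I.
Proof. by move=> ta s /=; rewrite in_itv/= => /andP[s0 st]; split => //; apply: lt_le_trans ta. Qed.

Lemma measurable_w (A : set R) : measurable A -> A `<=` I -> measurable_fun A (EFin \o w).
Proof. by move=> mA AI; apply/measurable_EFinP; exact: measurable_funS w_meas. Qed.

Lemma W_ge0 t : t%:E <= alpha -> 0 <= W t.
Proof. by move=> ta; apply: integral_ge0 => s /(sub_itvI ta) /w_ge0; rewrite lee_fin. Qed.

Lemma W_split s t : (0 <= s)%R -> (s <= t)%R -> t%:E <= alpha ->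
  W t = W s + \int[mu]_(r in `]s, t[) (w r)%:E.
Proof.
move=> s0 st ta.
have sub : `[s, t[ `<=` I.
  apply: subset_trans (sub_itvI ta) => r /=; rewrite !in_itv/= => /andP[sr ->].
  by rewrite (le_trans s0).
rewrite -(@integral_itv_bndoo _ _ _ _ true true); last first.
  by apply: measurable_w => //; apply: subset_trans sub; exact: subset_itv_oo_co.
rewrite /Defs.W (_ : `[0%R, t[%classic = `[0%R, s[ `|` `[s, t[); last first.
  by rewrite -itv_bndbnd_setU// bnd_simp.
rewrite ge0_integral_setU//=.
- by apply: measurable_w; [exact: measurableU|rewrite subUset; split => //; apply: sub_itvI; apply: le_trans ta; rewrite lee_fin].
- move=> r [|/sub /w_ge0]; last by rewrite lee_fin.
  by rewrite /= in_itv/= => /andP[r0 rs]; rewrite lee_fin w_ge0//; split => //; apply: lt_le_trans ta; rewrite lte_fin (lt_le_trans rs).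
- by apply/disj_setPRL => r /=; rewrite !in_itv/= => /andP[sr _]; rewrite ltNge sr andbF.
Qed.

Lemma gint_ge0 x : 0 <= gint x. Proof. exact: wint_ge0. Qed.

Lemma max_rearr_ge0I x t : I t -> 0 <= max_rearr x t.
Proof. by case=> t0 _; exact: max_rearr_ge0. Qed.

Lemma gint_lower x t : L0 x -> (0 < t)%R -> t%:E <= alpha -> max_rearr x t `^ p * W t <= gint x.
Proof.
move=> mx t0 ta.
have sub : `]0%R, t[ `<=` I.
  by apply: subset_trans (sub_itvI ta); exact: subset_itv_oo_co.
rewrite /Defs.W (@integral_itv_bndoo _ _ _ _ true true); last exact: measurable_w.
apply: wint_lower => //; [exact: measurable_max_rearr|apply: max_rearr_ge0; exact: ltW|].
by move=> s /=; rewrite in_itv/= => /andP[s0 /ltW st]; exact: max_rearr_nincr.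
Qed.

(** K x is nondecreasing, so that x ** at s >= t is at least K x t / s. *)
Lemma gint_lower_tail x t : L0 x -> (0 < t)%R ->
  Kfun x t `^ p * \int[mu]_(s in [set s | (t <= s)%R /\ s%:E < alpha]) (s `^ (- p) * w s)%:E
  <= gint x.
Proof.
move=> mx t0; set A := [set s | _].
have AI : A `<=` I by move=> s [ts sa]; split => //; rewrite (le_trans (ltW t0)).
have mA : measurable A.
  apply: is_interval_measurable => r s [tr ra] [ts sa] q /andP[rq qs]; split.
    exact: le_trans rq.
  by apply: le_lt_trans sa; rewrite lee_fin.
have s0 s : A s -> (0 < s)%R by move=> [ts _]; exact: lt_le_trans ts.
have pw (s : R) : (0 < s)%R -> (s `^ (- p) = (s^-1) `^ p)%R.
  by move=> s0'; rewrite -(powR_inv1 (ltW s0')) -powRrM mulN1r.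
have mP : measurable_fun A (fun s => (s `^ (- p) * w s)%:E).
  apply/measurable_EFinP/measurable_funM; last exact: measurable_funS w_meas.
  by apply: measurable_funTS; exact: measurable_powR.
rewrite -ge0_integralZl ?poweR_ge0//; last first.
  by move=> s As; rewrite lee_fin mulr_ge0 ?powR_ge0// w_ge0//; exact: AI.
apply: (@le_trans _ _ (\int[mu]_(s in A) (max_rearr x s `^ p * (w s)%:E))).
  apply: ge0_le_integral => //.
  - move=> s As; rewrite mule_ge0 ?poweR_ge0// lee_fin mulr_ge0 ?powR_ge0// w_ge0//; exact: AI.
  - exact: emeasurable_funM.
  - apply: (measurable_funS mI AI); apply: measurable_wint => //; exact: measurable_max_rearr.
  - move=> s As; rewrite EFinM muleA lee_wpmul2r ?lee_fin ?w_ge0//; first exact: AI.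
    rewrite pw ?s0// -poweR_EFin -poweRM ?Kfun_ge0 ?lee_fin ?invr_ge0 ?(ltW (s0 _ As))//.
    apply: le_poweR => //; first by rewrite mule_ge0 ?Kfun_ge0// lee_fin invr_ge0 ltW// s0.
    rewrite muleC max_rearrE lee_wpmul2l ?lee_fin ?invr_ge0 ?(ltW (s0 _ As))//.
    by apply: Kfun_nd; case: As.
apply: ge0_subset_integral => //; first by apply: measurable_wint => //; exact: measurable_max_rearr.
by move=> s Is; rewrite mule_ge0 ?poweR_ge0// lee_fin w_ge0.
Qed.

Lemma poweR_ltyP (a : \bar R) : 0 <= a -> a `^ p < +oo -> a < +oo.
Proof. by move=> a0 /(@lty_poweRy _ a p); apply; rewrite gt_eqF. Qed.

(** This says that w is not a.e. zero, in the form that [gint_lower] turns into a lower bound for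
    the norm. *)
Definition weight_pos := exists2 t, (0 < t)%R & t%:E <= alpha /\ 0 < W t.

Lemma Kfun_fin x t : weight_pos -> L0 x -> gint x < +oo -> (0 < t)%R -> Kfun x t < +oo.
Proof.
move=> [T T0 [Ta WT]] mx xfin t0.
have KT : Kfun x T < +oo.
  rewrite Kfun_max_rearr// lte_mul_pinfty ?lee_fin ?(ltW T0)//.
  apply: poweR_ltyP; first by apply: max_rearr_ge0; exact: ltW.
  have := le_lt_trans (gint_lower mx T0 Ta) xfin.
  case: (max_rearr x T `^ p) (poweR_ge0 (max_rearr x T) p) => [r||]// _; first by rewrite ltry.
  by rewrite gt0_mulye.
have [tT|Tt] := leP t T; first exact: le_lt_trans (Kfun_nd _ _ tT) KT.
apply: (le_lt_trans (Kfun_ratio mx T0 (ltW Tt))).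
by rewrite lte_mul_pinfty// lee_fin divr_ge0// ltW.
Qed.

(** Finiteness of K x 1 makes the part of |x| above some level integrable. *)
Lemma gint_fin_ae x : weight_pos -> L0 x -> gint x < +oo -> aeI (fun s => x s \is a fin_num).
Proof.
move=> wp mx xfin; have KT := Kfun_fin wp mx xfin ltr01.
have [l [l0 _ E]] := Kfun_attained mx ltr01 KT.
have ex : excess alpha l x < +oo.
  by apply: le_lt_trans KT; rewrite E leeDr// lee_fin mulr_ge0.
have : mu.-integrable I (fun s => maxe (`|x s| - l%:E) 0).
  apply/integrableP; split; first exact: measurable_excess_fun.
  apply: le_lt_trans ex; rewrite le_eqVlt; apply/orP; left; apply/eqP.
  by apply: eq_integral => s _; rewrite gee0_abs// excess_part_ge0.
move=> ix; have : aeI (fun s => maxe (`|x s| - l%:E) 0 \is a fin_num).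
  by apply: integrable_ae ix; exact: mI.
apply: aeIS => s Is.
by case: (x s).
Qed.

End gamma_functional.

Transparent Kfun excess.

Section weighted_gap.
Context (R : realType) (alpha : \bar R) (p : R) (w : R -> R).
Hypothesis p_gt1 : (1 < p)%R.
Hypothesis w_meas : measurable_fun (itvI alpha) w.
Hypothesis w_ge0 : forall t, itvI alpha t -> (0 <= w t)%R.
Local Open Scope ereal_scope.
Local Notation mu := (@lebesgue_measure R).
Local Notation I := (itvI alpha).
Local Notation wint := (wint alpha p w).
Local Notation W := (W w).
Implicit Types (f g h : R -> \bar R) (s t c : R).

Let p_gt0 : (0 < p)%R. Proof. by rewrite (lt_trans _ p_gt1). Qed.

Hypothesis W_fin : forall t, (0 < t)%R -> t%:E <= alpha -> W t < +oo.
Hypothesis W_incr : forall s t, (0 <= s)%R -> (s < t)%R -> t%:E <= alpha -> W s < W t.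

(* f is nonincreasing and t g(t) is nondecreasing, so that a gap at t0 persists
   slightly to the left of t0, where w has mass. *)
Lemma wint_gap t0 (B e : R) : (0 < t0)%R -> t0%:E <= alpha -> (0 <= B)%R -> (0 < e)%R ->
  exists2 d : R, (0 < d)%R & forall f g, measurable_fun I f -> measurable_fun I g ->
    (forall t, (0 < t)%R -> (t <= t0)%R -> f t0 <= f t) ->
    (forall t, (0 < t)%R -> (t <= t0)%R -> t%:E * g t <= t0%:E * g t0) ->
    0 <= g t0 -> g t0 <= B%:E -> g t0 + e%:E <= f t0 ->
    d%:E <= wint (fun t => `|f t - g t|).
Proof.
move=> t00 t0a B0 e0.
(* Chosen so that t0 c / t <= c + e / 2 whenever t > t1 and c <= B: on ]t1, t0[ the growth of g
   consumes at most half of the gap e. *)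
pose t1 := (t0 * (2 * B / (2 * B + e)))%R.
have Be : (0 < 2 * B + e)%R by rewrite ltr_wpDl// mulr_ge0.
have t10 : (0 <= t1)%R by rewrite /t1 mulr_ge0 ?(ltW t00)// divr_ge0 ?(ltW Be)// mulr_ge0.
have t1t0 : (t1 < t0)%R by rewrite /t1 gtr_pMr// ltr_pdivrMr// mul1r ltrDl.
have := W_incr t10 t1t0 t0a; rewrite (W_split w_meas w_ge0 t10 (ltW t1t0) t0a).
set A := \int[mu]_(r in `]t1, t0[) _ => lA.
have Afin : A < +oo.
  have := W_fin t00 t0a; rewrite (W_split w_meas w_ge0 t10 (ltW t1t0) t0a) -/A.
  apply: le_lt_trans; rewrite leeDr//; apply: (W_ge0 w_ge0).
  by apply: le_trans t0a; rewrite lee_fin ltW.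
have sub : `]t1, t0[ `<=` I.
  apply: subset_trans (sub_itvI t0a) => r /=; rewrite !in_itv/= => /andP[r1 ->].
  by rewrite (le_trans t10) ?ltW.
have A0 : 0 <= A by apply: integral_ge0 => r /sub /w_ge0; rewrite lee_fin.
have [a a0 aE] := ge0_fin_real A0 Afin.
have agt0 : (0 < a)%R.
  rewrite lt_neqAle a0 andbT; apply/eqP => a0'; move: lA.
  by rewrite aE -a0' adde0 ltxx.
exists ((e / 2) `^ p * a)%R; first by rewrite mulr_gt0// powR_gt0// divr_gt0.
move=> f g mf mg hf hg g0 gB gf.
have mfg : measurable_fun I (fun t => `|f t - g t|).
  apply: (measurableT_comp (f := abse)) => //; exact: emeasurable_funB.
have := @wint_lower R alpha p w p_gt1 w_meas w_ge0 (fun t => `|f t - g t|) `]t1, t0[ (e / 2)%:E mfg.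
rewrite -/A aE poweR_EFin -EFinM; apply => //.
  by rewrite lee_fin divr_ge0// ltW.
move=> t; rewrite /= in_itv/= => /andP[t1t tt0].
have t0' : (0 < t)%R by exact: le_lt_trans t1t.
apply: le_trans (lee_abs _).
have [c c0 cE] := ge0_fin_real g0 (le_lt_trans gB (ltry _)).
move: gB gf (hg t t0' (ltW tt0)) (hf t t0' (ltW tt0)); rewrite cE lee_fin => cB.
have key r : (t * r <= t0 * c -> r <= c + e / 2)%R.
  move=> h; rewrite -(ler_pM2l t0'); apply: (le_trans h).
  have h1 : (t0 * (2 * B) < t * (2 * B + e))%R.
    by move: t1t; rewrite /t1 mulrA ltr_pdivrMr.
  have h2 : ((t0 - t) * c <= (t0 - t) * B)%R by rewrite ler_wpM2l// subr_ge0 ltW.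
  lra.
case: (g t) => [r||]; rewrite -?EFinM.
- rewrite lee_fin => gf /key rc; have := leeD2r (- r%:E) (_ : f t0 <= f t).
  move=> /[swap] ft; move=> /(_ ft); apply: le_trans.
  move: gf; case: (f t0) => [q||]//; rewrite -EFinD ?lee_fin => gf; last by rewrite leey.
  lra.
- by rewrite gt0_muley ?lte_fin// leye_eq.
- by move=> gf _ ft; case: (f t) ft gf => [u||]//; case: (f t0) => // *; rewrite leey.
Qed.

(** Here h stands for the maximal function of a sum: it is at most f + g and almost as long as
    convexity allows. [powR_unif_convex] is integrated with h / 2 in place of the midpoint, which is
    the origin of the factor q = 2^(- p). *)
Lemma wint_unif_convex (e : R) : (0 < e)%R -> exists2 C : R, (0 <= C)%R &
  forall f g h (d : R), measurable_fun I f -> measurable_fun I g -> measurable_fun I h ->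
    (forall t, I t -> 0 <= f t < +oo) -> (forall t, I t -> 0 <= g t < +oo) ->
    (forall t, I t -> 0 <= h t <= f t + g t) ->
    wint f < +oo -> wint g < +oo ->
    (2 `^ (p - 1))%:E * (wint f + wint g) <= wint h + d%:E ->
    wint (fun t => `|f t - g t|) <= e%:E * (wint f + wint g) + (C * d)%:E.
Proof.
move=> e0; have [C0 C00 HC] := powR_unif_convex p_gt1 e0.
pose q := (2 `^ (- p) : R)%R.
have q0 : (0 <= q)%R by rewrite powR_ge0.
exists (C0 * q)%R; first by rewrite mulr_ge0.
move=> f g h d mf mg mh f0 g0 hfg wf wg H.
have f0' t : I t -> 0 <= f t by move=> /f0 /andP[].
have g0' t : I t -> 0 <= g t by move=> /g0 /andP[].
have mfg : measurable_fun I (fun t => `|f t - g t|).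
  apply: (measurableT_comp (f := abse)) => //; exact: emeasurable_funB.
have c0 : (0 <= e + C0 / 2)%R by rewrite addr_ge0 ?(ltW e0)// divr_ge0.
have Cq0 : (0 <= C0 * q)%R by rewrite mulr_ge0.
have L : 1%:E * wint (fun t => `|f t - g t|) + (C0 * q)%:E * wint h <=
    (e + C0 / 2)%:E * wint f + (e + C0 / 2)%:E * wint g.
  apply: wint_lin2 => // t It.
  have /andP[fa fb] := f0 t It; have /andP[ga gb] := g0 t It; have /andP[ha hb] := hfg t It.
  move: (hb); have [c c0' ->] : exists2 c, (0 <= c)%R & h t = c%:E.
    by apply: ge0_fin_real => //; apply: (le_lt_trans hb); rewrite lte_add_pinfty.
  have [a a0 ->] := ge0_fin_real fa fb; have [b b0 ->] := ge0_fin_real ga gb.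
  rewrite !lee_fin => cab; rewrite mul1r.
  have hq : (q * c `^ p <= ((a + b) / 2) `^ p)%R.
    rewrite /q powRN -(powR_inv1 (powR_ge0 _ _)) powRAC powR_inv1// -powRM//.
    rewrite mulrC; apply: ge0_ler_powR; rewrite ?nnegrE ?(ltW p_gt0) ?divr_ge0 ?addr_ge0//.
    by rewrite ler_wpM2r.
  have := HC a b a0 b0; have := ler_wpM2l C00 hq; lra.
have wh : wint h < +oo.
  apply: (@le_lt_trans _ _ (wint (f \+ g))).
    by apply: le_wint => //; [exact: emeasurable_funD|move=> t /hfg /andP[]|move=> t /hfg /andP[]].
  apply: (le_lt_trans (wintD p_gt1 w_meas w_ge0 mf mg f0' g0')).
  by rewrite lte_mul_pinfty ?lee_fin ?powR_ge0// lte_add_pinfty.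
have [F F0 FE] := ge0_fin_real (wint_ge0 p w_ge0 f) wf.
have [G G0 GE] := ge0_fin_real (wint_ge0 p w_ge0 g) wg.
have [H' H'0 HE] := ge0_fin_real (wint_ge0 p w_ge0 h) wh.
have D0 := wint_ge0 p w_ge0 (fun t => `|f t - g t|).
move: (wint (fun t => `|f t - g t|)) D0 L H => D D0.
rewrite FE GE HE -!(EFinD, EFinM) lee_fin mul1e.
case: D D0 => [D||]//; rewrite ?addye// -EFinD !lee_fin => D0 L H.
have pq : (q * 2 `^ (p - 1) = 2^-1 :> R)%R.
  rewrite /q -powRD ?pnatr_eq0 ?implybT//.
  have -> : (- p + (p - 1) = -1)%R by lra.
  by rewrite powR_inv1.
have := ler_wpM2l Cq0 H.
have -> : (C0 * q * (2 `^ (p - 1) * (F + G)) = C0 * (q * 2 `^ (p - 1)) * (F + G))%R by lra.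
rewrite pq; lra.
Qed.

(** (f + g - h)^p + h^p <= (f + g)^p <= 2^(p - 1) (f^p + g^p), by superadditivity and convexity; the
    finite integral of h^p w then cancels. *)
Lemma wint_defect f g h (d : R) : measurable_fun I f -> measurable_fun I g -> measurable_fun I h ->
  (forall t, I t -> 0 <= f t < +oo) -> (forall t, I t -> 0 <= g t < +oo) ->
  (forall t, I t -> 0 <= h t <= f t + g t) -> wint h < +oo ->
  (2 `^ (p - 1))%:E * (wint f + wint g) <= wint h + d%:E ->
  wint (fun t => `|(f t + g t) - h t|) <= d%:E.
Proof.
move=> mf mg mh f0 g0 hfg wh H.
have f0' t : I t -> 0 <= f t by move=> /f0 /andP[].
have g0' t : I t -> 0 <= g t by move=> /g0 /andP[].
have mfgh : measurable_fun I (fun t => `|(f t + g t) - h t|).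
  apply: (measurableT_comp (f := abse)) => //; apply: emeasurable_funB => //; exact: emeasurable_funD.
have L : 1%:E * wint (fun t => `|(f t + g t) - h t|) + 1%:E * wint h <=
    (2 `^ (p - 1))%:E * wint f + (2 `^ (p - 1))%:E * wint g.
  apply: wint_lin2; rewrite ?powR_ge0// => t It; rewrite !mul1e.
  have [f0t g0t] := (f0' t It, g0' t It).
  rewrite -ge0_muleDr ?poweR_ge0//; apply: le_trans (poweR2D p_gt1 f0t g0t).
  have /andP[fa fb] := f0 t It; have /andP[ga gb] := g0 t It; have /andP[ha hb] := hfg t It.
  move: (hb); have [c c0 ->] : exists2 c, (0 <= c)%R & h t = c%:E.
    by apply: ge0_fin_real => //; apply: (le_lt_trans hb); rewrite lte_add_pinfty.
  have [a a0 ->] := ge0_fin_real fa fb; have [b b0 ->] := ge0_fin_real ga gb.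
  rewrite !lee_fin => cab; rewrite ger0_norm ?subr_ge0//.
  have -> : (a + b = (a + b - c) + c)%R by lra.
  by rewrite [X in (X `^ _ + _)%R]addrK powRD_super// subr_ge0.
have [H' H'0 HE] := ge0_fin_real (wint_ge0 p w_ge0 h) wh.
rewrite !mul1e -ge0_muleDr ?wint_ge0// in L; have := le_trans L H.
by rewrite HE [leRHS]addeC leeD2rE.
Qed.

End weighted_gap.

Local Opaque Defs.L0 Defs.max_rearr Kfun excess.

Section limits.
Context (R : realType) (alpha : \bar R) (p : R) (w : R -> R).
Hypothesis p_gt1 : (1 < p)%R.
Hypothesis w_meas : measurable_fun (itvI alpha) w.
Hypothesis w_ge0 : forall t, itvI alpha t -> (0 <= w t)%R.
Local Open Scope ereal_scope.
Local Notation mu := (@lebesgue_measure R).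
Local Notation I := (itvI alpha).
Local Notation L0 := (@L0 R alpha).
Local Notation max_rearr := (max_rearr alpha).
Local Notation aeI := (aeI alpha).
Local Notation wint := (wint alpha p w).
Local Notation gint := (gint alpha p w).
Implicit Types (g h x y z : R -> \bar R) (s t c : R).

Let p_gt0 : (0 < p)%R. Proof. by rewrite (lt_trans _ p_gt1). Qed.

Lemma ge0_dominated_cvg0 (f : nat -> R -> \bar R) g :
  (forall n, measurable_fun I (f n)) -> measurable_fun I g ->
  (forall n t, I t -> 0 <= f n t) -> (forall t, I t -> 0 <= g t) ->
  aeI (fun t => forall n, f n t <= g t) -> \int[mu]_(t in I) g t < +oo ->
  aeI (fun t => f n t @[n --> \oo] --> 0) ->
  \int[mu]_(t in I) f n t @[n --> \oo] --> 0.
Proof.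
move=> mf mg f0 g0 fg gfin fcvg.
have ig : mu.-integrable I g.
  apply/integrableP; split => //; apply: le_lt_trans gfin.
  rewrite le_eqVlt; apply/orP; left; apply/eqP.
  by apply: eq_integral => t; rewrite inE => It; rewrite gee0_abs//; exact: g0.
have [||_ _] := @dominated_convergence _ _ R mu I (measurable_itvI alpha) f (cst 0) g mf _ fcvg ig.
- exact: measurable_cst.
- have : aeI (fun t => forall n, `|f n t| <= g t).
    by move: fg; apply: aeIS => t It ft n; rewrite gee0_abs; [exact: ft|exact: f0].
  by rewrite /Defs.aeI; apply: filterS => t ft n It; exact: ft.
by rewrite integral0.
Qed.

Lemma wint_cvg0 (f : nat -> R -> \bar R) g :
  (forall n, measurable_fun I (f n)) -> measurable_fun I g ->
  (forall n t, I t -> 0 <= f n t) -> (forall n t, I t -> f n t <= g t) -> wint g < +oo ->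
  (forall t, I t -> (0 < t)%R -> f n t @[n --> \oo] --> 0) ->
  wint (f n) @[n --> \oo] --> 0.
Proof.
move=> mf mg f0 fg gfin fcvg.
apply: (@ge0_dominated_cvg0 _ (fun t => g t `^ p * (w t)%:E)) => //.
- by move=> n; exact: measurable_wint.
- exact: measurable_wint.
- by move=> n t It; exact: (wint_part_ge0 p w_ge0).
- by move=> t It; exact: (wint_part_ge0 p w_ge0).
- apply: aeI_all => t It n; apply: lee_wpmul2r; first by rewrite lee_fin w_ge0.
  by apply: le_poweR => //; [exact: f0|exact: fg].
have ae0 : {ae mu, forall t : R, t <> 0%R}.
  exists [set 0%R]; split => //; first exact: lebesgue_measure_set1.
  by move=> t /= /contrapT.
move: ae0; apply: filterS => t tn0 It; have t0 : (0 < t)%R.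
  by case: It => t0 _; rewrite lt_neqAle t0 andbT eq_sym; exact/eqP.
apply/cvge0P => [n|e e0]; first exact: (wint_part_ge0 p w_ge0).
have w1 : (0 < w t + 1)%R by rewrite ltr_wpDl// w_ge0.
have /cvge0P := fcvg t It t0.
move=> /(_ (fun n => f0 n t It)) /(_ (Num.min 1 (e / (w t + 1))))%R.
have m0 : (0 < Num.min 1 (e / (w t + 1)))%R by rewrite lt_min ltr01 divr_gt0.
move=> /(_ m0)[N HN]; exists N => n Nn; have := HN n Nn.
have := f0 n t It; case: (f n t) => [r||]//; rewrite !lee_fin le_min => r0 /andP[r1 re].
apply: (@le_trans _ _ (r * (w t + 1))%R); last by rewrite -ler_pdivlMr.
apply: ler_pM; rewrite ?powR_ge0 ?w_ge0// ?lerDl//.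
move: r0; rewrite le_eqVlt => /predU1P[<-|r0]; first by rewrite powR0// gt_eqF.
by apply: ge1r_powR; [rewrite r0 r1|exact: ltW].
Qed.

(** A crude triangle inequality for series: if M is the right-hand side, each a n is at most M^(1 /
    p) / 2^(n + 1), and these bounds add up to M^(1 / p). *)
Lemma poweR_series (a : nat -> \bar R) : (forall n, 0 <= a n) ->
  (\sum_(n <oo) a n) `^ p <= \sum_(n <oo) ((2 ^ n.+1)%:R `^ p)%:E * a n `^ p.
Proof.
move=> a0; set M := \sum_(n <oo) (_ * _).
have t0 n : 0 <= ((2 ^ n.+1)%:R `^ p)%:E * a n `^ p.
  by rewrite mule_ge0 ?poweR_ge0// lee_fin powR_ge0.
have M0 : 0 <= M by apply: nneseries_ge0 => *; exact: t0.
have [->|] := eqVneq M +oo; first by rewrite leey.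
rewrite -ltey => /(ge0_fin_real M0)[m m0 ME].
have am n : a n <= (m `^ p^-1 / (2 ^ n.+1)%:R)%:E.
  have : ((2 ^ n.+1)%:R `^ p)%:E * a n `^ p <= m%:E.
    rewrite -ME; apply: le_trans (nneseries_lim_ge n.+1 _) => //.
    by rewrite big_mkord big_ord_recr/= leeDr// sume_ge0.
  have c0 : (0 < (2 ^ n.+1)%:R :> R)%R by rewrite ltr0n expn_gt0.
  have := a0 n; case: (a n) => [r||]// r0; last first.
    by rewrite poweR_pty// gt0_muley ?leye_eq// lte_fin powR_gt0.
  rewrite poweR_EFin -EFinM !lee_fin.
  rewrite -powRM ?(ltW c0)// => h.
  rewrite ler_pdivlMr// mulrC.
  have cr0 : (0 <= (2 ^ n.+1)%:R * r)%R by rewrite mulr_ge0// ltW.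
  have <- : (((2 ^ n.+1)%:R * r) `^ p `^ p^-1 = (2 ^ n.+1)%:R * r)%R.
    by rewrite -powRrM mulfV ?gt_eqF// powRr1.
  by apply: ge0_ler_powR; rewrite ?nnegrE ?powR_ge0 ?invr_ge0 ?(ltW p_gt0).
apply: (@le_trans _ _ ((m `^ p^-1)%:E `^ p)).
  apply: le_poweR => //; first exact: nneseries_ge0.
  apply: (le_trans _ (epsilon_trick0 xpredT (powR_ge0 m p^-1))).
  by apply: lee_nneseries => // n _; exact: am.
by rewrite ME poweR_EFin -powRrM mulVf ?gt_eqF// powRr1.
Qed.

Lemma gint_series (d : nat -> R -> \bar R) z : (forall n, L0 (d n)) -> L0 z ->
  aeI (fun s => `|z s| <= \sum_(n <oo) `|d n s|) ->
  gint z <= \sum_(n <oo) ((2 ^ n.+1)%:R `^ p)%:E * gint (d n).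
Proof.
move=> md mz zd; have mI := measurable_itvI alpha.
pose q n : R := ((2 ^ n.+1)%:R `^ p)%R.
have q0 n : 0 <= (q n)%:E by rewrite lee_fin powR_ge0.
pose F n t := (q n)%:E * (max_rearr (d n) t `^ p * (w t)%:E).
have mm n : measurable_fun I (max_rearr (d n)) by exact: measurable_max_rearr.
have mw n : measurable_fun I (fun t => max_rearr (d n) t `^ p * (w t)%:E) by exact: measurable_wint.
have mF n : measurable_fun I (F n) by exact: emeasurable_funM.
have F0 n t : I t -> 0 <= F n t by move=> It; rewrite mule_ge0// (wint_part_ge0 p w_ge0).
have -> : \sum_(n <oo) (q n)%:E * gint (d n) = \sum_(n <oo) \int[mu]_(t in I) F n t.
  apply: eq_eseriesr => n _; rewrite ge0_integralZl//; first exact: mw.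
  by move=> t It; exact: (wint_part_ge0 p w_ge0).
rewrite -integral_nneseries//.
apply: ge0_le_integral => //.
- by move=> t It; exact: (wint_part_ge0 p w_ge0).
- by apply: measurable_wint => //; exact: measurable_max_rearr.
- by apply: (ge0_emeasurable_sum (P := xpredT)) => *; [exact: F0|exact: mF].
move=> t It; have [t0 _] := It.
have a0 n : 0 <= max_rearr (d n) t by exact: max_rearr_ge0.
apply: (@le_trans _ _ ((\sum_(n <oo) ((q n)%:E * max_rearr (d n) t `^ p)) * (w t)%:E)).
  apply: lee_wpmul2r; first by rewrite lee_fin w_ge0.
  apply: (le_trans _ (poweR_series a0)); apply: le_poweR => //; first exact: max_rearr_ge0.
  exact: max_rearr_series.
rewrite muleC -nneseriesZl; last by move=> n _; rewrite mule_ge0// poweR_ge0.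
rewrite le_eqVlt; apply/orP; left; apply/eqP; apply: eq_eseriesr => n _.
by rewrite /F muleC muleA.
Qed.

End limits.

(** * Sequences with asymptotically longest midpoints *)

Section midpoint_cauchy.
Context (R : realType) (alpha : \bar R) (p : R) (w : R -> R).
Hypothesis p_gt1 : (1 < p)%R.
Hypothesis w_meas : measurable_fun (itvI alpha) w.
Hypothesis w_ge0 : forall t, itvI alpha t -> (0 <= w t)%R.
Local Open Scope ereal_scope.
Local Notation mu := (@lebesgue_measure R).
Local Notation I := (itvI alpha).
Local Notation L0 := (@L0 R alpha).
Local Notation Kfun := (Kfun alpha).
Local Notation max_rearr := (max_rearr alpha).
Local Notation aeI := (aeI alpha).
Local Notation wint := (wint alpha p w).
Local Notation gint := (gint alpha p w).
Local Notation W := (W w).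
Implicit Types (f g h x y : R -> \bar R) (s t c : R).

Let p_gt0 : (0 < p)%R. Proof. by rewrite (lt_trans _ p_gt1). Qed.

Lemma le_gint x y : L0 x -> L0 y ->
  (forall t, (0 < t)%R -> max_rearr x t <= max_rearr y t) -> gint x <= gint y.
Proof.
move=> mx my xy; apply: (le_wint p_gt1 w_meas w_ge0).
- exact: measurable_max_rearr mx.
- exact: measurable_max_rearr my.
- by move=> t; exact: max_rearr_ge0I.
move=> t [t0 _]; move: t0; rewrite le_eqVlt => /predU1P[<-|]; last exact: xy.
by rewrite !max_rearr0.
Qed.

Lemma gintD x y z : L0 x -> L0 y -> L0 z ->
  aeI (fun s => `|z s| <= `|x s| + `|y s|) ->
  gint z <= (2 `^ (p - 1))%:E * (gint x + gint y).
Proof.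
move=> mx my mz zxy; apply: (@le_trans _ _ (wint (max_rearr x \+ max_rearr y))).
  apply: (le_wint p_gt1 w_meas w_ge0).
  - exact: measurable_max_rearr mz.
  - by apply: emeasurable_funD; exact: measurable_max_rearr.
  - by move=> t; exact: max_rearr_ge0I.
  - by move=> t [t0 _]; exact: max_rearrD mx my mz t0 zxy.
apply: (wintD p_gt1 w_meas w_ge0).
- exact: measurable_max_rearr mx.
- exact: measurable_max_rearr my.
- by move=> t; exact: max_rearr_ge0I.
- by move=> t; exact: max_rearr_ge0I.
Qed.

Lemma gint_scale x c : L0 x -> gint (fscale c x) = (`|c| `^ p)%:E * gint x.
Proof.
move=> mx; rewrite -poweR_EFin.
rewrite -(wintZ p w_meas w_ge0 (measurable_max_rearr mx) (lee_tofin (normr_ge0 c)) (fun t => @max_rearr_ge0I R alpha x t)).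
by apply: eq_integral => t; rewrite inE => -[t0 _]; rewrite max_rearr_scale.
Qed.

Lemma max_rearr_fin x t : weight_pos alpha w -> L0 x -> gint x < +oo -> (0 <= t)%R ->
  0 <= max_rearr x t < +oo.
Proof.
move=> wp mx gx t0; rewrite max_rearr_ge0//=.
move: t0; rewrite le_eqVlt => /predU1P[<-|t0]; first by rewrite max_rearr0.
rewrite max_rearrE lte_mul_pinfty ?lee_fin ?invr_ge0 ?(ltW t0)//.
exact: Kfun_fin p_gt1 w_meas w_ge0 _ _ wp mx gx t0.
Qed.

Hypothesis alphaE : alpha = 1%:E \/ alpha = +oo.
Hypothesis W_fin : forall t, (0 < t)%R -> t%:E <= alpha -> W t < +oo.
Hypothesis W_incr : forall s t, (0 <= s)%R -> (s < t)%R -> t%:E <= alpha -> W s < W t.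
Hypothesis W_infty : alpha = +oo -> forall M : R, exists2 t, (0 < t)%R & M%:E <= W t.
Hypothesis tail_infty : forall M : R, exists2 t, (0 < t)%R &
  M%:E <= \int[mu]_(s in [set s | (t <= s)%R /\ s%:E < alpha]) (s `^ (- p) * w s)%:E.

Let W0 : W 0 = 0. Proof. by rewrite /Defs.W set_itvco0 integral_set0. Qed.

Lemma one_le_alpha : 1%:E <= alpha.
Proof. by case: alphaE => ->; rewrite ?leey. Qed.

Lemma W_incr_pos : weight_pos alpha w.
Proof.
exists 1%R => //; split; first exact: one_le_alpha.
by rewrite -W0; exact: W_incr ltr01 one_le_alpha.
Qed.

Let wp := W_incr_pos.

(** Times beyond the end of a bounded interval are brought back to that end, where W gives
    information. *)
Lemma Kfun_alpha t : (0 < t)%R -> exists t' : R, [/\ (0 < t')%R, t'%:E <= alpha, (t' <= t)%R &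
  forall x, L0 x -> Kfun x t = Kfun x t'].
Proof.
move=> t0; case: alphaE => aE; last by exists t; split => //; rewrite aE leey.
have [t1|t1] := leP t 1%R; first by exists t; split => //; rewrite aE lee_fin.
exists 1%R; split => //; [by rewrite aE|exact: ltW|].
by move=> x mx; apply: Kfun_end => //; exact: ltW.
Qed.

Lemma gint_bound_Kfun (B t : R) : (0 <= B)%R -> (0 < t)%R -> t%:E <= alpha ->
  exists2 b : R, (0 <= b)%R & forall x, L0 x -> gint x <= B%:E -> max_rearr x t <= b%:E.
Proof.
move=> B0 t0 ta; have Wt : 0 < W t.
  by rewrite -W0; exact: W_incr.
have [V V0 VE] := ge0_fin_real (ltW Wt) (W_fin t0 ta).
have V_gt0 : (0 < V)%R by rewrite -lte_fin -VE.
exists ((B / V) `^ p^-1)%R; first by rewrite powR_ge0.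
move=> x mx xB; have := le_trans (gint_lower p_gt1 w_meas w_ge0 mx t0 ta) xB.
have /andP[] := max_rearr_fin wp mx (le_lt_trans xB (ltry _)) (ltW t0).
rewrite VE; case: (max_rearr x t) => [m||]//; rewrite lee_fin => m0 _.
rewrite poweR_EFin -EFinM !lee_fin -ler_pdivlMr// => h.
have <- : ((m `^ p) `^ p^-1 = m)%R by rewrite -powRrM mulfV ?gt_eqF// powRr1.
by apply: ge0_ler_powR; rewrite ?nnegrE ?powR_ge0 ?divr_ge0 ?invr_ge0 ?(ltW p_gt0).
Qed.

(** The norm controls K x t through the integral of s^-p w beyond t, which is as large as desired
    for small t: at the value (B + 1) / h^p, K x t > h would contradict gint x <= B. *)
Lemma Kfun_near0 (B h : R) : (0 <= B)%R -> (0 < h)%R -> exists2 t, (0 < t)%R &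
  forall x, L0 x -> gint x <= B%:E -> Kfun x t <= h%:E.
Proof.
move=> B0 h0; have [t t0 Ht] := tail_infty ((B + 1) / h `^ p)%R.
exists t => // x mx xB; rewrite leNgt; apply/negP => hK.
have := gint_lower_tail p_gt1 w_meas w_ge0 mx t0.
apply/negP; rewrite -ltNge; apply: (le_lt_trans xB).
apply: (@lt_le_trans _ _ (h%:E `^ p * ((B + 1) / h `^ p)%:E)).
  by rewrite poweR_EFin -EFinM lte_fin mulrC divfK ?gt_eqF ?powR_gt0//; lra.
apply: lee_pmul => //; rewrite ?poweR_ge0//.
  by rewrite lee_fin divr_ge0 ?powR_ge0// addr_ge0.
by apply: le_poweR => //; [rewrite lee_fin ltW|exact: ltW].
Qed.

(** On the half-line, x **(t)^p W t <= gint x with W t as large as desired. On the bounded interval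
    K x is constant beyond 1 and the linear bound overtakes it. *)
Lemma Kfun_nearoo (B l : R) : (0 <= B)%R -> (0 < l)%R -> exists2 t, (0 < t)%R &
  forall x, L0 x -> gint x <= B%:E -> Kfun x t <= (l * t)%:E.
Proof.
move=> B0 l0; case: alphaE => aE.
  have [|b b0 Hb] := gint_bound_Kfun B0 ltr01; first by rewrite aE.
  have bl0 : (0 <= b / l)%R by rewrite divr_ge0// ltW.
  exists (1 + b / l)%R; first by rewrite ltr_wpDr.
  move=> x mx xB; rewrite (Kfun_end mx aE ltr01) ?lerDl// Kfun_max_rearr// mul1e.
  apply: (le_trans (Hb x mx xB)); rewrite lee_fin mulrDr mulrCA divff ?gt_eqF//; lra.
have [t t0 Ht] := W_infty aE ((B + 1) / l `^ p)%R.
have ta : t%:E <= alpha by rewrite aE leey.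
exists t => // x mx xB; rewrite leNgt; apply/negP => hK.
have := gint_lower p_gt1 w_meas w_ge0 mx t0 ta.
apply/negP; rewrite -ltNge; apply: (le_lt_trans xB).
apply: (@lt_le_trans _ _ (l%:E `^ p * ((B + 1) / l `^ p)%:E)).
  by rewrite poweR_EFin -EFinM lte_fin mulrC divfK ?gt_eqF ?powR_gt0//; lra.
apply: lee_pmul => //; rewrite ?poweR_ge0//.
  by rewrite lee_fin divr_ge0 ?powR_ge0// addr_ge0.
apply: le_poweR => //; first by rewrite lee_fin ltW.
rewrite -(@lee_pmul2l _ t%:E)// -Kfun_max_rearr//.
by rewrite -EFinM mulrC ltW.
Qed.

Section sequence.
Variables (u : nat -> R -> \bar R) (B : R).
Hypothesis B_ge0 : (0 <= B)%R.
Hypothesis mu_ : forall n, L0 (u n).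
Hypothesis uB : forall n, gint (u n) <= B%:E.
(** The reverse, up to d, of the bound [gintD] for a sum. *)
Hypothesis midpoint : forall d : R, (0 < d)%R -> exists N, forall m n, (N <= m)%N -> (N <= n)%N ->
  (2 `^ (p - 1))%:E * (gint (u m) + gint (u n)) <= gint (u m \+ u n) + d%:E.

Let a n t := max_rearr (u n) t.
Let s m n t := max_rearr (u m \+ u n) t.

Let ufin n : gint (u n) < +oo. Proof. exact: le_lt_trans (uB n) (ltry _). Qed.

Let sfin m n : gint (u m \+ u n) < +oo.
Proof.
apply: (@le_lt_trans _ _ ((2 `^ (p - 1))%:E * (gint (u m) + gint (u n)))).
  apply: gintD => //; first exact: L0_add.
  by apply: aeI_all => r _; exact: lee_abs_add.
by rewrite lte_mul_pinfty ?lee_fin ?powR_ge0// lte_add_pinfty.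
Qed.

Let aI n t : I t -> 0 <= a n t < +oo.
Proof. by case=> t0 _; exact: max_rearr_fin. Qed.

Let s_le m n t : I t -> 0 <= s m n t <= a m t + a n t.
Proof.
case=> t0 _; rewrite max_rearr_ge0//=; apply: max_rearrD => //; first exact: L0_add.
by apply: aeI_all => r _; exact: lee_abs_add.
Qed.

Let ma n : measurable_fun I (a n). Proof. exact: measurable_max_rearr. Qed.
Let ms m n : measurable_fun I (s m n). Proof. by apply: measurable_max_rearr; exact: L0_add. Qed.

Lemma wint_dist_cauchy (d : R) : (0 < d)%R -> exists N, forall m n, (N <= m)%N -> (N <= n)%N ->
  wint (fun t => `|a m t - a n t|) <= d%:E.
Proof.
move=> d0; have B1 : (0 < B + 1)%R by rewrite ltr_wpDl.
have e0 : (0 < d / (4 * (B + 1)))%R by rewrite divr_gt0// mulr_gt0.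
have [C C0 HC] := wint_unif_convex p_gt1 w_meas w_ge0 e0.
have C1 : (0 < C + 1)%R by rewrite ltr_wpDl.
have dC0 : (0 < d / (2 * (C + 1)))%R by rewrite divr_gt0// mulr_gt0.
have [N HN] := midpoint dC0.
exists N => m n Nm Nn.
apply: (le_trans (HC _ _ _ _ (ma m) (ma n) (ms m n) (@aI m) (@aI n) (@s_le m n)
  (ufin m) (ufin n) (HN m n Nm Nn))).
apply: (@le_trans _ _ ((d / (4 * (B + 1)))%:E * (B%:E + B%:E) + (C * (d / (2 * (C + 1))))%:E)).
  apply: leeD; last exact: lexx.
  apply: lee_wpmul2l; first by rewrite lee_fin; exact: ltW.
  exact: leeD (uB m) (uB n).
rewrite -[B%:E + B%:E]EFinD -EFinM -EFinD lee_fin.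
have h1 : (d / (4 * (B + 1)) * (B + B) <= d / 2)%R.
  by rewrite mulrAC ler_pdivrMr ?mulr_gt0//; lra.
have h2 : (C * (d / (2 * (C + 1))) <= d / 2)%R.
  by rewrite mulrA ler_pdivrMr ?mulr_gt0//; lra.
lra.
Qed.

Lemma wint_defect_small (d : R) : (0 < d)%R -> exists N, forall m n, (N <= m)%N -> (N <= n)%N ->
  wint (fun t => `|(a m t + a n t) - s m n t|) <= d%:E.
Proof.
move=> d0; have [N HN] := midpoint d0; exists N => m n Nm Nn.
exact: (wint_defect p_gt1 w_meas w_ge0 (ma m) (ma n) (ms m n) (@aI m) (@aI n) (@s_le m n)
  (sfin m n) (HN m n Nm Nn)).
Qed.

Let Kfun_finu n t : (0 < t)%R -> Kfun (u n) t < +oo.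
Proof. by move=> t0; exact: Kfun_fin p_gt1 w_meas w_ge0 _ _ wp (mu_ n) (ufin n) t0. Qed.

Let quasi x t0 : L0 x -> forall t, (0 < t)%R -> (t <= t0)%R -> t%:E * max_rearr x t <= t0%:E * max_rearr x t0.
Proof. by move=> mx t t_gt0 tt0; exact: max_rearr_quasi. Qed.

(** By [wint_gap], a difference larger than h at t would keep the distance in L^p(w) above a fixed
    d, against [wint_dist_cauchy]. *)
Lemma max_rearr_cauchy (t h : R) : (0 < t)%R -> t%:E <= alpha -> (0 < h)%R ->
  exists N, forall m n, (N <= m)%N -> (N <= n)%N -> a m t <= a n t + h%:E.
Proof.
move=> t0 ta h0; have [b b0 Hb] := gint_bound_Kfun B_ge0 t0 ta.
have [d d0 Hd] := wint_gap p_gt1 w_meas w_ge0 W_fin W_incr t0 ta b0 h0.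
have d20 : (0 < d / 2)%R by rewrite divr_gt0.
have [N HN] := wint_dist_cauchy d20.
exists N => m n Nm Nn; rewrite leNgt; apply/negP => hlt.
suff : (d <= d / 2)%R by lra.
rewrite -lee_fin; apply: le_trans (HN m n Nm Nn); apply: (Hd (a m) (a n) (ma m) (ma n)).
- by move=> r r0 rt; apply: (max_rearr_nincr (mu_ m)).
- apply: quasi; exact: (mu_ n).
- by apply: max_rearr_ge0; exact: ltW.
- exact: Hb.
- exact: ltW.
Qed.

Lemma max_rearr_midpoint (t h : R) : (0 < t)%R -> t%:E <= alpha -> (0 < h)%R ->
  exists N, forall m n, (N <= m)%N -> (N <= n)%N -> a m t + a n t <= s m n t + h%:E.
Proof.
move=> t0 ta h0; have [b b0 Hb] := gint_bound_Kfun B_ge0 t0 ta.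
have [d d0 Hd] := wint_gap p_gt1 w_meas w_ge0 W_fin W_incr t0 ta (addr_ge0 b0 b0) h0.
have d20 : (0 < d / 2)%R by rewrite divr_gt0.
have [N HN] := wint_defect_small d20.
exists N => m n Nm Nn; rewrite leNgt; apply/negP => hlt.
suff : (d <= d / 2)%R by lra.
rewrite -lee_fin; apply: le_trans (HN m n Nm Nn); have madd : measurable_fun I (fun t => a m t + a n t) by exact: emeasurable_funD.
apply: (Hd (fun t => a m t + a n t) (s m n) madd (ms m n)).
- by move=> r r0 rt; apply: leeD; [apply: (max_rearr_nincr (mu_ m))|apply: (max_rearr_nincr (mu_ n))].
- by apply: quasi; exact: L0_add.
- by apply: max_rearr_ge0; exact: ltW.
- rewrite EFinD; apply: (@le_trans _ _ (a m t + a n t)); last by apply: leeD; exact: Hb.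
  apply: max_rearrD => //; [exact: L0_add|exact: ltW|].
  by apply: aeI_all => r _; exact: lee_abs_add.
- exact: ltW.
Qed.

Lemma Kfun_sub_small (t h : R) : (0 < t)%R -> (0 < h)%R -> exists N, forall m n,
  (N <= m)%N -> (N <= n)%N -> Kfun (u m \- u n) t <= h%:E.
Proof.
move: t h; apply: Kfun_sub_cvg => //.
- by move=> n; exact: gint_fin_ae p_gt1 w_meas w_ge0 _ wp (mu_ n) (ufin n).
- by move=> h h0; have [t t0 Ht] := Kfun_near0 B_ge0 h0; exists t => // n; exact: Ht.
- by move=> l l0; have [t t0 Ht] := Kfun_nearoo B_ge0 l0; exists t => // n; exact: Ht.
- move=> t h t0 h0; have [t' [t'0 t'a _ KE]] := Kfun_alpha t0.
  have [N HN] := max_rearr_cauchy t'0 t'a (divr_gt0 h0 t'0).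
  exists N => m n Nm Nn; rewrite !KE// !Kfun_max_rearr//.
  have := lee_wpmul2l (_ : 0 <= t'%:E) (HN m n Nm Nn); rewrite lee_fin (ltW t'0) => /(_ isT).
  rewrite ge0_muleDr ?lee_fin ?divr_ge0 ?(ltW h0) ?(ltW t'0)//; last by apply: max_rearr_ge0; exact: ltW.
  by rewrite -EFinM [(t' * _)%R]mulrC divfK// gt_eqF.
- move=> t h t0 h0; have [t' [t'0 t'a _ KE]] := Kfun_alpha t0.
  have [N HN] := max_rearr_midpoint t'0 t'a (divr_gt0 h0 t'0).
  exists N => m n Nm Nn; rewrite !KE//; last exact: L0_add.
  rewrite !Kfun_max_rearr//.
  have := lee_wpmul2l (_ : 0 <= t'%:E) (HN m n Nm Nn); rewrite lee_fin (ltW t'0) => /(_ isT).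
  rewrite !ge0_muleDr ?lee_fin ?divr_ge0 ?(ltW h0) ?(ltW t'0)//;
    do ?[by apply: max_rearr_ge0; exact: ltW].
  by rewrite -EFinM [(t' * (_ / _))%R]mulrC divfK// gt_eqF.
Qed.

Let z m n t := max_rearr (u m \- u n) t.

Let z_le m n t : (0 <= t)%R -> z m n t <= a m t + a n t.
Proof.
move=> t0; apply: (max_rearrD (mu_ m) (mu_ n) (L0_sub (mu_ m) (mu_ n)) t0).
by apply: aeI_all => r _; exact: lee_abs_sub.
Qed.

(* Generalized dominated convergence: the dominants [a m + a n] converge in L^p(w). *)
Lemma gint_sub_small (d : R) : (0 < d)%R -> exists N, forall m n, (N <= m)%N -> (N <= n)%N ->
  gint (u m \- u n) <= d%:E.
Proof.
move=> d0; pose c : R := (2 `^ (p - 1))%R.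
have c0 : (0 < c)%R by rewrite powR_gt0.
have d'0 : (0 < d / (4 * c * c))%R by rewrite divr_gt0// !mulr_gt0.
have [N0 HN0] := wint_dist_cauchy d'0.
pose h t := 2%:E * a N0 t.
have mh : measurable_fun I h by apply: emeasurable_funM => //; exact: ma.
have a0 n t : I t -> 0 <= a n t by move=> It; have /andP[] := aI n It.
have h0 t : I t -> 0 <= h t by move=> It; apply: mule_ge0; [rewrite lee_fin|exact: a0].
have mz m n : measurable_fun I (z m n) by exact: measurable_max_rearr (L0_sub (mu_ m) (mu_ n)).
have z0 m n t : I t -> 0 <= z m n t by move=> It; exact: max_rearr_ge0I.
(* Truncating by the fixed function h makes domination possible; where the truncation bites, z <= a
   m + a n exceeds h by at most |a m - a N0| + |a n - a N0|. *)
pose A m n t := mine (z m n t) (h t).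
have mA m n : measurable_fun I (A m n) by apply: measurable_mine; [exact: mz|exact: mh].
have A0 m n t : I t -> 0 <= A m n t.
  by move=> It; rewrite /A le_min (z0 m n t It) (h0 t It).
have wh : wint h < +oo.
  rewrite (wintZ p w_meas w_ge0 (ma N0) _ (a0 N0)) ?lee_fin//.
  by apply: lte_mul_pinfty; [exact: poweR_ge0|rewrite fin_num_poweR|exact: ufin].
have dc0 : (0 < d / (4 * c))%R by rewrite divr_gt0// mulr_gt0.
have [N1 HN1] : exists N, forall m n, (N <= m)%N -> (N <= n)%N -> wint (A m n) <= (d / (4 * c))%:E.
  (* Dominated convergence is about sequences with one index, so failure of the claim is tested
     along a sequence of pairs going to infinity. *)
  apply: contrapT => /forallNP nex.
  have /choice[f fP] : forall N, exists mn : nat * nat,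
      [/\ (N <= mn.1)%N, (N <= mn.2)%N & ~ wint (A mn.1 mn.2) <= (d / (4 * c))%:E].
    move=> N; apply: contrapT => /forallNP nmn; apply: (nex N) => m n Nm Nn.
    by apply: contrapT => nle; apply: (nmn (m, n)).
  have Ah k t : I t -> A (f k).1 (f k).2 t <= h t by move=> _; rewrite /A ge_min lexx orbT.
  have : wint (A (f k).1 (f k).2) @[k --> \oo] --> 0.
    apply: (@wint_cvg0 R alpha p w p_gt1 w_meas w_ge0 (fun k => A (f k).1 (f k).2) h
      (fun k => mA _ _) mh (fun k => A0 _ _) Ah wh).
    move=> t It t0; apply/cvge0P => [k|e e0]; first exact: A0.
    have et0 : (0 < e * t)%R by rewrite mulr_gt0.
    have [N HN] := Kfun_sub_small t0 et0; exists N => k Nk.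
    have [km kn _] := fP k.
    rewrite /A ge_min; apply/orP; left; rewrite /z max_rearrE lee_pdivrMl//.
    by rewrite -EFinM mulrC; apply: HN; [exact: leq_trans km|exact: leq_trans kn].
  move/cvge0P => /(_ (fun k => wint_ge0 p w_ge0 _) _ dc0)[N HN].
  by have [_ _] := fP N; apply; exact: HN.
exists (maxn N0 N1) => m n; rewrite !geq_max => /andP[m0 m1] /andP[n0 n1].
pose B1 k t := `|a k t - a N0 t|.
have mB k : measurable_fun I (B1 k).
  by apply: (measurableT_comp (f := abse)) => //; apply: emeasurable_funB; exact: ma.
have B0 k t : I t -> 0 <= B1 k t by move=> _; exact: abse_ge0.
have mBB : measurable_fun I (B1 m \+ B1 n) by exact: emeasurable_funD.
have BB0 t : I t -> 0 <= (B1 m \+ B1 n) t by move=> It; apply: adde_ge0; exact: B0.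
apply: (@le_trans _ _ (wint (A m n \+ (B1 m \+ B1 n)))).
  apply: (le_wint p_gt1 w_meas w_ge0 (mz m n) _ (z0 m n)); first exact: emeasurable_funD.
  move=> t It; have /andP[ma0 mao] := aI m It; have /andP[na0 nao] := aI n It.
  have /andP[Na0 Nao] := aI N0 It.
  have zle : z m n t <= a m t + a n t by apply: z_le; case: It.
  rewrite /= /A; have [zh|zh] := leP (z m n t) (h t).
    by rewrite leeDl//; apply: BB0.
  apply: (le_trans zle); rewrite /h /B1.
  have [x x0 ->] := ge0_fin_real ma0 mao; have [y y0 ->] := ge0_fin_real na0 nao.
  have [q q0 ->] := ge0_fin_real Na0 Nao.
  rewrite lee_fin; have := ler_norm (x - q)%R; have := ler_norm (y - q)%R; lra.
apply: (le_trans (wintD p_gt1 w_meas w_ge0 (mA m n) mBB (A0 m n) BB0)).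
have hBB := wintD p_gt1 w_meas w_ge0 (mB m) (mB n) (B0 m) (B0 n).
have hB : wint (B1 m) + wint (B1 n) <= (d / (4 * c * c) + d / (4 * c * c))%:E.
  by rewrite EFinD; apply: leeD; apply: HN0.
apply: (@le_trans _ _ (c%:E * ((d / (4 * c))%:E + c%:E * (d / (4 * c * c) + d / (4 * c * c))%:E))).
  apply: lee_wpmul2l; first by rewrite lee_fin ltW.
  apply: leeD; first exact: HN1.
  apply: (le_trans hBB); apply: lee_wpmul2l => //; by rewrite lee_fin ltW.
rewrite lee_fin.
have -> : (c * (d / (4 * c) + c * (d / (4 * c * c) + d / (4 * c * c))) = d * (3 / 4))%R.
  by field; rewrite gt_eqF.
lra.
Qed.

End sequence.
End midpoint_cauchy.

Lemma limn_esup_bounds (R : realType) (v : nat -> \bar R) n (a b : \bar R) :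
  (forall m, (n <= m)%N -> (a <= v m <= b)%E) -> (a <= limn_esup v <= b)%E.
Proof.
move=> H; rewrite limn_esup_lim; apply/andP; split.
  apply: lime_ge; first exact: is_cvg_esups.
  apply: nearW => k; apply: (@le_trans _ _ (v (maxn n k))).
    by have /andP[] := H (maxn n k) (leq_maxl n k).
  apply: ereal_sup_ubound; exists (maxn n k) => //=; exact: leq_maxr.
apply: lime_le; first exact: is_cvg_esups.
exists n => // k /= nk; apply: ub_ereal_sup => _ [m /= km <-].
by have /andP[] := H m (leq_trans nk km).
Qed.

Lemma ge0_neqNy (R : realType) (a : \bar R) : (0 <= a)%E -> a != -oo%E.
Proof. by case: a. Qed.

(** The real bounds a and b are taken positive so that [gintD_le] can divide by them. *)
Lemma lee_add_real_bounds (R : realType) (A B C : \bar R) : (0 <= A)%E -> (0 <= B)%E ->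
  (forall a b : R, 0 < a -> 0 < b -> (A <= a%:E)%E -> (B <= b%:E)%E -> (C <= (a + b)%:E)%E) ->
  (C <= A + B)%E.
Proof.
move=> A0 B0 H.
have [->|] := eqVneq A +oo%E; first by rewrite addye ?leey// ge0_neqNy.
have [->|] := eqVneq B +oo%E; first by rewrite addey ?leey// ge0_neqNy.
rewrite -!ltey => Bfin Afin.
have [a a0 aE] := ge0_fin_real A0 Afin; have [b b0 bE] := ge0_fin_real B0 Bfin.
apply/lee_addgt0Pr => e e0; rewrite aE bE -!EFinD.
have -> : a + b + e = (a + e / 2) + (b + e / 2) by lra.
apply: H; rewrite ?aE ?bE ?lee_fin; lra.
Qed.

(** * The Banach space *)

Section gamma_norm.
Context (R : realType) (alpha : \bar R) (p : R) (w : R -> R).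
Hypothesis p_gt1 : (1 < p)%R.
Hypothesis w_meas : measurable_fun (itvI alpha) w.
Hypothesis w_ge0 : forall t, itvI alpha t -> (0 <= w t)%R.
Local Open Scope ereal_scope.
Local Notation mu := (@lebesgue_measure R).
Local Notation I := (itvI alpha).
Local Notation L0 := (@L0 R alpha).
Local Notation Kfun := (Kfun alpha).
Local Notation max_rearr := (max_rearr alpha).
Local Notation aeI := (aeI alpha).
Local Notation gint := (gint alpha p w).
Local Notation X := (Gamma alpha p w).
Implicit Types (f g h x y z : R -> \bar R) (s t c e d : R).

Let p_gt0 : (0 < p)%R. Proof. by rewrite (lt_trans _ p_gt1). Qed.

Let gint0 x : 0 <= gint x. Proof. exact: gint_ge0. Qed.

Lemma gamma_normE x : fnorm X x = gint x `^ p^-1. Proof. by []. Qed.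

Lemma gamma_norm_ge0 x : 0 <= fnorm X x.
Proof. by rewrite gamma_normE poweR_ge0. Qed.

Lemma gamma_normX x : fnorm X x `^ p = gint x.
Proof. by rewrite gamma_normE -poweRrM mulVf ?gt_eqF// poweRe1. Qed.

Lemma le_poweR_inv (a b : \bar R) : 0 <= a -> 0 <= b -> a `^ p <= b -> a <= b `^ p^-1.
Proof.
move=> a0 b0 ab.
have -> : a = (a `^ p) `^ p^-1 by rewrite -poweRrM mulfV ?gt_eqF// poweRe1.
have pV : (0 <= p^-1)%R by rewrite invr_ge0 ltW.
by apply: gt0_ler_poweR => //; rewrite in_itv/= leey andbT ?poweR_ge0.
Qed.

Lemma gamma_norm_leP x e : (0 <= e)%R -> (fnorm X x <= e%:E) <-> (gint x <= (e `^ p)%:E).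
Proof.
move=> e0; split=> [h|h].
  by rewrite -gamma_normX -poweR_EFin; apply: le_poweR; rewrite ?gamma_norm_ge0.
rewrite gamma_normE.
have -> : e%:E = ((e `^ p)%:E) `^ p^-1.
  by rewrite poweR_EFin -powRrM mulfV ?gt_eqF// powRr1.
have pV : (0 <= p^-1)%R by rewrite invr_ge0 ltW.
by apply: gt0_ler_poweR => //; rewrite in_itv/= leey andbT// lee_fin powR_ge0.
Qed.

Lemma gamma_norm_lty x : (fnorm X x < +oo) <-> (gint x < +oo).
Proof.
split => h; last by rewrite gamma_normE poweR_lty.
by rewrite -gamma_normX poweR_lty.
Qed.

Lemma carrierP x : carrier X x <-> L0 x /\ gint x < +oo.
Proof.
by split => -[mx h]; split => //; apply/gamma_norm_lty.
Qed.

Lemma eq_gint x y : L0 x -> L0 y -> aeI (fun s => `|x s| = `|y s|) -> gint x = gint y.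
Proof.
move=> mx my xy; apply/le_anti/andP; split.
  apply: (le_gint p_gt1 w_meas w_ge0 mx my) => t t0.
  by rewrite (eq_max_rearr mx my (ltW t0) xy).
apply: (le_gint p_gt1 w_meas w_ge0 my mx) => t t0.
by rewrite (eq_max_rearr mx my (ltW t0) xy).
Qed.

Lemma le_gint_ae x y : L0 x -> L0 y -> aeI (fun s => `|x s| <= `|y s|) -> gint x <= gint y.
Proof.
move=> mx my xy; apply: (le_gint p_gt1 w_meas w_ge0 mx my) => t t0.
exact: le_max_rearr mx my (ltW t0) xy.
Qed.

Lemma gint_cst0 : gint (cst 0) = 0.
Proof.
apply: integral0_eq => t [t0 _].
by rewrite max_rearrE Kfun_cst0// mule0 poweR0r ?mul0e// gt_eqF.
Qed.

(** Minkowski's inequality by homogeneity: with th = a / (a + b), x + y is a + b times the convex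
    combination of x / a and y / b with weights th and 1 - th. Convexity of the p-th power is
    applied to their maximal functions. *)
Lemma gintD_le x y z a b : L0 x -> L0 y -> L0 z -> aeI (fun s => `|z s| <= `|x s| + `|y s|) ->
  (0 < a)%R -> (0 < b)%R -> gint x <= (a `^ p)%:E -> gint y <= (b `^ p)%:E ->
  gint z <= ((a + b) `^ p)%:E.
Proof.
move=> mx my mz zxy a0 b0 xa yb; have ab0 : (0 < a + b)%R by rewrite addr_gt0.
pose th := (a / (a + b))%R.
have th1 : (1 - th = b / (a + b))%R by rewrite /th; field; rewrite gt_eqF.
have th01 : (0 <= th <= 1)%R.
  by rewrite /th divr_ge0 ?ler_pdivrMr ?mul1r ?lerDl ?(ltW a0) ?(ltW b0) ?(ltW ab0).
pose c := (th * ((a + b) / a) `^ p)%R; pose d := ((1 - th) * ((a + b) / b) `^ p)%R.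
have c0 : (0 <= c)%R by rewrite mulr_ge0 ?powR_ge0//; case/andP: th01.
have d0 : (0 <= d)%R by rewrite mulr_ge0 ?powR_ge0// subr_ge0; case/andP: th01.
have L : 1%:E * gint z + 0%:E * gint x <= c%:E * gint x + d%:E * gint y.
  apply: (wint_lin2 w_meas w_ge0 (measurable_max_rearr mz) (measurable_max_rearr mx)
    (measurable_max_rearr mx) (measurable_max_rearr my) ler01 (lexx _) c0 d0).
  move=> t [t0 _]; rewrite mul1e mul0e adde0.
  have zt := max_rearrD mx my mz t0 zxy.
  apply: (le_trans (le_poweR p_gt1 (max_rearr_ge0 _ _ t0) zt)).
  have := max_rearr_ge0 alpha x t0; have := max_rearr_ge0 alpha y t0.
  have [xE|xfin] := eqVneq (max_rearr x t) +oo.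
    have cpos : 0 < c%:E by rewrite lte_fin /c mulr_gt0 ?powR_gt0 ?divr_gt0.
    move=> y0 _; rewrite xE (poweR_pty p_gt1) (gt0_muley cpos) [leRHS]addye ?leey//.
    by rewrite ge0_neqNy// mule_ge0 ?poweR_ge0// lee_fin.
  have [yE|yfin] := eqVneq (max_rearr y t) +oo.
    have dpos : 0 < d%:E by rewrite lte_fin /d mulr_gt0 ?powR_gt0 ?divr_gt0// th1 divr_gt0.
    move=> _ x0; rewrite yE (poweR_pty p_gt1) (gt0_muley dpos) [leRHS]addey ?leey//.
    by rewrite ge0_neqNy// mule_ge0 ?poweR_ge0// lee_fin.
  case: (max_rearr x t) xfin => [r||]// _; case: (max_rearr y t) yfin => [q||]// _.
  rewrite !lee_fin => q0 r0.
  have := powR_conv p_gt1 th01 (_ : 0 <= (a + b) / a * r)%R (_ : 0 <= (a + b) / b * q)%R.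
  rewrite !mulr_ge0 ?invr_ge0 ?(ltW ab0) ?(ltW a0) ?(ltW b0)// => /(_ isT isT).
  have -> : (th * ((a + b) / a * r) + (1 - th) * ((a + b) / b * q) = r + q)%R.
    by rewrite th1 /th; field; rewrite !gt_eqF.
  have aba0 : (0 <= (a + b) / a)%R by rewrite divr_ge0// ltW.
  have abb0 : (0 <= (a + b) / b)%R by rewrite divr_ge0// ltW.
  by rewrite (powRM _ aba0 r0) (powRM _ abb0 q0) !mulrA.
rewrite mul1e mul0e adde0 in L; apply: (le_trans L).
apply: (@le_trans _ _ (c%:E * (a `^ p)%:E + d%:E * (b `^ p)%:E)).
  by apply: leeD; apply: lee_wpmul2l; rewrite ?lee_fin.
rewrite -!EFinM -EFinD lee_fin le_eqVlt; apply/orP; left; apply/eqP.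
have E1 : (((a + b) / a) `^ p * a `^ p = (a + b) `^ p)%R.
  by rewrite -powRM ?divr_ge0 ?(ltW ab0) ?(ltW a0)// divfK// gt_eqF.
have E2 : (((a + b) / b) `^ p * b `^ p = (a + b) `^ p)%R.
  by rewrite -powRM ?divr_ge0 ?(ltW ab0) ?(ltW b0)// divfK// gt_eqF.
by rewrite /c /d -[(th * _ * _)%R]mulrA E1 -[((1 - th) * _ * _)%R]mulrA E2 -mulrDl addrC subrK mul1r.
Qed.

Lemma gamma_normD x y z : L0 x -> L0 y -> L0 z -> aeI (fun s => `|z s| <= `|x s| + `|y s|) ->
  fnorm X z <= fnorm X x + fnorm X y.
Proof.
move=> mx my mz zxy; apply: lee_add_real_bounds; [exact: gamma_norm_ge0|exact: gamma_norm_ge0|].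
move=> a b a0 b0 /(gamma_norm_leP x (ltW a0)) xa /(gamma_norm_leP y (ltW b0)) yb.
apply/gamma_norm_leP; first by rewrite addr_ge0// ltW.
exact: gintD_le mx my mz zxy a0 b0 xa yb.
Qed.

Lemma gamma_norm_scale x c : L0 x -> fnorm X (fscale c x) = `|c|%:E * fnorm X x.
Proof.
move=> mx; rewrite !gamma_normE (gint_scale p w_meas w_ge0)// poweRM ?lee_fin ?powR_ge0//.
by rewrite poweR_EFin -powRrM mulfV ?gt_eqF// powRr1.
Qed.

Lemma carrier_sub x y : carrier X x -> carrier X y -> carrier X (x \- y).
Proof.
move=> [mx xfin] [my yfin]; split; first exact: L0_sub.
have h : aeI (fun s => `|(x \- y) s| <= `|x s| + `|y s|).
  by apply: aeI_all => s _; exact: lee_abs_sub.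
apply: (le_lt_trans (gamma_normD mx my (L0_sub mx my) h)).
exact: (lte_add_pinfty xfin yfin).
Qed.

Lemma carrier_add x y : carrier X x -> carrier X y -> carrier X (x \+ y).
Proof.
move=> [mx xfin] [my yfin]; split; first exact: L0_add.
have h : aeI (fun s => `|(x \+ y) s| <= `|x s| + `|y s|).
  by apply: aeI_all => s _; exact: lee_abs_add.
apply: (le_lt_trans (gamma_normD mx my (L0_add mx my) h)).
exact: (lte_add_pinfty xfin yfin).
Qed.

Lemma carrier_scale c x : carrier X x -> carrier X (fscale c x).
Proof.
move=> [mx xfin]; split; first exact: L0_scale.
apply: (@le_lt_trans _ _ (`|c|%:E * fnorm X x)); first by rewrite -gamma_norm_scale.
by apply: lte_mul_pinfty; [rewrite lee_fin| |exact: xfin].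
Qed.

Hypothesis wp : weight_pos alpha w.

(** x ** vanishes at a time T with W T > 0. Then K x T = 0 forces the optimal level to be 0, and the
    excess at level 0 is the whole integral of |x|. *)
Lemma gint_eq0 x : L0 x -> gint x = 0 -> aeI (fun s => x s = 0).
Proof.
move=> mx x0; have [T T0 [Ta WT]] := wp.
have mr0 : max_rearr x T = 0.
  apply: (@poweR_eq0_eq0 _ _ p); first by apply: max_rearr_ge0; exact: ltW.
  have := gint_lower p_gt1 w_meas w_ge0 mx T0 Ta; rewrite x0.
  have := poweR_ge0 (max_rearr x T) p; rewrite le_eqVlt => /predU1P[//|m0].
  by rewrite leNgt mule_gt0.
have K0 : Kfun x T = 0 by rewrite Kfun_max_rearr// mr0 mule0.
have [|l [l0 _]] := Kfun_attained mx T0; first by rewrite K0.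
rewrite K0 => /esym/eqP; rewrite padde_eq0 ?excess_ge0 ?lee_fin ?mulr_ge0 ?(ltW T0)//.
move=> /andP[]; rewrite eqe mulf_eq0 (gt_eqF T0) orbF => /eqP -> /eqP E0.
have : ae_eq mu I (fun s => maxe (`|x s| - 0%:E) 0) (cst 0).
  apply/ae_eq_integral_abs; [exact: measurable_itvI|exact: measurable_excess_fun|].
  rewrite -[RHS]E0; apply: eq_integral => s _.
  by rewrite gee0_abs// excess_part_ge0.
rewrite /ae_eq; apply: (@aeIS R alpha) => s Is.
by rewrite sube0 (max_idPl _)// => /eqP; rewrite abse_eq0 => /eqP.
Qed.

Definition gint_cauchy (u : nat -> R -> \bar R) := forall e, (0 < e)%R ->
  exists N, forall m n, (N <= m)%N -> (N <= n)%N -> gint (u m \- u n) <= e%:E.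

Lemma cauchy_seqP (u : nat -> R -> \bar R) : cauchy_seq X u <-> gint_cauchy u.
Proof.
split => H e e0.
  have [N HN] := H (e `^ p^-1)%R (powR_gt0 _ e0); exists N => m n Nm Nn.
  have /ltW/gamma_norm_leP := HN m n Nm Nn.
  by rewrite powR_ge0 -powRrM mulVf ?gt_eqF// powRr1 ?(ltW e0)//; apply.
have e20 : (0 < e / 2)%R by rewrite divr_gt0.
have [N HN] := H ((e / 2) `^ p)%R (powR_gt0 _ e20); exists N => m n Nm Nn.
apply: (@le_lt_trans _ _ (e / 2)%:E); last by rewrite lte_fin; lra.
by apply/gamma_norm_leP; [exact: ltW|exact: HN].
Qed.

End gamma_norm.

(** * Completeness and dominated subsequences *)

Section completeness.
Context (R : realType) (alpha : \bar R) (p : R) (w : R -> R).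
Hypothesis p_gt1 : (1 < p)%R.
Hypothesis w_meas : measurable_fun (itvI alpha) w.
Hypothesis w_ge0 : forall t, itvI alpha t -> (0 <= w t)%R.
Local Open Scope ereal_scope.
Local Notation mu := (@lebesgue_measure R).
Local Notation I := (itvI alpha).
Local Notation L0 := (@L0 R alpha).
Local Notation aeI := (aeI alpha).
Local Notation gint := (gint alpha p w).
Local Notation X := (Gamma alpha p w).
Implicit Types (x y z : R -> \bar R) (s t c e d : R).

Hypothesis wp : weight_pos alpha w.

Let p_gt0 : (0 < p)%R. Proof. by rewrite (lt_trans _ p_gt1). Qed.

Lemma aeI_forall (P : nat -> R -> Prop) : (forall n, aeI (P n)) -> aeI (fun s => forall n, P n s).
Proof.
move=> H; have : \forall s \ae mu, forall n, I s -> P n s by apply/ae_foralln => n; exact: H.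
by rewrite /Defs.aeI; apply: filterS => s h Is n; exact: h.
Qed.

(** Fitted to the weights of [gint_series]: (2^(k + 1))^p times q (n + k) is at most 2^-n / 2^(k +
    1), which sums to 2^-n. *)
Let q n : R := (((2 ^ n.+1)%:R `^ p * (2 ^ n.+1)%:R)^-1)%R.

Let q_gt0 n : (0 < q n)%R.
Proof. by rewrite invr_gt0 mulr_gt0 ?powR_gt0// ltr0n expn_gt0. Qed.

Lemma fast_subseq (u : nat -> R -> \bar R) : gint_cauchy alpha p w u ->
  exists phi : nat -> nat, {homo phi : m n / (m < n)%N} /\
    forall k, gint (u (phi k.+1) \- u (phi k)) <= (q k)%:E.
Proof.
move=> uC; have /choice[N HN] k := uC (q k) (q_gt0 k).
pose phi := fix phi k := if k is k'.+1 then maxn (phi k').+1 (N k) else N 0%N.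
have phiN k : (N k <= phi k)%N by case: k => [|k] //=; exact: leq_maxr.
have phiS k : (phi k < phi k.+1)%N by rewrite /= leq_maxl.
exists phi; split; first by apply: homo_ltn => //; exact: ltn_trans.
move=> k; apply: HN => //; exact: leq_trans (phiN k) (ltnW (phiS k)).
Qed.

Lemma gint_tail (d : nat -> R -> \bar R) z n : (forall k, L0 (d k)) ->
  (forall k, gint (d k) <= (q k)%:E) -> L0 z ->
  aeI (fun s => `|z s| <= \sum_(k <oo) `|d (n + k)%N s|) ->
  gint z <= (2 ^- n)%:E.
Proof.
move=> md dq mz zd.
apply: (le_trans (gint_series p_gt1 w_meas w_ge0 (fun k => md (n + k)%N) mz zd)).
apply: (le_trans _ (epsilon_trick0 xpredT (_ : 0 <= 2 ^- n)%R)); last by rewrite invr_ge0 exprn_ge0.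
apply: lee_nneseries => [k _ _|k _].
  by apply: mule_ge0; [rewrite lee_fin powR_ge0|exact: gint_ge0].
have a0 : (0 < (2 ^ k.+1)%:R `^ p :> R)%R by rewrite powR_gt0// ltr0n expn_gt0.
apply: (@le_trans _ _ (((2 ^ k.+1)%:R `^ p)%:E * (q (n + k))%:E)).
  by apply: lee_wpmul2l; [rewrite lee_fin ltW|exact: dq].
rewrite -EFinM lee_fin /q invfM mulrA.
have -> : (2 ^- n / (2 ^ k.+1)%:R = ((2 ^ (n + k).+1)%:R)^-1 :> R)%R.
  by rewrite !natrX -addnS exprD invfM.
rewrite ler_piMl ?invr_ge0 ?ler0n// ler_pdivrMr ?powR_gt0 ?ltr0n ?expn_gt0// mul1r.
apply: ge0_ler_powR; rewrite ?nnegrE ?ler0n ?(ltW p_gt0)// ler_nat leq_exp2l//; lia.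
Qed.

Lemma ereal_dist_telescope (v : nat -> \bar R) n m : (forall k, v k \is a fin_num) -> (n <= m)%N ->
  `|v m - v n| <= \sum_(k <oo) `|v (n + k).+1 - v (n + k)%N|.
Proof.
move=> vf nm; apply: (@le_trans _ _ (\sum_(0 <= k < (m - n)%N) `|v (n + k).+1 - v (n + k)%N|)).
  rewrite -{1}(subnKC nm); elim: (m - n)%N => [|k IH].
    by rewrite addn0 big_geq// subee// abse0.
  rewrite big_nat_recr//= addnS.
  have -> : v (n + k).+1 - v n = (v (n + k)%N - v n) + (v (n + k).+1 - v (n + k)%N).
    move: (vf (n + k).+1) (vf n) (vf (n + k)%N).
    case: (v (n + k).+1) => [a||]//; case: (v n) => [b||]//; case: (v (n + k)%N) => [c||]// _ _ _.
    rewrite -!EFinB -EFinD; congr EFin; lra.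
  by apply: (le_trans (lee_abs_add _ _)); exact: leeD2r.
exact: nneseries_lim_ge.
Qed.

Lemma fin_dist_bounds (a b T : \bar R) : a \is a fin_num -> b \is a fin_num -> 0 <= T ->
  `|a - b| <= T -> b - T <= a <= b + T.
Proof.
move: a b T => [a||]// [b||]// [c||]// _ _ c0 h; last first.
  by rewrite addeC /= leNye addeC /= leey.
have {}h : (`|a - b| <= c)%R by rewrite lee_fin in h.
have h1 := ler_norm (a - b); have h2 := ler_norm (- (a - b)); rewrite normrN in h2.
by apply/andP; split; rewrite lee_fin; lra.
Qed.

Lemma bounds_dist (a b T : \bar R) : b \is a fin_num -> 0 <= T ->
  b - T <= a <= b + T -> `|b - a| <= T.
Proof.
move: a b T => [a||]// [b||]// [c||]// _; rewrite ?leey// => _ /andP[]; rewrite ?lee_fin => h1 h2.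
by rewrite ler_norml; apply/andP; split; lra.
Qed.

Lemma dist_triangle (a b c : \bar R) : a \is a fin_num -> b \is a fin_num ->
  `|a - c| <= `|a - b| + `|b - c|.
Proof.
move: a b c => [a||]// [b||]// [c||]// _ _; rewrite ?addey// lee_fin.
by have := ler_normD (a - b)%R (b - c)%R; rewrite addrA subrK.
Qed.

Lemma abs_le_dist (a b : \bar R) : a \is a fin_num -> `|b| <= `|a| + `|a - b|.
Proof.
move: a b => [a||]// [b||]// _; rewrite ?addey// lee_fin.
by have := ler_normB a (a - b)%R; rewrite opprB addrCA subrr addr0.
Qed.

(** Riesz-Fischer argument. The limit is an upper limit along a rapidly Cauchy subsequence, so it is
    measurable without discarding a null set, and its distance to a term is bounded by the tail of
    the telescoping series. *)
Lemma gamma_complete (u : nat -> R -> \bar R) : (forall n, carrier X (u n)) ->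
  gint_cauchy alpha p w u ->
  exists2 x, carrier X x & forall e, (0 < e)%R -> exists N, forall n, (N <= n)%N ->
    fnorm X (u n \- x) <= e%:E.
Proof.
move=> uX uC; have [phi [phi_incr phiq]] := fast_subseq uC.
have mu_ n : L0 (u n) by have [] := uX n.
have ufin : aeI (fun s => forall n, u n s \is a fin_num).
  apply: aeI_forall => n; have /(carrierP p_gt1 w_ge0)[_ unf] := uX n.
  exact: gint_fin_ae p_gt1 w_meas w_ge0 _ wp (mu_ n) unf.
pose d k := u (phi k.+1) \- u (phi k).
pose x s := limn_esup (fun k => u (phi k) s).
have mx : L0 x by apply: measurable_fun_limn_esup => n; exact: mu_.
have md k : L0 (d k) by exact: L0_sub.
have xphi n : gint (u (phi n) \- x) <= (2 ^- n)%:E.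
  apply: (gint_tail md phiq (L0_sub (mu_ _) mx)).
  move: ufin; apply: aeIS => s Is us.
  pose v k := u (phi k) s; have vf k : v k \is a fin_num by exact: us.
  set T := \sum_(k <oo) _.
  have T0 : 0 <= T by apply: nneseries_ge0.
  have vT m : (n <= m)%N -> v n - T <= v m <= v n + T.
    move=> nm; have h : `|v m - v n| <= T by exact: ereal_dist_telescope.
    exact: fin_dist_bounds.
  exact: bounds_dist (limn_esup_bounds vT).
have gfin n : gint (u (phi n) \- x) < +oo by exact: le_lt_trans (xphi n) (ltry _).
have xX : carrier X x.
  split => //; have h : aeI (fun s => `|x s| <= `|u (phi 0%N) s| + `|(u (phi 0%N) \- x) s|).
    move: ufin; apply: aeIS => s Is us /=; exact: abs_le_dist.
  apply: (le_lt_trans (gamma_normD p_gt1 w_meas w_ge0 (mu_ _) (L0_sub (mu_ _) mx) mx h)).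
  apply: lte_add_pinfty; first by case: (uX (phi 0%N)).
  by apply/(gamma_norm_lty p_gt1 w_ge0); exact: gfin.
exists x => // e e0; have e20 : (0 < e / 2)%R by rewrite divr_gt0.
have ep0 : (0 < (e / 2) `^ p)%R by rewrite powR_gt0.
have [N HN] := uC _ ep0.
pose k := maxn N (Num.truncn ((e / 2) `^ p)^-1).+1.
have phik j : (j <= phi j)%N.
  elim: j => // j IH; apply: leq_ltn_trans IH _; exact: phi_incr.
have k2 : (2 ^- k <= (e / 2) `^ p)%R.
  rewrite invf_ple ?posrE ?exprn_gt0//.
  have i0 : (0 <= ((e / 2) `^ p)^-1)%R by rewrite invr_ge0 powR_ge0.
  have /andP[_ /ltW h] := truncn_itv i0; apply: (le_trans h).
  rewrite -natrX ler_nat; apply: (@leq_trans k); first exact: leq_maxr.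
  exact/ltnW/ltn_expl.
exists N => n Nn.
have h : aeI (fun s => `|(u n \- x) s| <= `|(u n \- u (phi k)) s| + `|(u (phi k) \- x) s|).
  move: ufin; apply: aeIS => s Is us /=; have := us (phi k); have := us n.
  exact: dist_triangle.
apply: (le_trans (gamma_normD p_gt1 w_meas w_ge0 (L0_sub (mu_ n) (mu_ _)) (L0_sub (mu_ _) mx) (L0_sub (mu_ n) mx) h)).
rewrite (splitr e) EFinD; apply: leeD; apply/(gamma_norm_leP p_gt1 w_ge0); rewrite ?(ltW e20)//.
  apply: HN => //; apply: (leq_trans _ (phik k)); exact: leq_maxl.
by apply: (le_trans (xphi k)); rewrite lee_fin.
Qed.

(** The dominating function is |u (phi 0)| plus all absolute increments of a rapidly Cauchy
    subsequence. It will allow dominated convergence in pairings. *)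
Lemma dominated_subseq (u : nat -> R -> \bar R) : (forall n, carrier X (u n)) ->
  gint_cauchy alpha p w u ->
  exists phi : nat -> nat, (forall k, (k <= phi k)%N) /\ exists2 h, carrier X h &
    aeI (fun s => forall k, `|u (phi k) s| <= h s).
Proof.
move=> uX uC; have [phi [phi_incr phiq]] := fast_subseq uC.
have mu_ n : L0 (u n) by have [] := uX n.
have ufin : aeI (fun s => forall n, u n s \is a fin_num).
  apply: aeI_forall => n; have /(carrierP p_gt1 w_ge0)[_ unf] := uX n.
  exact: gint_fin_ae p_gt1 w_meas w_ge0 _ wp (mu_ n) unf.
exists phi; split.
  elim=> // j IH; apply: leq_ltn_trans IH _; exact: phi_incr.
pose d k := u (phi k.+1) \- u (phi k).
have md k : L0 (d k) by exact: L0_sub.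
pose D s := \sum_(k <oo) `|d k s|.
have D0 s : 0 <= D s by apply: nneseries_ge0.
have mD : L0 D.
  by apply: (ge0_emeasurable_sum (P := xpredT)) => // k _; exact: L0_abs.
have DX : carrier X D.
  apply/(carrierP p_gt1 w_ge0); split => //.
  apply: (@le_lt_trans _ _ (2 ^- 0)%:E); last by rewrite ltry.
  apply: (gint_tail md phiq mD); apply: aeI_all => s _; rewrite gee0_abs//.
pose a s := `|u (phi 0%N) s|.
have aX : carrier X a.
  have ma : L0 a by exact: L0_abs.
  apply/(carrierP p_gt1 w_ge0); split => //.
  have /(carrierP p_gt1 w_ge0)[_ unf] := uX (phi 0%N).
  apply: le_lt_trans unf; apply: (le_gint_ae p_gt1 w_meas w_ge0) => //.
  by apply: aeI_all => s _; rewrite /a abse_id.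
exists (a \+ D); first exact: carrier_add.
move: ufin; apply: aeIS => s Is us k /=.
have h : `|u (phi k) s - u (phi 0%N) s| <= D s.
  exact: (@ereal_dist_telescope (fun k => u (phi k) s)).
have := us (phi k); have := us (phi 0%N); move: h (D0 s); rewrite /a.
move: (u (phi k) s) (u (phi 0%N) s) (D s) => [x||]// [y||]// [z||]//; rewrite ?leey//.
rewrite -EFinB !lee_fin => h _ _ _.
have -> : (x = y + (x - y))%R by lra.
by apply: (le_trans (ler_normD _ _)); rewrite lerD2l.
Qed.

End completeness.

Section banach.
Context (R : realType) (alpha : \bar R) (p : R) (w : R -> R).
Hypothesis p_gt1 : (1 < p)%R.
Hypothesis w_meas : measurable_fun (itvI alpha) w.
Hypothesis w_ge0 : forall t, itvI alpha t -> (0 <= w t)%R.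
Local Open Scope ereal_scope.

Lemma gamma_banach : weight_pos alpha w -> banach_space alpha (Gamma alpha p w).
Proof.
move=> wp; split.
- by move=> x [].
- move=> x /(carrierP p_gt1 w_ge0)[mx xf]; exact: gint_fin_ae p_gt1 w_meas w_ge0 _ wp mx xf.
- apply/(carrierP p_gt1 w_ge0); split; first exact: L0_0.
  by rewrite gint_cst0.
- by move=> x y; exact: carrier_add.
- by move=> c x; exact: carrier_scale.
- by move=> x [mx xf]; rewrite gamma_norm_ge0.
- move=> x [mx xf]; split.
    move=> x0; apply: (gint_eq0 p_gt1 w_meas w_ge0 wp mx).
    by rewrite -(gamma_normX p_gt1 w_ge0) x0 poweR0r// gt_eqF// (lt_trans _ p_gt1).
  move=> x0; rewrite gamma_normE (_ : gint _ _ _ _ = 0).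
    by rewrite poweR0r// invr_neq0// gt_eqF// (lt_trans _ p_gt1).
  rewrite -(gint_cst0 alpha w p_gt1); apply: (eq_gint p_gt1 w_meas w_ge0 mx).
    exact: L0_0.
  by move: x0; apply: aeIS => s Is ->.
- by move=> c x [mx xf]; exact: gamma_norm_scale.
- move=> x y [mx xf] [my yf]; apply: (gamma_normD p_gt1 w_meas w_ge0 mx my (L0_add mx my)).
  by apply: aeI_all => s _; exact: lee_abs_add.
- move=> u uX /(cauchy_seqP p_gt1 w_ge0) uC.
  have [x xX Hx] := gamma_complete p_gt1 w_meas w_ge0 wp uX uC.
  exists x => //; apply/cvge0P => [n|]; first exact: gamma_norm_ge0.
  exact: Hx.
Qed.

End banach.

Section powR_approx.
Context (R : realType) (p : R).
Hypothesis p_gt1 : 1 < p.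

Lemma powR_near_arith (q r A S T K e d : R) : q = 2 * r -> 0 < q ->
  A <= S + K * e -> S - K * e <= T -> 2 * q * K * e <= d -> r * (A + A) <= q * T + d.
Proof.
move=> qr q0 h1 h2 h3.
have -> : r * (A + A) = q * A by rewrite qr; ring.
have : q * A <= q * (S + K * e) by rewrite ler_pM2l.
have : q * (S - K * e) <= q * T by rewrite ler_pM2l.
lra.
Qed.

(** Continuity of the p-th power at D, in the form that turns nearly equal norms of terms and
    midpoints into the hypothesis of [gint_sub_small]. K is the slope of the power at D + 1; as e <=
    1, it bounds both increments. *)
Lemma powR_near (D d : R) : 0 <= D -> 0 < d -> exists2 e, 0 < e & forall a, 0 <= a -> D - e <= a ->
  2 `^ (p - 1) * ((D + e) `^ p + (D + e) `^ p) <= (2 * a) `^ p + d.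
Proof.
have p1 := p_gt1; move=> D0 d0; have p0 : 0 < p by rewrite (lt_trans _ p_gt1).
pose K := p * (D + 1) `^ (p - 1).
have K0 : 0 < K by rewrite mulr_gt0// powR_gt0; lra.
have q0 : 0 < 2 `^ p :> R by rewrite powR_gt0.
have q3 : 0 < 2 * 2 `^ p * K by apply: mulr_gt0 => //; apply: mulr_gt0.
pose e := Num.min 1 (d / (2 * 2 `^ p * K)).
have e0 : 0 < e by rewrite lt_min ltr01 /=; exact: divr_gt0.
have e1 : e <= 1 by rewrite ge_min lexx.
have ed : 2 * 2 `^ p * K * e <= d.
  by rewrite -ler_pdivlMl// mulrC ge_min lexx orbT.
exists e => // a a0 Da.
have pm : 0 <= p - 1 by lra.
have t1 := powR_ge_tangent p_gt1 D0 (addr_ge0 D0 (ltW e0)).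
have t2 := powR_ge_tangent p_gt1 a0 D0.
have m1 : p * (D + e) `^ (p - 1) <= K.
  rewrite /K ler_pM2l//; apply: ge0_ler_powR; rewrite ?nnegrE => //; clear -p1 D0 d0 e0 e1; lra.
have m2 : p * D `^ (p - 1) <= K.
  rewrite /K ler_pM2l//; apply: ge0_ler_powR; rewrite ?nnegrE => //; clear -p1 D0 d0 e0 e1; lra.
have m20 : 0 <= p * D `^ (p - 1) by rewrite mulr_ge0 ?powR_ge0// ltW.
have u1 : (D + e) `^ p <= D `^ p + K * e.
  have : p * (D + e) `^ (p - 1) * e <= K * e by rewrite ler_pM2r.
  by move: t1; rewrite (_ : D - (D + e) = - e)%R; [lra|ring].
have u2 : D `^ p - K * e <= a `^ p.
  have h1 : p * D `^ (p - 1) * (- e) <= p * D `^ (p - 1) * (a - D) by apply: ler_wpM2l => //; lra.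
  have : p * D `^ (p - 1) * e <= K * e by rewrite ler_pM2r.
  lra.
have -> : (2 * a) `^ p = 2 `^ p * a `^ p by rewrite powRM.
have q2 : 2 `^ p = 2 * 2 `^ (p - 1) :> R.
  by rewrite mulr_powRB1.
exact: powR_near_arith q2 q0 u1 u2 ed.
Qed.

End powR_approx.

(** * Good weights give approximative compactness *)

Section approximation.
Context (R : realType) (alpha : \bar R) (p : R) (w : R -> R).
Hypothesis p_gt1 : (1 < p)%R.
Hypothesis w_meas : measurable_fun (itvI alpha) w.
Hypothesis w_ge0 : forall t, itvI alpha t -> (0 <= w t)%R.
Hypothesis alphaE : alpha = 1%:E \/ alpha = +oo%E.
Local Open Scope ereal_scope.
Local Notation mu := (@lebesgue_measure R).
Local Notation L0 := (@L0 R alpha).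
Local Notation aeI := (aeI alpha).
Local Notation gint := (gint alpha p w).
Local Notation X := (Gamma alpha p w).
Implicit Types (x y z : R -> \bar R) (s t c e d : R).

Definition good_weight : Prop :=
  [/\ forall t, (0 < t)%R -> t%:E <= alpha -> W w t < +oo,
      forall s t, (0 <= s)%R -> (s < t)%R -> t%:E <= alpha -> W w s < W w t,
      alpha = +oo -> forall M : R, exists2 t, (0 < t)%R & M%:E <= W w t
    & forall M : R, exists2 t, (0 < t)%R &
        M%:E <= \int[mu]_(s in [set s | (t <= s)%R /\ s%:E < alpha]) (s `^ (- p) * w s)%:E].

Lemma good_weight_pos : good_weight -> weight_pos alpha w.
Proof. by case=> _ wi _ _; exact: W_incr_pos alphaE wi. Qed.

Lemma gint_cauchy_shift (u : nat -> R -> \bar R) N :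
  gint_cauchy alpha p w (fun n => u (n + N)%N) -> gint_cauchy alpha p w u.
Proof.
move=> H e /H[M HM]; exists (M + N)%N => m n hm hn.
have := HM (m - N)%N (n - N)%N; rewrite !subnK; first by apply; lia.
  lia.
lia.
Qed.

(* Uniform convexity of x ** in L^p(w), transferred to the space by [gint_sub_small]. *)
Lemma min_seq_cauchy (v : nat -> R -> \bar R) D : good_weight -> (0 <= D)%R ->
  (forall n, carrier X (v n)) ->
  (forall e, (0 < e)%R -> exists N, forall n, (N <= n)%N -> fnorm X (v n) <= (D + e)%:E) ->
  (forall e, (0 < e)%R -> exists N, forall m n, (N <= m)%N -> (N <= n)%N ->
     (2 * (D - e))%:E <= fnorm X (v m \+ v n)) ->
  gint_cauchy alpha p w v.
Proof.
move=> [w1 w2 w3 w4] D0 vX vD vvD.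
have [N0 HN0] := vD 1%R ltr01.
apply: (@gint_cauchy_shift _ N0).
have mv n : L0 (v n) by have [] := vX n.
have B0 : (0 <= (D + 1) `^ p)%R by exact: powR_ge0.
apply: (gint_sub_small p_gt1 w_meas w_ge0 alphaE w1 w2 w3 w4 B0) => [n|n|d d0].
- exact: mv.
- apply/(gamma_norm_leP p_gt1 w_ge0); first by lra.
  by apply: HN0; exact: leq_addl.
have [e e0 He] := powR_near p_gt1 D0 d0.
have [N1 HN1] := vD e e0; have [N2 HN2] := vvD e e0.
exists (N1 + N2)%N => m n hm hn.
have De : (0 <= D + e)%R by lra.
have g k : (N1 + N2 <= k)%N -> gint (v (k + N0)%N) <= ((D + e) `^ p)%:E.
  move=> hk; apply/(gamma_norm_leP p_gt1 w_ge0) => //; apply: HN1; lia.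
have le2 k : (N1 + N2 <= k)%N -> (N2 <= k + N0)%N by lia.
have ss : carrier X (v (m + N0)%N \+ v (n + N0)%N) by exact: carrier_add.
have [a a0 aE] := ge0_fin_real (gamma_norm_ge0 alpha p w _) ss.2.
have lo : (D - e <= a / 2)%R.
  have h2 : (2 * (D - e))%:E <= a%:E by rewrite -aE; apply: HN2; exact: le2.
 move: h2; rewrite lee_fin; lra.
have := He (a / 2)%R (divr_ge0 a0 (ler0n _ _)) lo.
have e2 : (2 * (a / 2) = a)%R by field.
rewrite e2 => hr.
have <- : (a `^ p)%:E = gint (v (m + N0)%N \+ v (n + N0)%N).
  by rewrite -(gamma_normX p_gt1 w_ge0) [fnorm _ _]aE.
apply: (@le_trans _ _ ((2 `^ (p - 1))%:E * (((D + e) `^ p)%:E + ((D + e) `^ p)%:E))).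
  by apply: lee_wpmul2l; [rewrite lee_fin powR_ge0|apply: leeD; exact: g].
by rewrite -EFinD -EFinM lee_fin.
Qed.

Lemma midpoint_fin (a b c : \bar R) : a \is a fin_num -> b \is a fin_num -> c \is a fin_num ->
  (a - c) + (b - c) = 2%:E * ((2^-1%:E * a + (1 - 2^-1)%:E * b) - c).
Proof. by move: a b c => [a||]// [b||]// [c||]// _ _ _; congr EFin; field. Qed.

Lemma eq_fnorm x y : L0 x -> L0 y -> aeI (fun s => `|x s| = `|y s|) -> fnorm X x = fnorm X y.
Proof.
by move=> mx my xy; have e := eq_gint p_gt1 w_meas w_ge0 mx my xy; rewrite !gamma_normE e.
Qed.

Lemma norm_midpoint x y z : L0 x -> L0 y -> L0 z -> aeI (fun s => x s \is a fin_num) ->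
   aeI (fun s => y s \is a fin_num) -> aeI (fun s => z s \is a fin_num) ->
  fnorm X ((x \- z) \+ (y \- z)) =
  2%:E * fnorm X ((fscale (2^-1)%R x \+ fscale (1 - 2^-1)%R y) \- z).
Proof.
move=> mx my mz xf yf zf.
have mm : L0 ((fscale (2^-1)%R x \+ fscale (1 - 2^-1)%R y) \- z).
  by apply: L0_sub => //; apply: L0_add; exact: L0_scale.
have -> : 2%:E = `|2%R : R|%:E :> \bar R by rewrite ger0_norm.
rewrite -(gamma_norm_scale p_gt1 w_meas w_ge0 (2 : R)%R mm); apply: eq_fnorm.
- by apply: L0_add; exact: L0_sub.
- exact: L0_scale.
have xyf : aeI (fun s => x s \is a fin_num /\ y s \is a fin_num) by move: xf yf; apply: aeIS2.
move: xyf zf; apply: aeIS2 => s _ [xs ys] zs; congr abse; exact: midpoint_fin.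
Qed.

Lemma dist_sub_fin (a b c : \bar R) : a \is a fin_num -> b \is a fin_num -> c \is a fin_num ->
  (a - c) - (b - c) = a - b.
Proof. by move: a b c => [a||]// [b||]// [c||]// _ _ _; congr EFin; ring. Qed.

(** For v = u - x, midpoints of u stay in C and are no closer to x than the distance. The whole
    sequence is then Cauchy, so the extraction is the identity. *)
Lemma good_approx_compact : good_weight -> approx_compact alpha X.
Proof.
move=> gw; have wp := good_weight_pos gw.
have bX := gamma_banach p_gt1 w_meas w_ge0 wp.
split=> // C CX [y0 Cy0] convC _ x u xX Cu ud.
have uX n := CX _ (Cu n).
pose v n := u n \- x.
have vX n : carrier X (v n) := carrier_sub p_gt1 w_meas w_ge0 (uX n) xX.
have xfin z : carrier X z -> aeI (fun s => z s \is a fin_num) by exact: bs_fin.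
have d0 : 0 <= dist_to X C x by apply/ereal_infP => _ [y _ <-]; exact: gamma_norm_ge0.
have dle y : C y -> dist_to X C x <= fnorm X (y \- x).
  by move=> Cy; apply: ge_ereal_inf; exists (fnorm X (y \- x)) => //; exists y.
have dlt : dist_to X C x < +oo.
  by apply: le_lt_trans (dle _ Cy0) _; exact: (carrier_sub p_gt1 w_meas w_ge0 (CX _ Cy0) xX).2.
have [D D0 DE] := ge0_fin_real d0 dlt.
have vc : gint_cauchy alpha p w v.
  apply: (min_seq_cauchy gw D0 vX) => [e e0|e e0].
    have h : \forall n \near \oo, fnorm X (v n) < (D + e)%:E.
      apply: (ud _ (open_ereal_lt' _)); rewrite DE lte_fin; lra.
    by have [N _ HN] := h; exists N => n Nn; apply: ltW; exact: HN.
  exists 0%N => m n _ _.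
  have Cm := convC _ _ 2^-1%R (Cu m) (Cu n).
  have h2 : (0 <= (2^-1 : R) <= 1)%R by apply/andP; split; lra.
  rewrite (norm_midpoint (uX m).1 (uX n).1 xX.1 (xfin _ (uX m)) (xfin _ (uX n)) (xfin _ xX)).
  have := dle _ (Cm h2); rewrite DE => h; rewrite EFinM.
  by apply: lee_wpmul2l => //; apply: le_trans h; rewrite lee_fin; lra.
exists id; split => //; apply/(cauchy_seqP p_gt1 w_ge0) => e /vc[N HN].
exists N => m n mN nN; apply: le_trans (HN m n mN nN).
apply: (le_gint_ae p_gt1 w_meas w_ge0).
- by apply: L0_sub; [exact: (uX m).1|exact: (uX n).1].
- by apply: L0_sub; [exact: (vX m).1|exact: (vX n).1].
have h : aeI (fun s => u m s \is a fin_num /\ u n s \is a fin_num).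
  by move: (xfin _ (uX m)) (xfin _ (uX n)); apply: aeIS2.
by move: h (xfin _ xX); apply: aeIS2 => s _ [? ?] ?; rewrite /v /= dist_sub_fin.
Qed.

End approximation.

(** * Order continuity of the space and of its dual forces a good weight *)

Section step_functions.
Context (R : realType) (alpha : \bar R).
Local Open Scope ereal_scope.
Local Notation mu := (@lebesgue_measure R).
Local Notation I := (itvI alpha).
Local Notation L0 := (@L0 R alpha).
Local Notation aeI := (aeI alpha).
Local Notation Kfun := (Kfun alpha).
Implicit Types (x y z : R -> \bar R) (s t c e d : R) (A B : set R).

Definition step c A : R -> \bar R := fun s => (c * \1_A s)%:E.

Lemma step_in c A s : A s -> step c A s = c%:E.
Proof. by move=> As; rewrite /step indicE mem_set// mulr1. Qed.

Lemma step_notin c A s : ~ A s -> step c A s = 0.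
Proof. by move=> As; rewrite /step indicE memNset// mulr0. Qed.

Lemma step_ge0 c A s : (0 <= c)%R -> 0 <= step c A s.
Proof. by move=> c0; rewrite lee_fin mulr_ge0. Qed.

Lemma L0_step c A : measurable A -> L0 (step c A).
Proof.
by move=> mA; apply/measurable_EFinP; apply: measurable_funM => //; exact: measurable_indic.
Qed.

Lemma integral_stepM c A x : (0 <= c)%R -> measurable A -> A `<=` I -> L0 x ->
  \int[mu]_(s in I) `|x s * step c A s| = c%:E * \int[mu]_(s in A) `|x s|.
Proof.
move=> c0 mA AI mx; have mI := measurable_itvI alpha.
have -> : \int[mu]_(s in A) `|x s| = \int[mu]_(s in I) ((abse \o x) \_ A) s.
  by rewrite -integral_mkcondr setIidr.
rewrite -ge0_integralZl//; last 2 first.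
- apply/(measurable_restrict (abse \o x) mA mI).
  have h : I `&` A `<=` I by apply: subIsetl.
  exact: (measurable_funS mI h (L0_abs mx)).
- by move=> s _; rewrite /patch; case: ifP => // _ /=.
apply: eq_integral => s _; rewrite abseM muleC /patch; case: ifPn => sA.
  by rewrite (step_in _ (set_mem sA)) gee0_abs.
rewrite step_notin ?abse0 ?mul0e; last by move=> As; move/negP: sA; apply; exact/mem_set.
by rewrite (_ : point = 0 :> \bar R)// mule0.
Qed.

Lemma integral_step c A : (0 <= c)%R -> measurable A -> A `<=` I ->
  \int[mu]_(s in I) `|step c A s| = c%:E * mu A.
Proof.
move=> c0 mA AI; have m1 : L0 (cst 1) by exact: measurable_cst.
have -> : \int[mu]_(s in I) `|step c A s| = \int[mu]_(s in I) `|cst 1 s * step c A s|.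
  by apply: eq_integral => s _; rewrite /cst mul1e.
rewrite (integral_stepM c0 mA AI m1) (eq_integral (cst 1)) ?integral_cst ?mul1e// => s _.
by rewrite /cst abse1.
Qed.

Lemma aeI_neq0 : aeI (fun s => s != 0%R).
Proof.
have : \forall s \ae mu, s != 0%R.
  exists [set 0%R]; split; [exact: measurable_set1|exact: lebesgue_measure_set1|].
  by move=> s /= /negP; rewrite negbK => /eqP.
by rewrite /Defs.aeI; apply: filterS.
Qed.

Lemma excess0E x : excess alpha 0 x = \int[mu]_(s in I) `|x s|.
Proof. by apply: eq_integral => s _; rewrite sube0; apply/max_idPl. Qed.

Lemma Kfun_le_norm1 x t : L0 x -> (0 <= t)%R -> Kfun x t <= \int[mu]_(s in I) `|x s|.
Proof. by move=> mx t0; have := Kfun_le mx (lexx 0%R) t0; rewrite mul0r add0e excess0E. Qed.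

Lemma Kfun_le_sup x c t : L0 x -> (0 <= c)%R -> (0 <= t)%R -> (forall s, I s -> `|x s| <= c%:E) ->
  Kfun x t <= (c * t)%:E.
Proof.
move=> mx c0 t0 xc; have := Kfun_le mx c0 t0; rewrite [excess _ _ _](_ : _ = 0) ?adde0//.
by apply: integral0_eq => s Is; apply/max_idPr; rewrite sube_le0 xc.
Qed.

Lemma max_rearr_le x (M : \bar R) t : (0 < t)%R -> Kfun x t <= t%:E * M -> max_rearr alpha x t <= M.
Proof.
move=> t0; rewrite max_rearrE => h.
apply: (@le_trans _ _ ((t^-1)%:E * (t%:E * M))).
  by apply: lee_wpmul2l => //; rewrite lee_fin invr_ge0 ltW.
by rewrite muleA -EFinM mulVf ?gt_eqF// mul1e.
Qed.

Lemma max_rearr_ge x (M : \bar R) t : (0 < t)%R -> t%:E * M <= Kfun x t -> M <= max_rearr alpha x t.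
Proof.
move=> t0; rewrite max_rearrE => h.
apply: (@le_trans _ _ ((t^-1)%:E * (t%:E * M))).
  by rewrite muleA -EFinM mulVf ?gt_eqF// mul1e.
by apply: lee_wpmul2l => //; rewrite lee_fin invr_ge0 ltW.
Qed.

Lemma integral_le_bigcup (F : (set R)^nat) (f : R -> \bar R) (M : \bar R) :
  {homo F : n m / (n <= m)%N >-> (n <= m)%O} -> (forall n, measurable (F n)) ->
  (forall n, F n `<=` I) -> measurable_fun I f -> (forall s, I s -> 0 <= f s) ->
  (forall s, I s -> (\bigcup_n F n) s \/ f s = 0) ->
  (forall n, \int[mu]_(s in F n) f s <= M) -> \int[mu]_(s in I) f s <= M.
Proof.
move=> Fnd mF FI mf f0 If FM.
have sub : \bigcup_n F n `<=` I by move=> s [n _ Fs]; exact: FI Fs.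
have -> : \int[mu]_(s in I) f s = \int[mu]_(s in \bigcup_n F n) f s.
  rewrite -{1}(setIidr sub) (integral_mkcondr mu I); apply: eq_integral => s /set_mem Is.
  rewrite /patch; case: ifPn => // /negP h; case: (If s Is) => // Fs.
  by exfalso; apply: h; exact/mem_set.
have c := @ge0_nondecreasing_set_cvg_integral _ (measurableTypeR R) R F f mu Fnd mF.
have {}c := c (fun n => measurable_funS (measurable_itvI alpha) (FI n) mf) (fun n s Fs => f0 s (FI n s Fs)).
have <- := cvg_lim (@ereal_hausdorff R) c.
by apply: lime_le; [apply/cvg_ex; eexists; exact: c|exact: nearW].
Qed.

End step_functions.

Section weight_facts.
Context (R : realType) (alpha : \bar R) (p : R) (w : R -> R).
Hypothesis p_gt1 : (1 < p)%R.
Hypothesis w_meas : measurable_fun (itvI alpha) w.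
Hypothesis w_ge0 : forall t, itvI alpha t -> (0 <= w t)%R.
Hypothesis alphaE : alpha = 1%:E \/ alpha = +oo%E.
Local Open Scope ereal_scope.
Local Notation mu := (@lebesgue_measure R).
Local Notation I := (itvI alpha).
Local Notation L0 := (@L0 R alpha).
Local Notation aeI := (aeI alpha).
Local Notation gint := (gint alpha p w).
Local Notation wint := (wint alpha p w).
Local Notation Kfun := (Kfun alpha).
Local Notation max_rearr := (max_rearr alpha).
Local Notation X := (Gamma alpha p w).
Implicit Types (x y z : R -> \bar R) (s t c e d : R).

Let p_gt0 : (0 < p)%R. Proof. by rewrite (lt_trans _ p_gt1). Qed.
Let mI : measurable I. Proof. exact: measurable_itvI. Qed.

(** [Wp] without its factor t^p; good weights are those for which, among other things, this is
    unbounded as t tends to 0. *)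
Definition tail t : \bar R :=
  \int[mu]_(s in [set s | (t <= s)%R /\ s%:E < alpha]) (s `^ (- p) * w s)%:E.

Lemma gint_le_wint x (f : R -> \bar R) : L0 x -> measurable_fun I f ->
  (forall t, I t -> 0 <= f t) -> (forall t, I t -> (0 < t)%R -> Kfun x t <= t%:E * f t) ->
  gint x <= wint f.
Proof.
move=> mx mf f0 Kf; apply: (le_wint p_gt1 w_meas w_ge0 (measurable_max_rearr mx) mf).
  by move=> t; exact: max_rearr_ge0I.
move=> t It; have : (0 <= t)%R by case: It.
rewrite le_eqVlt => /orP[/eqP t0|t0]; first by rewrite -t0 max_rearr0 t0 f0.
by apply: max_rearr_le => //; exact: Kf.
Qed.

Lemma integral_w_le (M : R) : alpha = +oo -> (forall t, (0 < t)%R -> W w t <= M%:E) ->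
  \int[mu]_(t in I) (w t)%:E <= M%:E.
Proof.
move=> aoo WM.
apply: (@integral_le_bigcup _ _ (fun n => `[0%R, n.+1%:R[%classic)).
- move=> m n mn; apply/subsetPset => s /=; rewrite !in_itv/= => /andP[-> h].
  by apply: lt_le_trans h _; rewrite ler_nat.
- by [].
- by move=> n; apply: sub_itvI; rewrite aoo leey.
- exact/measurable_EFinP.
- by move=> s /w_ge0; rewrite lee_fin.
- move=> s [s0 _]; left; exists (Num.truncn s) => //=; rewrite in_itv/= s0.
  by have /andP[] := truncn_itv s0.
- by move=> n; exact: WM.
Qed.

Lemma measurable_tail_fun : measurable_fun I (fun t => (t `^ (- p) * w t)%:E).
Proof.
apply/measurable_EFinP; apply: measurable_funM => //.
by apply: measurable_funTS; exact: measurable_powR.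
Qed.

Lemma integral_tail_le (M : R) : (forall t, (0 < t)%R -> tail t <= M%:E) ->
  \int[mu]_(t in I) (t `^ (- p) * w t)%:E <= M%:E.
Proof.
move=> tM.
have sub n : [set s | ((n.+1%:R)^-1 <= s)%R /\ s%:E < alpha] `<=` I.
  by move=> s [ns sa]; split => //; apply: le_trans ns; rewrite invr_ge0.
apply: (@integral_le_bigcup _ _ (fun n => [set s | ((n.+1%:R)^-1 <= s)%R /\ s%:E < alpha])).
- move=> m n mn; apply/subsetPset => s [ms sa]; split => //; apply: le_trans ms.
  by rewrite lef_pV2 ?posrE// ler_nat.
- move=> n; rewrite (_ : [set s | _] = I `&` `[(n.+1%:R)^-1%R, +oo[%classic).
    exact: measurableI.
  apply/seteqP; split => s /=; rewrite in_itv/= andbT.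
    by move=> h; split; [exact: sub h|case: h].
  by move=> [[_ ?] ?].
- exact: sub.
- exact: measurable_tail_fun.
- by move=> s Is; rewrite lee_fin mulr_ge0 ?powR_ge0 ?w_ge0.
- move=> s [s0 sa]; have [->|sn0] := eqVneq s 0%R.
    by right; rewrite powR0 ?mul0r// oppr_eq0 gt_eqF.
  have s0' : (0 < s)%R by rewrite lt_neqAle eq_sym sn0.
  left; exists (Num.truncn s^-1) => //; split => //.
  rewrite invf_ple ?posrE//; apply: ltW.
  have si : (0 <= s^-1)%R by rewrite invr_ge0.
  by have /andP[] := truncn_itv si.
- by move=> n; apply: tM; rewrite invr_gt0.
Qed.

Lemma measurable_cdiv c : measurable_fun I (fun t => (c / t)%:E).
Proof.
apply/measurable_EFinP; apply: measurable_funM => //.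
apply: (eq_measurable_fun (fun t => t `^ (-1))%R) => [t /set_mem[t0 _]|].
  exact: powR_inv1.
by apply: measurable_funTS; exact: measurable_powR.
Qed.

(** c / t dominates x ** for every x whose absolute value has integral c, however concentrated: the
    bound for all bumps of mass c. *)
Lemma wint_inv c (M : R) : (0 <= c)%R -> (forall t, (0 < t)%R -> tail t <= M%:E) ->
  wint (fun t => (c / t)%:E) <= (c `^ p * M)%:E.
Proof.
move=> c0 /integral_tail_le tM.
have -> : wint (fun t => (c / t)%:E) = (c `^ p)%:E * \int[mu]_(t in I) (t `^ (- p) * w t)%:E.
  rewrite -ge0_integralZl//; last 3 first.
  - exact: measurable_tail_fun.
  - by move=> s Is; rewrite lee_fin mulr_ge0 ?powR_ge0 ?w_ge0.
  - by rewrite lee_fin powR_ge0.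
  apply: eq_integral => s /set_mem[s0 _].
  by rewrite poweR_EFin powRM ?invr_ge0// -[(s^-1)%R]powR_inv1// -powRrM mulN1r -!EFinM mulrA.
by rewrite EFinM; apply: lee_wpmul2l => //; rewrite lee_fin powR_ge0.
Qed.

Lemma fnorm_cvg0P (u : nat -> R -> \bar R) : fnorm X (u n) @[n --> \oo] --> 0 <->
  forall e, (0 < e)%R -> exists N, forall n, (N <= n)%N -> gint (u n) <= e%:E.
Proof.
have g n : 0 <= fnorm X (u n) by exact: gamma_norm_ge0.
split=> [/(cvge0P g) H e e0|H].
  have e0' : (0 < e `^ p^-1)%R by rewrite powR_gt0.
  have [N HN] := H _ e0'; exists N => n Nn.
  have /(gamma_norm_leP p_gt1 w_ge0 _ (ltW e0')) := HN n Nn.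
  by rewrite -powRrM mulVf ?gt_eqF// powRr1// ltW.
apply/(cvge0P g) => e e0; have e0' : (0 < e `^ p)%R by rewrite powR_gt0.
have [N HN] := H _ e0'; exists N => n Nn.
by apply/(gamma_norm_leP p_gt1 w_ge0 _ (ltW e0)); exact: HN.
Qed.

Lemma Kfun_step_ge c (A B : set R) t : (0 <= c)%R -> measurable A -> measurable B -> B `<=` A -> B `<=` I ->
  (0 < t)%R -> mu B = t%:E -> (c * t)%:E <= Kfun (step c A) t.
Proof.
move=> c0 mA mB BA BI t0 Bt.
have mBt : mu B <= t%:E by rewrite Bt.
have mS : L0 (step c A) by exact: L0_step.
apply: le_trans (integral_le_Kfun mS t0 mB BI mBt).
rewrite (eq_integral (cst c%:E)) ?integral_cst//; last first.
  by move=> s /set_mem Bs; rewrite step_in ?gee0_abs ?lee_fin//; exact: BA.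
by rewrite [X in _ * X]Bt.
Qed.

(** If W is bounded on the half-line, the constant 1 has finite norm and dominates the indicators of
    [n, oo). These tend to 0 pointwise, but K of each of them at T is still at least T. *)
Lemma oc_W_infty : weight_pos alpha w -> order_continuous alpha X ->
  alpha = +oo -> forall M : R, exists2 t, (0 < t)%R & M%:E <= W w t.
Proof.
move=> [T T0 [Ta WT]] oc aoo M; apply: contrapT => H.
have WM t : (0 < t)%R -> W w t <= M%:E.
  by move=> t0; rewrite leNgt; apply/negP => h; apply: H; exists t => //; exact: ltW.
pose A n := `[n%:R : R, +oo[%classic.
have mu_ n : L0 (step 1 (A n)) by apply: L0_step; exact: measurable_itv.
have m1 : L0 (cst 1) by exact: measurable_cst.
have g1 : gint (cst 1) < +oo.
  apply: (@le_lt_trans _ _ M%:E); last by rewrite ltry.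
  apply: le_trans (integral_w_le aoo WM).
  apply: (@le_trans _ _ (wint (cst 1))).
    apply: gint_le_wint => // t _ t0; rewrite mule1 -[t in leRHS]mul1r.
    by apply: Kfun_le_sup => //; [exact: ltW|move=> s _; rewrite abse1].
  apply: ge0_le_integral => //.
  - by move=> t It; rewrite mule_ge0 ?poweR_ge0// lee_fin w_ge0.
  - exact: measurable_wint.
  - exact/measurable_EFinP.
  - by move=> t It; rewrite /cst poweR_EFin powR1 mul1e.
have u1 n s : 0 <= step 1 (A n) s <= `|cst 1 s|.
  rewrite step_ge0// /cst abse1 /step mul1r lee_fin indicE.
  by case: (_ \in _); rewrite ?lexx ?ler01.
have uX n : carrier X (step 1 (A n)).
  apply/(carrierP p_gt1 w_ge0); split; [exact: mu_|apply: le_lt_trans g1].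
  apply: (le_gint_ae p_gt1 w_meas w_ge0 (mu_ n) m1); apply: aeI_all => s _.
  by rewrite gee0_abs; case/andP: (u1 n s).
have xX : carrier X (cst 1) by apply/(carrierP p_gt1 w_ge0); split; [exact: m1|exact: g1].
have u1' n : aeI (fun s => 0 <= step 1 (A n) s <= `|cst 1 s|) by apply: aeI_all.
have h : aeI (fun s => step 1 (A n) s @[n --> \oo] --> 0).
  apply: aeI_all => s [s0 _]; apply/cvge0P => [n|e e0]; first exact: step_ge0.
  exists (Num.truncn s).+1 => n sn; rewrite step_notin ?lee_fin ?ltW// /A /= in_itv/= andbT.
  apply/negP; rewrite -ltNge; have /andP[_ /lt_le_trans] := truncn_itv s0; apply.
  by rewrite ler_nat.
have /fnorm_cvg0P := oc (cst 1) (fun n => step 1 (A n)) xX uX u1' h.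
have [c c0 cE] := ge0_fin_real (ltW WT) (le_lt_trans (WM T T0) (ltry _)).
have c0' : (0 < c)%R by move: WT; rewrite cE lte_fin.
move=> /(_ _ (divr_gt0 c0' (ltr0n _ 2)))[N /(_ N (leqnn N))]; apply/negP; rewrite -ltNge.
apply: (@lt_le_trans _ _ c%:E); first by rewrite lte_fin; lra.
apply: (le_trans _ (gint_lower p_gt1 w_meas w_ge0 (mu_ N) T0 Ta)).
rewrite cE -[leLHS]mul1e; apply: lee_wpmul2r; first by rewrite lee_fin.
have one : 1 <= max_rearr (step 1 (A N)) T.
  apply: max_rearr_ge => //; rewrite mule1 -[X in X%:E]mul1r.
  apply: (@Kfun_step_ge _ _ `[N%:R, (N%:R + T)%R[%classic) => //.
  - exact: measurable_itv.
  - by move=> s; rewrite /A /= !in_itv/= andbT => /andP[].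
  - by move=> s /=; rewrite in_itv/= => /andP[h1 _]; split; [exact: le_trans h1|rewrite aoo ltry].
  - rewrite /= lebesgue_measure_itv/= lte_fin ltrDl T0 -EFinB; congr EFin; ring.
by have := le_poweR p_gt1 lee01 one; rewrite poweR_EFin powR1.
Qed.

Lemma assoc_norm_ge (x y : R -> \bar R) : carrier X x -> fnorm X x <= 1 ->
  \int[mu]_(s in I) `|x s * y s| <= fnorm (associate alpha X) y.
Proof. by move=> xX x1; apply: ereal_sup_ubound; exists x. Qed.

(** If t^-p w is integrable, bumps of mass c on [0, 1 / (n + 1)) stay in the unit ball. Paired with
    the indicators of these intervals they give c, so the dual norms do not tend to 0. *)
Lemma oc_tail_infty : weight_pos alpha w -> order_continuous alpha (associate alpha X) ->
  forall M : R, exists2 t, (0 < t)%R & M%:E <= tail t.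
Proof.
move=> wp oc M; apply: contrapT => H.
have [M0 M0' tM] : exists2 M0 : R, (0 < M0)%R & forall t, (0 < t)%R -> tail t <= M0%:E.
  exists (`|M| + 1)%R; first by rewrite ltr_wpDl.
  move=> t t0; apply: (@le_trans _ _ M%:E); last first.
    by rewrite lee_fin; have := ler_norm M; lra.
  by rewrite leNgt; apply/negP => h; apply: H; exists t => //; exact: ltW.
pose A n := `[0%R, (n.+1%:R^-1)%R : R[%classic.
have one : 1 <= alpha := one_le_alpha alphaE.
have mA n : measurable (A n) by exact: measurable_itv.
have k0 n : (0 < n.+1%:R^-1 :> R)%R by rewrite invr_gt0.
have k1 n : (n.+1%:R^-1 <= 1 :> R)%R by rewrite invf_le1 ?ler1n.
have AI n : A n `<=` I.
  by apply: sub_itvI; apply: le_trans one; rewrite lee_fin.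
have muA n : mu (A n) = (n.+1%:R^-1)%:E.
  by rewrite /A /= lebesgue_measure_itv/= lte_fin k0 sube0.
have mu_ n : L0 (step 1 (A n)) by exact: L0_step.
have yX n : carrier (associate alpha X) (step 1 (A n)).
  split=> // x /(carrierP p_gt1 w_ge0)[mx xf].
  rewrite (integral_stepM ler01 (mA n) (AI n) mx) mul1e.
  have h1 : mu (A n) <= 1 by rewrite muA lee_fin.
  apply: le_lt_trans (integral_le_Kfun mx ltr01 (mA n) (AI n) h1) _.
  exact: Kfun_fin p_gt1 w_meas w_ge0 _ _ wp mx xf ltr01.
have u1 n : aeI (fun s => 0 <= step 1 (A n) s <= `|step 1 (A 0%N) s|).
  apply: aeI_all => s _; rewrite step_ge0// gee0_abs ?step_ge0//.
  have [As|As] := pselect (A n s); last by rewrite (step_notin _ As) step_ge0.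
  have A0 : A 0%N s.
    move: As; rewrite /A /= !in_itv/= => /andP[-> h].
    by apply: lt_le_trans h _; rewrite invr1; exact: k1.
  by rewrite (step_in _ As) (step_in _ A0) lexx.
have h : aeI (fun s => step 1 (A n) s @[n --> \oo] --> 0).
  have h0 := aeI_neq0 alpha.
  move: h0; apply: aeIS => s [s0 _] sn0; apply/cvge0P => [n|e e0]; first exact: step_ge0.
  have s0' : (0 < s)%R by rewrite lt_neqAle eq_sym sn0.
  have si : (0 <= s^-1)%R by rewrite invr_ge0.
  exists (Num.truncn s^-1) => n sn; rewrite step_notin ?lee_fin ?ltW// /A /= in_itv/= s0/=.
  apply/negP; rewrite -leNgt invf_ple ?posrE//.
  have /andP[_ /ltW /le_trans] := truncn_itv si; apply.
  by rewrite ler_nat.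
have := oc _ _ (yX 0%N) yX u1 h; move/cvge0P.
have g n : 0 <= fnorm (associate alpha X) (step 1 (A n)).
  apply: ereal_sup_ge; exists (\int[mu]_(s in I) `|cst 0 s * step 1 (A n) s|).
    exists (cst 0) => //; split; last first.
      by apply/(gamma_norm_leP p_gt1 w_ge0 _ ler01); rewrite gint_cst0// lee_fin powR_ge0.
    by apply/(carrierP p_gt1 w_ge0); rewrite gint_cst0//; split; [exact: L0_0|exact: ltry].
  exact: integral_ge0.
move=> /(_ g).
(* Normalizes the bumps: c^p M0 = 1 in [wint_inv]. *)
pose c := (M0^-1 `^ p^-1)%R.
have c0 : (0 < c)%R by rewrite powR_gt0// invr_gt0.
move=> /(_ _ (divr_gt0 c0 (ltr0n _ 2)))[N /(_ N (leqnn N))]; apply/negP; rewrite -ltNge.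
apply: (@lt_le_trans _ _ c%:E); first by rewrite lte_fin; lra.
pose x := step (c * N.+1%:R) (A N).
have cN0 : (0 <= c * N.+1%:R)%R by rewrite mulr_ge0 ?ltW.
have mx : L0 x by exact: L0_step.
have gx : gint x <= 1.
  apply: (@le_trans _ _ (wint (fun t => (c / t)%:E))).
    apply: gint_le_wint => // [|t [t0 _]|t _ t0].
    - exact: measurable_cdiv.
    - by rewrite lee_fin divr_ge0 // ltW.
    apply: le_trans (Kfun_le_norm1 mx (ltW t0)) _.
    rewrite /x integral_step// muA -!EFinM lee_fin -mulrA mulfV ?pnatr_eq0// mulr1.
    by rewrite mulrCA mulfV ?gt_eqF// mulr1.
  apply: le_trans (wint_inv (ltW c0) tM) _.
  by rewrite lee_fin /c -powRrM mulVf ?gt_eqF// powRr1 ?invr_ge0 ?(ltW M0')// mulVf ?gt_eqF.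
have xX : carrier X x.
  by apply/(carrierP p_gt1 w_ge0); split; [exact: mx|exact: le_lt_trans gx (ltry _)].
have x1 : fnorm X x <= 1 by apply/(gamma_norm_leP p_gt1 w_ge0 _ ler01); rewrite powR1.
apply: le_trans (assoc_norm_ge (step 1 (A N)) xX x1).
rewrite (integral_stepM ler01 (mA N) (AI N) mx) mul1e.
rewrite (eq_integral (cst (c * N.+1%:R)%:E)).
  rewrite integral_cst; last exact: mA.
  by rewrite [X in _ * X]muA -EFinM lee_fin mulfK ?pnatr_eq0.
by move=> s /set_mem As; rewrite /x step_in// gee0_abs.
Qed.

End weight_facts.

(** * Half-spaces and dual functions *)

Section triangle.
Context (R : realType).
Local Open Scope ereal_scope.
Local Notation mu := (@lebesgue_measure R).
Implicit Types (x h : R -> \bar R) (s t : R).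

Lemma patch_in (A : set R) x s : A s -> (x \_ A) s = x s.
Proof. by move=> As; rewrite patchE mem_set. Qed.

Lemma patch_notin (A : set R) x s : ~ A s -> (x \_ A) s = 0.
Proof. by move=> As; rewrite patchE memNset. Qed.

Lemma patch_ge0 (A : set R) x s : (forall s, A s -> 0 <= x s) -> 0 <= (x \_ A) s.
Proof.
by move=> x0; have [As|As] := pselect (A s); [rewrite patch_in//; exact: x0|rewrite patch_notin].
Qed.

Lemma tonelli_triangle x h : measurable_fun setT x -> measurable_fun setT h ->
  (forall s, 0 <= x s) -> (forall s, 0 <= h s) ->
  \int[mu]_s (x s * \int[mu]_(t in `]s, +oo[) h t) =
  \int[mu]_t (h t * \int[mu]_(s in `]-oo, t[) x s).
Proof.
move=> mx mh x0 h0.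
pose f (z : R * R) := x z.1 * h z.2 * (\1_[set z : R * R | (z.1 < z.2)%R] z)%:E.
have f0 z : 0 <= f z by rewrite mule_ge0// ?mule_ge0// lee_fin.
have mT : measurable [set z : R * R | (z.1 < z.2)%R].
  rewrite (_ : [set z | _] = setT `&` [set z | (EFin \o fst) z < (EFin \o snd) z]); last by rewrite setTI.
  by apply: measurable_lte => //; apply/measurable_EFinP; [exact: measurable_fst|exact: measurable_snd].
have mf : measurable_fun setT f.
  apply: emeasurable_funM; last by apply/measurable_EFinP; exact: measurable_indic.
  apply: emeasurable_funM; apply: measurableT_comp => //.
transitivity (\int[mu]_s \int[mu]_t f (s, t)).
  apply: eq_integral => s _; rewrite integral_mkcond -ge0_integralZl//.
  - apply: eq_integral => t _; rewrite /f/= indicE patchE mem_setE/= in_itv/= andbT.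
    rewrite (_ : (_ \in _) = (s < t)%R); last by apply/idP/idP; rewrite inE.
    by case: (s < t)%R => /=; [rewrite mule1|rewrite !mule0].
  - apply/(@measurable_restrictT _ _ _ _ `]s, +oo[%classic h (measurable_itv _)); exact: measurable_funTS.
  - by move=> t _; exact: patch_ge0.
transitivity (\int[mu]_t \int[mu]_s f (s, t)).
  exact: (@fubini_tonelli _ _ _ _ _ mu mu f mf f0).
apply: eq_integral => t _.
rewrite [in RHS]integral_mkcond -[RHS]ge0_integralZl//.
- have e1 s : (s \in `]-oo, t[%classic) = (s < t)%R by rewrite mem_setE in_itv.
  apply: eq_integral => s _; rewrite /f/= indicE patchE e1.
  rewrite (_ : (_ \in _) = (s < t)%R); last by apply/idP/idP; rewrite inE.
  by case: (s < t)%R => /=; [rewrite mule1 muleC|rewrite !mule0].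
- apply/(@measurable_restrictT _ _ _ _ `]-oo, t[%classic x (measurable_itv _)); exact: measurable_funTS.
- by move=> s _; exact: patch_ge0.
Qed.

End triangle.

Section triangleI.
Context (R : realType) (alpha : \bar R).
Local Open Scope ereal_scope.
Local Notation mu := (@lebesgue_measure R).
Local Notation I := (itvI alpha).
Local Notation L0 := (@L0 R alpha).
Implicit Types (x h : R -> \bar R) (s t : R).

(** A nonincreasing test function, whose pairing with x is by Tonelli a weighted integral of the
    integrals of |x| over initial intervals, which K controls. *)
Definition upper h s : \bar R := \int[mu]_(t in I `&` `]s, +oo[) h t.

Lemma measurable_upperI s : measurable (I `&` `]s, +oo[%classic).
Proof. by apply: measurableI => //; exact: measurable_itvI. Qed.

Lemma upper_ge0 h s : (forall t, I t -> 0 <= h t) -> 0 <= upper h s.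
Proof. by move=> h0; apply: integral_ge0 => t [/h0]. Qed.

Lemma upper_nincr h s t : measurable_fun I h -> (forall t, I t -> 0 <= h t) ->
  (s <= t)%R -> upper h t <= upper h s.
Proof.
move=> mh h0 st; apply: ge0_subset_integral.
- exact: measurable_upperI.
- exact: measurable_upperI.
- by apply: measurable_funS mh => //; exact: measurable_itvI.
- by move=> r [/h0].
- by move=> r [Ir /=]; rewrite !in_itv/= !andbT => tr; split => //; exact: le_lt_trans tr.
Qed.

Lemma L0_upper h : measurable_fun I h -> (forall t, I t -> 0 <= h t) -> L0 (upper h).
Proof.
move=> mh h0; apply: nonincreasing_emeasurable => [s t [s0 sa] [t0 ta] r /andP[sr rt]|s t _ _].
  by split; [exact: le_trans sr|apply: le_lt_trans ta; rewrite lee_fin].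
exact: upper_nincr.
Qed.

Lemma integral_upper x h : L0 x -> measurable_fun I h -> (forall t, I t -> 0 <= h t) ->
  \int[mu]_(s in I) `|x s * upper h s| = \int[mu]_(t in I) (h t * \int[mu]_(s in `[0%R, t[) `|x s|).
Proof.
move=> mx mh h0; have mI := measurable_itvI alpha.
have m1 : measurable_fun setT ((abse \o x) \_ I).
  by apply/(measurable_restrictT _ mI); exact: L0_abs.
have m2 : measurable_fun setT (h \_ I) by apply/(measurable_restrictT _ mI).
have p1 s : 0 <= ((abse \o x) \_ I) s by apply: patch_ge0 => r _ /=.
have p2 s : 0 <= (h \_ I) s by exact: patch_ge0.
rewrite [LHS]integral_mkcond [RHS]integral_mkcond.
transitivity (\int[mu]_s (((abse \o x) \_ I) s * \int[mu]_(t in `]s, +oo[) (h \_ I) t)).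
  apply: eq_integral => s _; have [Is|Is] := pselect (I s); last by rewrite !patch_notin// mul0e.
  rewrite !patch_in// abseM (gee0_abs (upper_ge0 s h0)); congr (_ * _).
  by rewrite /upper setIC integral_mkcondr.
rewrite (tonelli_triangle m1 m2 p1 p2); apply: eq_integral => t _; have [It|It] := pselect (I t); last first.
  by rewrite !patch_notin// mul0e.
rewrite !patch_in//; congr (_ * _).
rewrite -integral_mkcondr (_ : `]-oo, t[ `&` I = `[0%R, t[%classic)//.
apply/seteqP; split => r /=; rewrite !in_itv/=; first by move=> [-> [->]].
by move=> /andP[r0 rt]; split => //; split => //; case: It => _; apply: lt_trans; rewrite lte_fin.
Qed.

End triangleI.

Section half_space.
Context (R : realType) (alpha : \bar R) (p : R) (w : R -> R).
Hypothesis p_gt1 : (1 < p)%R.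
Hypothesis w_meas : measurable_fun (itvI alpha) w.
Hypothesis w_ge0 : forall t, itvI alpha t -> (0 <= w t)%R.
Local Open Scope ereal_scope.
Local Notation mu := (@lebesgue_measure R).
Local Notation I := (itvI alpha).
Local Notation L0 := (@L0 R alpha).
Local Notation aeI := (aeI alpha).
Local Notation gint := (gint alpha p w).
Local Notation wint := (wint alpha p w).
Local Notation Kfun := (Kfun alpha).
Local Notation max_rearr := (max_rearr alpha).
Local Notation X := (Gamma alpha p w).
Implicit Types (x y z g u : R -> \bar R) (s t c e d M : R) (H : R -> R).

Let p_gt0 : (0 < p)%R. Proof. by rewrite (lt_trans _ p_gt1). Qed.
Let mI : measurable I. Proof. exact: measurable_itvI. Qed.

Definition pairing x g : \bar R := \int[mu]_(s in I) `|x s * g s|.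

Lemma L0_mul x g : L0 x -> L0 g -> L0 (fun s => x s * g s).
Proof. by move=> mx mg; exact: emeasurable_funM. Qed.

Lemma pairing_ge0 x g : 0 <= pairing x g.
Proof. exact: integral_ge0. Qed.

Lemma pairing_le x y g : L0 x -> L0 y -> L0 g -> aeI (fun s => `|x s| <= `|y s|) ->
  pairing x g <= pairing y g.
Proof.
move=> mx my mg xy; apply: ae_ge0_le_integral => //.
- by apply: L0_abs; exact: L0_mul.
- by apply: L0_abs; exact: L0_mul.
by move: xy; apply: aeIS => s _ h; rewrite !abseM; exact: lee_wpmul2r.
Qed.

Lemma pairing_add x y g : L0 x -> L0 y -> L0 g ->
  pairing x g + pairing y g = \int[mu]_(s in I) (`|x s * g s| + `|y s * g s|).
Proof.
move=> mx my mg; rewrite ge0_integralD//.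
- by apply: L0_abs; exact: L0_mul.
- by apply: L0_abs; exact: L0_mul.
Qed.

Lemma pairingD x y z g : L0 x -> L0 y -> L0 z -> L0 g ->
  aeI (fun s => `|z s| <= `|x s| + `|y s|) -> pairing z g <= pairing x g + pairing y g.
Proof.
move=> mx my mz mg h.
have mxg : measurable_fun I (fun s => `|x s * g s|) by apply: L0_abs; exact: L0_mul.
have myg : measurable_fun I (fun s => `|y s * g s|) by apply: L0_abs; exact: L0_mul.
rewrite (pairing_add mx my mg); apply: ae_ge0_le_integral => //.
- by apply: L0_abs; exact: L0_mul.
- by move=> s _; exact: adde_ge0.
- exact: emeasurable_funD.
move: h; apply: aeIS => s _ h; rewrite !abseM -ge0_muleDl//; exact: lee_wpmul2r.
Qed.

Lemma pairing_scale c x g : L0 x -> L0 g -> pairing (fscale c x) g = `|c|%:E * pairing x g.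
Proof.
move=> mx mg; rewrite /pairing -ge0_integralZl//.
- by apply: eq_integral => s _; rewrite /fscale -muleA abseM.
- by apply: L0_abs; exact: L0_mul.
Qed.

(** A half-space of the positive cone: [pairing] contains absolute values and is additive on
    nonnegative functions, whence convexity. *)
Definition pos_test g M : set (R -> \bar R) :=
  [set x | carrier X x /\ aeI (fun s => 0 <= x s) /\ M%:E <= pairing x g].

Lemma abseD_mul (a b k : \bar R) : 0 <= a -> 0 <= b -> `|a * k| + `|b * k| <= `|(a + b) * k|.
Proof.
by move=> a0 b0; rewrite !abseM -ge0_muleDl// (gee0_abs a0) (gee0_abs b0) (gee0_abs (adde_ge0 a0 b0)).
Qed.

Lemma pos_test_convex g M : L0 g -> (0 <= M)%R -> convex_in (pos_test g M).
Proof.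
move=> mg M0 x y c [xX [x0 Mx]] [yX [y0 My]] /andP[c0 c1].
have c1' : (0 <= 1 - c)%R by lra.
have cX := carrier_scale p_gt1 w_meas w_ge0 c xX.
have cY := carrier_scale p_gt1 w_meas w_ge0 (1 - c)%R yX.
split; first exact: (carrier_add p_gt1 w_meas w_ge0 cX cY).
split; first by move: x0 y0; apply: aeIS2 => s _ xs ys; apply: adde_ge0; apply: mule_ge0.
have mcx : L0 (fscale c x) := L0_scale c xX.1.
have mcy : L0 (fscale (1 - c) y) := L0_scale (1 - c) yX.1.
have mxg : measurable_fun I (fun s => `|fscale c x s * g s|) by apply: L0_abs; exact: L0_mul.
have myg : measurable_fun I (fun s => `|fscale (1 - c) y s * g s|) by apply: L0_abs; exact: L0_mul.
apply: (@le_trans _ _ (pairing (fscale c x) g + pairing (fscale (1 - c) y) g)).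
  rewrite (pairing_scale _ xX.1 mg) (pairing_scale _ yX.1 mg) !ger0_norm//.
  have -> : M%:E = c%:E * M%:E + (1 - c)%:E * M%:E by rewrite -!EFinM -EFinD; congr EFin; ring.
  by apply: leeD; apply: lee_wpmul2l.
rewrite (pairing_add mcx mcy mg); apply: ae_ge0_le_integral => //.
- by move=> s _; exact: adde_ge0.
- exact: emeasurable_funD.
- by apply: L0_abs; apply: L0_mul => //; exact: L0_add.
move: x0 y0; apply: aeIS2 => s _ xs ys; apply: abseD_mul.
- by apply: mule_ge0.
- by apply: mule_ge0.
Qed.

Lemma neg_part_le (a b : \bar R) : 0 <= b -> a \is a fin_num -> `|maxe (- a) 0| <= `|b - a|.
Proof.
move: a b => [a||]// [b||]// b0 _; rewrite ?leey// -EFinN -EFin_max lee_fin.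
rewrite lee_fin in b0; have := ler_norm (b - a)%R; have := normr_ge0 (b - a)%R.
by rewrite ger0_norm ?le_max ?lexx ?orbT// ge_max => h1 h2; apply/andP; split; lra.
Qed.

(** The bound on the unit ball makes the pairing continuous. Nonnegativity survives because the
    negative part of x is dominated by |y - x| for every nonnegative y. *)
Lemma pos_test_closed g M B : weight_pos alpha w -> L0 g -> (0 <= B)%R ->
  (forall x, carrier X x -> gint x <= 1 -> pairing x g <= B%:E) -> closed_in X (pos_test g M).
Proof.
move=> wp mg B0 gB x xX H.
have xfin z : carrier X z -> aeI (fun s => z s \is a fin_num).
  exact: (bs_fin (gamma_banach p_gt1 w_meas w_ge0 wp)).
split => //; split.
  pose z s := maxe (- x s) 0.
  have mz : L0 z by apply: measurable_maxe => //; exact: measurableT_comp (xX.1).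
  have z0 : gint z = 0.
    apply/eqP; rewrite eq_le gint_ge0// andbT; apply/lee_addgt0Pr => e e0; rewrite add0e.
    have e0' : (0 < e `^ p^-1)%R by rewrite powR_gt0.
    have [y [yX [y0 _]] yx] := H _ e0'.
    have h : gint (y \- x) <= e%:E.
      have /(gamma_norm_leP p_gt1 w_ge0 _ (ltW e0')) := ltW yx.
      by rewrite -powRrM mulVf ?gt_eqF// powRr1// ltW.
    apply: le_trans h; apply: (le_gint_ae p_gt1 w_meas w_ge0 mz (L0_sub yX.1 xX.1)).
    by move: y0 (xfin _ xX); apply: aeIS2 => s _; exact: neg_part_le.
  move: (gint_eq0 p_gt1 w_meas w_ge0 wp mz z0); apply: aeIS => s _ zs.
  have : - x s <= z s by rewrite le_max lexx.
  by rewrite zs oppe_le0.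
apply/lee_addgt0Pr => e e0.
pose d := (e / (B + 1))%R.
have B1 : (0 < B + 1)%R by lra.
have d0 : (0 < d)%R by exact: divr_gt0.
have di : (0 <= d^-1)%R by rewrite invr_ge0 ltW.
have [y [yX [_ My]] yx] := H _ d0.
have yxX : carrier X (y \- x) by exact: carrier_sub.
apply: (le_trans My); apply: (@le_trans _ _ (pairing x g + pairing (y \- x) g)).
  apply: (pairingD xX.1 yxX.1 yX.1 mg).
  move: (xfin _ xX); apply: aeIS => s _ xs /=.
  move: (x s) (y s) xs => [a||]// [b||]// _; rewrite ?leey// ?addey//.
  have := ler_normD a (b - a)%R; have -> : (a + (b - a) = b)%R by ring.
  by rewrite -lee_fin.
apply: leeD => //.
pose z := fscale d^-1 (y \- x).
have zX : carrier X z by exact: carrier_scale.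
have z1 : gint z <= 1.
  rewrite (gint_scale p w_meas w_ge0 _ yxX.1) (ger0_norm di).
  have /(gamma_norm_leP p_gt1 w_ge0 _ (ltW d0)) h := ltW yx.
  apply: (@le_trans _ _ ((d^-1 `^ p)%:E * (d `^ p)%:E)).
    by apply: lee_wpmul2l; [rewrite lee_fin powR_ge0|exact: h].
  by rewrite -EFinM -(powRM _ di (ltW d0)) mulVf ?gt_eqF// powR1.
have := gB z zX z1; rewrite (pairing_scale _ yxX.1 mg) (ger0_norm di) => h.
apply: (@le_trans _ _ (d%:E * B%:E)).
  by rewrite -lee_pdivrMl.
rewrite -EFinM lee_fin /d mulrAC ler_pdivrMr// ler_pM2l//; lra.
Qed.

Lemma poweR_young (a : \bar R) c : 0 <= a -> (0 <= c)%R ->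
  p%:E * ((c `^ (p - 1))%:E * a) <= a `^ p + (p - 1)%:E * (c `^ p)%:E.
Proof.
move: a => [a a0 c0|_ c0|//]; last by rewrite poweR_pty// addye// leey.
by rewrite poweR_EFin -!EFinM -EFinD lee_fin; apply: (powR_young p_gt1).
Qed.

(* By Tonelli, [pairing x (dual_test H)] is the integral of
   H ^ (p - 1) w times the mean of |x| over [0, t); Young's inequality then bounds
   it by the p-th powers of x ** and H in L^p(w), with equality if x ** = H. *)
Definition dual_test H : R -> \bar R := upper alpha (fun t => (H t `^ (p - 1) * (t^-1 * w t))%:E).

Section dual_test.
Variable H : R -> R.
Hypothesis mH : measurable_fun I H.
Hypothesis H0 : forall t, I t -> (0 <= H t)%R.

Let h t : \bar R := (H t `^ (p - 1) * (t^-1 * w t))%:E.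

Let mh : measurable_fun I h.
Proof.
apply/measurable_EFinP; apply: measurable_funM.
  exact: (measurableT_comp (measurable_powR (p - 1)) mH).
apply: measurable_funM => //.
have := @measurable_cdiv R alpha 1%R => /measurable_EFinP; apply: eq_measurable_fun => t _.
by rewrite mul1r.
Qed.

Let h0 t : I t -> 0 <= h t.
Proof. by move=> It; rewrite lee_fin mulr_ge0 ?powR_ge0// mulr_ge0 ?w_ge0// invr_ge0; case: It. Qed.

Lemma L0_dual_test : L0 (dual_test H).
Proof. exact: (L0_upper mh h0). Qed.

Lemma pairing_dual_test x : L0 x ->
  pairing x (dual_test H) = \int[mu]_(t in I) (h t * \int[mu]_(s in `[0%R, t[) `|x s|).
Proof. by move=> mx; exact: (integral_upper mx mh h0). Qed.

Let mJ x : L0 x -> measurable_fun I (fun t => \int[mu]_(s in `[0%R, t[) `|x s|).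
Proof.
move=> mx.
have -> : (fun t => \int[mu]_(s in `[0%R, t[) `|x s|) =
    (fun t => - - \int[mu]_(s in `[0%R, t[) `|x s|) by apply/funext => t; rewrite oppeK.
apply: measurableT_comp => //.
apply: nonincreasing_emeasurable => [s t [s0 sa] [t0 ta] r /andP[sr rt]|s t Is It st].
  by split; [exact: le_trans sr|apply: le_lt_trans ta; rewrite lee_fin].
rewrite leeN2; apply: ge0_subset_integral => //.
- apply: (measurable_funS mI _ (L0_abs mx)); apply: sub_itvI; case: It => _; exact: ltW.
- by move=> r /=; rewrite !in_itv/= => /andP[-> rs]; exact: lt_le_trans rs st.
Qed.

Lemma measurable_dual_part x : L0 x ->
  measurable_fun I (fun t => h t * \int[mu]_(s in `[0%R, t[) `|x s|).
Proof. by move=> mx; exact: (emeasurable_funM mh (mJ mx)). Qed.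

Let young_reorder (A k c : R) (K : \bar R) :
  p%:E * ((A * (k * c))%:E * K) = p%:E * (A%:E * (k%:E * K)) * c%:E.
Proof. by rewrite !EFinM -!muleA [c%:E * K]muleC. Qed.

Lemma half_space_young x : L0 x ->
  p%:E * pairing x (dual_test H) <= gint x + (p - 1)%:E * wint (EFin \o H).
Proof.
move=> mx; have pm : (0 <= p - 1)%R by have := p_gt1; lra.
have mEH : measurable_fun I (EFin \o H) by exact/measurable_EFinP.
have mhJ := emeasurable_funM mh (mJ mx).
have mw1 := measurable_wint p w_meas (measurable_max_rearr mx).
have mw2 := measurable_wint p w_meas mEH.
rewrite (pairing_dual_test mx) -ge0_integralZl//; last 2 first.
- by move=> t It; apply: mule_ge0; [exact: h0|exact: integral_ge0].
- by rewrite lee_fin ltW.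
rewrite /gint /wint -[in leRHS]ge0_integralZl//; last 1 first.
- by move=> t It; exact: (wint_part_ge0 p w_ge0).
rewrite -ge0_integralD//; last 3 first.
- by move=> t It; exact: (wint_part_ge0 p w_ge0).
- by move=> t It; apply: mule_ge0; [rewrite lee_fin|exact: (wint_part_ge0 p w_ge0)].
- exact: measurable_funeM.
apply: ge0_le_integral => //.
- move=> t It; apply: mule_ge0; first by rewrite lee_fin ltW.
  by apply: mule_ge0; [exact: h0|exact: integral_ge0].
- exact: measurable_funeM.
- by apply: emeasurable_funD => //; exact: measurable_funeM.
move=> t It; have := It.1; rewrite le_eqVlt => /orP[/eqP t0|t0].
  rewrite /h -t0 invr0 mul0r mulr0 mul0e mule0.
  have I0 : I 0%R by rewrite t0.
  by apply: adde_ge0; [|apply: mule_ge0; first by rewrite lee_fin]; exact: (wint_part_ge0 p w_ge0 _ I0).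
apply: (@le_trans _ _ (p%:E * (h t * Kfun x t))).
  apply: lee_wpmul2l; first by rewrite lee_fin ltW.
  apply: lee_wpmul2l; first exact: h0.
  apply: integral_le_Kfun => //.
  - by apply: sub_itvI; case: It => _; exact: ltW.
  - by rewrite /= lebesgue_measure_itv/= lte_fin t0 sube0.
rewrite young_reorder -max_rearrE.
have w0 : 0 <= (w t)%:E by rewrite lee_fin w_ge0.
apply: (@le_trans _ _ ((max_rearr x t `^ p + (p - 1)%:E * (H t `^ p)%:E) * (w t)%:E)).
  by apply: lee_wpmul2r => //; apply: poweR_young; [exact: max_rearr_ge0I|exact: H0].
rewrite ge0_muleDl ?poweR_ge0//; last by rewrite mule_ge0// lee_fin powR_ge0.
by rewrite poweR_EFin muleA.
Qed.

(** The alternative [w t = 0] lets [H] disagree with the mean of |x| on a flat piece of W, where the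
    weight does not see it. *)
Lemma dual_test_ge x : L0 x ->
  aeI (fun t => w t = 0%R \/ (t * H t)%:E <= \int[mu]_(s in `[0%R, t[) `|x s|) ->
  wint (EFin \o H) <= pairing x (dual_test H).
Proof.
move=> mx hx; rewrite (pairing_dual_test mx); apply: ae_ge0_le_integral => //.
- by move=> t It; exact: (wint_part_ge0 p w_ge0).
- by apply: measurable_wint => //; exact/measurable_EFinP.
- by move=> t It; apply: mule_ge0; [exact: h0|exact: integral_ge0].
- exact: (emeasurable_funM mh (mJ mx)).
move: hx (aeI_neq0 alpha); apply: aeIS2 => t It; rewrite /h => -[->|Jt] tn0.
  by rewrite mule0 mulr0 mulr0 mul0e.
have t0 : (0 < t)%R by rewrite lt_neqAle eq_sym tn0; case: It.
apply: (@le_trans _ _ (h t * (t * H t)%:E)); last by apply: lee_wpmul2l => //; exact: h0.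
rewrite poweR_EFin -!EFinM lee_fin.
by rewrite -[in leLHS](mulr_powRB1 (H0 It) p_gt0) le_eqVlt; apply/orP; left; apply/eqP; field; rewrite gt_eqF.
Qed.

Lemma gint_le_dual x : L0 x -> aeI (fun t => w t = 0%R \/ Kfun x t <= (t * H t)%:E) ->
  gint x <= wint (EFin \o H).
Proof.
move=> mx hx; apply: ae_ge0_le_integral => //.
- by move=> t It; exact: (wint_part_ge0 p w_ge0).
- exact: (measurable_wint p w_meas (measurable_max_rearr mx)).
- by move=> t It; exact: (wint_part_ge0 p w_ge0).
- by apply: measurable_wint => //; exact/measurable_EFinP.
move: hx (aeI_neq0 alpha); apply: aeIS2 => t It -[->|Kt] tn0; first by rewrite !mule0.
have t0 : (0 < t)%R by rewrite lt_neqAle eq_sym tn0; case: It.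
apply: lee_wpmul2r; first by rewrite lee_fin w_ge0.
apply: (le_poweR p_gt1); first exact: max_rearr_ge0I.
by apply: max_rearr_le => //; rewrite -EFinM.
Qed.

End dual_test.

Lemma cvge_ge_near (a : nat -> \bar R) (D : R) : (forall n, D%:E <= a n) ->
  (forall e, (0 < e)%R -> exists N, forall n, (N <= n)%N -> a n <= (D + e)%:E) ->
  a n @[n --> \oo] --> D%:E.
Proof.
move=> aD H.
have fin e n : a n <= (D + e)%:E -> a n \is a fin_num.
  by move=> h; rewrite fin_numElt (lt_le_trans (ltNyr D) (aD n)) (le_lt_trans h (ltry _)).
apply/fine_cvgP; split.
  by have [N HN] := H _ ltr01; exists N => // n /= Nn; exact: fin (HN n Nn).
apply/cvgrPdist_le => e e0; have [N HN] := H e e0; exists N => // n /= Nn.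
have f := fin _ _ (HN n Nn); have := HN n Nn; have := aD n.
rewrite -(fineK f) !lee_fin /= => h1 h2.
by rewrite distrC ger0_norm ?subr_ge0//; lra.
Qed.

Lemma lee_mul_div (c a : R) (q : \bar R) : (0 < c)%R -> c%:E * q <= a%:E -> q <= (a / c)%:E.
Proof.
move=> c0; case: q => [q||]; last by rewrite leNye.
  by rewrite -EFinM !lee_fin ler_pdivlMr// mulrC.
by rewrite gt0_muley ?lte_fin.
Qed.

(** Approximative compactness for the distance from the origin to C, which is N^(1 / p): N is a
    lower bound on C that u attains asymptotically. *)
Lemma approx_min_cauchy (C : set (R -> \bar R)) N (u : nat -> R -> \bar R) :
  approx_compact alpha X -> (0 <= N)%R ->
  C `<=` carrier X -> convex_in C -> closed_in X C -> (forall x, C x -> N%:E <= gint x) ->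
  (forall n, C (u n)) ->
  (forall e, (0 < e)%R -> exists K, forall n, (K <= n)%N -> gint (u n) <= (N + e)%:E) ->
  exists phi : nat -> nat, {homo phi : m n / (m < n)%N} /\ gint_cauchy alpha p w (u \o phi).
Proof.
move=> [bX aX] N0 sub conv clos CN uC uN.
have X0 : carrier X (cst 0) := bs_zero bX.
have sub0 y : y \- cst 0 = y by apply/funext => s; rewrite /= sube0.
pose D := (N `^ p^-1)%R.
have D0 : (0 <= D)%R by exact: powR_ge0.
have DN : (D `^ p = N)%R by rewrite -powRrM mulVf ?gt_eqF// powRr1.
have lo y : C y -> D%:E <= fnorm X y.
  move=> Cy; rewrite gamma_normE; apply: (le_poweR_inv p_gt1) => //.
  - exact: (gint_ge0 p w_ge0).
  - by rewrite poweR_EFin DN; exact: CN.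
have up e : (0 < e)%R -> exists K, forall n, (K <= n)%N -> fnorm X (u n) <= (D + e)%:E.
  move=> e0; have De : (D < D + e)%R by lra.
  have d0 : (0 < (D + e) `^ p - N)%R.
    by rewrite -{1}DN subr_gt0 gt0_ltr_powR// nnegrE; lra.
  have [K HM] := uN _ d0; exists K => n Mn.
  apply/(gamma_norm_leP p_gt1 w_ge0); first by lra.
  by apply: le_trans (HM n Mn) _; rewrite lee_fin; lra.
have cv : fnorm X (u n \- cst 0) @[n --> \oo] --> D%:E.
  by apply: cvge_ge_near => [n|e /up[K HM]]; [|exists K => n]; rewrite sub0; [exact: lo|exact: HM].
have dD : dist_to X C (cst 0) = D%:E.
  apply/eqP; rewrite eq_le; apply/andP; split.
    apply/lee_addgt0Pr => e /up[K HM]; apply: ge_ereal_inf.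
    by exists (fnorm X (u K \- cst 0)); [exists (u K)|rewrite sub0 -EFinD; exact: HM].
  by apply/ereal_infP => _ [y Cy <-]; rewrite sub0; exact: lo.
have ne : C !=set0 by exists (u 0%N).
have cv' : fnorm X (u n \- cst 0) @[n --> \oo] --> dist_to X C (cst 0) by rewrite dD.
have [phi [phi1 phi2]] := aX _ sub ne conv clos _ _ X0 uC cv'.
by exists phi; split => //; apply/(cauchy_seqP p_gt1 w_ge0).
Qed.

(** On the half-space, [young] reads p N <= gint x + (p - 1) N, that is gint x >= N. It also bounds
    the pairing on the unit ball, hence closedness. *)
Lemma half_space_cauchy g N (u : nat -> R -> \bar R) : weight_pos alpha w ->
  approx_compact alpha X -> L0 g -> (0 <= N)%R ->
  (forall x, L0 x -> p%:E * pairing x g <= gint x + (p - 1)%:E * N%:E) ->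
  (forall n, pos_test g N (u n)) ->
  (forall e, (0 < e)%R -> exists K, forall n, (K <= n)%N -> gint (u n) <= (N + e)%:E) ->
  exists phi : nat -> nat, {homo phi : m n / (m < n)%N} /\ gint_cauchy alpha p w (u \o phi).
Proof.
move=> wp aX mg N0 young uC uN.
have p1 : (0 <= p - 1)%R by have := p_gt1; lra.
have B0 : (0 <= (1 + (p - 1) * N) / p)%R.
  by apply: divr_ge0; [apply: addr_ge0 => //; exact: mulr_ge0|exact: ltW].
have gB x : carrier X x -> gint x <= 1 -> pairing x g <= ((1 + (p - 1) * N) / p)%:E.
  move=> xX x1; apply: (lee_mul_div p_gt0); apply: (le_trans (young x xX.1)).
  by apply: (leeD2r _ x1).
have CN y : pos_test g N y -> N%:E <= gint y.
  move=> [yX [_ Ny]]; have : p%:E * N%:E <= gint y + (p - 1)%:E * N%:E.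
    by apply: le_trans (young y yX.1); apply: lee_wpmul2l => //; rewrite lee_fin ltW.
  by move: (gint y) => [a||]//; rewrite -?EFinM ?leey// -?EFinD ?lee_fin; lra.
have conv := pos_test_convex mg N0.
have clos := pos_test_closed (M := N) wp mg B0 gB.
have sub : pos_test g N `<=` carrier X by move=> x [].
exact: approx_min_cauchy aX N0 sub conv clos CN uC uN.
Qed.

End half_space.

(** * Bumps concentrating at the origin *)

Section necessary_tail.
Context (R : realType) (alpha : \bar R) (p : R) (w : R -> R).
Hypothesis p_gt1 : (1 < p)%R.
Hypothesis w_meas : measurable_fun (itvI alpha) w.
Hypothesis w_ge0 : forall t, itvI alpha t -> (0 <= w t)%R.
Hypothesis alphaE : alpha = 1%:E \/ alpha = +oo%E.
Local Open Scope ereal_scope.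
Local Notation mu := (@lebesgue_measure R).
Local Notation I := (itvI alpha).
Local Notation L0 := (@L0 R alpha).
Local Notation gint := (gint alpha p w).
Local Notation wint := (wint alpha p w).
Local Notation Kfun := (Kfun alpha).
Local Notation max_rearr := (max_rearr alpha).
Local Notation X := (Gamma alpha p w).
Local Notation tail := (tail alpha p w).
Implicit Types (x y z g u : R -> \bar R) (s t c e d M : R) (H : R -> R).

Let p_gt0 : (0 < p)%R. Proof. by rewrite (lt_trans _ p_gt1). Qed.
Let mI : measurable I. Proof. exact: measurable_itvI. Qed.

(** K x at any two positive times is comparable, so a lower bound at t passes to a time T where W T
    > 0. *)
Lemma gint_ge_Kfun t : weight_pos alpha w -> (0 < t)%R ->
  exists2 c, (0 < c)%R & forall x k, L0 x -> (0 <= k)%R -> k%:E <= Kfun x t ->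
    (c * k `^ p)%:E <= gint x.
Proof.
move=> [T T0 [Ta WT]] t0.
have [c0 c00 c0W] : exists2 c0, (0 < c0)%R & c0%:E <= W w T.
  move: WT; case: (W w T) => [c||]// c0; first by exists c; rewrite // -lte_fin.
  by exists 1%R; rewrite // leey.
pose r := (Num.min 1 (T / t) / T)%R.
have m0 : (0 < Num.min 1 (T / t))%R by rewrite lt_min ltr01 divr_gt0.
have r0 : (0 < r)%R by rewrite divr_gt0.
exists (r `^ p * c0)%R; first by rewrite mulr_gt0// powR_gt0.
move=> x k mx k0 Kk.
have mr : (r * k)%:E <= max_rearr x T.
  apply: max_rearr_ge => //; rewrite -EFinM /r.
  have -> : (T * (Num.min 1 (T / t) / T * k) = Num.min 1 (T / t) * k)%R by field; rewrite gt_eqF.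
  have [tT|Tt] := leP t T.
    apply: le_trans (Kfun_nd alpha x tT); apply: le_trans Kk.
    by rewrite lee_fin ler_piMl// ge_min lexx.
  have h := le_trans Kk (Kfun_ratio mx T0 (ltW Tt)).
  apply: (@le_trans _ _ ((T / t)%:E * k%:E)).
    by rewrite -EFinM lee_fin ler_wpM2r// ge_min lexx orbT.
  rewrite -lee_pdivlMl ?divr_gt0// invf_div; exact: h.
have rk : 0 <= (r * k)%:E by rewrite lee_fin mulr_ge0// ltW.
apply: le_trans (gint_lower p_gt1 w_meas w_ge0 mx T0 Ta).
apply: (@le_trans _ _ ((r * k)%:E `^ p * W w T)).
  rewrite poweR_EFin (powRM p (ltW r0) k0).
  apply: (@le_trans _ _ ((r `^ p * k `^ p)%:E * c0%:E)).
    by rewrite -EFinM lee_fin mulrAC.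
  by apply: lee_wpmul2l => //; rewrite lee_fin mulr_ge0 ?powR_ge0.
apply: lee_wpmul2r; first by exact: (W_ge0 w_ge0 Ta).
exact: (le_poweR p_gt1).
Qed.

Let inv_fun t : R := (1 / t)%R.

Let mEH : measurable_fun I (EFin \o inv_fun). Proof. exact: measurable_cdiv. Qed.

Let mH : measurable_fun I inv_fun. Proof. exact/measurable_EFinP. Qed.

Let H0 t : I t -> (0 <= inv_fun t)%R. Proof. by move=> [t0 _]; rewrite divr_ge0. Qed.

Lemma wint_invE : wint (EFin \o inv_fun) = \int[mu]_(t in I) (t `^ (- p) * w t)%:E.
Proof.
apply: eq_integral => s /set_mem[s0 _].
have -> : (EFin \o inv_fun) s = (s^-1)%:E by rewrite /= /inv_fun div1r.
by rewrite poweR_EFin -[(s^-1)%R]powR_inv1// -powRrM mulN1r -EFinM.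
Qed.

Let mtail t : (0 < t)%R -> measurable [set s | (t <= s)%R /\ s%:E < alpha].
Proof.
move=> t0; rewrite (_ : [set s | _] = I `&` `[t, +oo[%classic); first exact: measurableI.
apply/seteqP; split => s /=; rewrite in_itv/= andbT.
  by move=> [h1 h2]; split => //; split => //; apply: le_trans h1; exact: ltW.
by move=> [[_ ?] ?].
Qed.

Let tsub t : (0 < t)%R -> [set s | (t <= s)%R /\ s%:E < alpha] `<=` I.
Proof. by move=> t0 s [ts sa]; split => //; apply: le_trans ts; exact: ltW. Qed.

Let mtf := measurable_tail_fun p w_meas.

Let tf0 s : I s -> 0 <= (s `^ (- p) * w s)%:E.
Proof. by move=> Is; rewrite lee_fin mulr_ge0 ?powR_ge0 ?w_ge0. Qed.

Lemma tail_nincr s t : (0 < s)%R -> (s <= t)%R -> tail t <= tail s.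
Proof.
move=> s0 st; have t0 := lt_le_trans s0 st; apply: ge0_subset_integral.
- exact: mtail.
- exact: mtail.
- exact: (measurable_funS mI (tsub s0) mtf).
- by move=> r /(tsub s0)/tf0.
- by move=> r [tr ra]; split => //; exact: le_trans tr.
Qed.

(** N is the integral of t^-p w over the whole interval, the supremum of the tails by monotone
    convergence. *)
Lemma tail_limit M : weight_pos alpha w -> (forall t, (0 < t)%R -> tail t <= M%:E) ->
  exists N, [/\ (0 < N)%R, wint (EFin \o inv_fun) = N%:E,
    forall t, (0 < t)%R -> tail t <= N%:E
    & forall N', (N' < N)%R -> exists2 t, (0 < t)%R & N'%:E <= tail t].
Proof.
move=> wp tM.
have NM : wint (EFin \o inv_fun) <= M%:E by rewrite wint_invE; exact: integral_tail_le.
have [N N0' NN] := ge0_fin_real (wint_ge0 p w_ge0 _) (le_lt_trans NM (ltry _)).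
exists N; split=> //.
- have [T T0 [Ta WT]] := wp.
  rewrite -lte_fin -NN; apply: (@lt_le_trans _ _ ((1 / T)%:E `^ p * W w T)).
    by apply: mule_gt0 => //; rewrite poweR_EFin lte_fin powR_gt0// divr_gt0.
  have -> : W w T = \int[mu]_(r in `]0%R, T[) (w r)%:E.
    have := W_split w_meas w_ge0 (lexx 0%R) (ltW T0) Ta.
    by rewrite /W set_itvco0 integral_set0 add0e.
  apply: (wint_lower p_gt1 w_meas w_ge0 mEH) => //.
  - by move=> s /=; rewrite in_itv/= => /andP[s0 sT]; apply: (sub_itvI Ta); rewrite /= in_itv/= ltW.
  - by rewrite lee_fin divr_ge0// ltW.
  move=> s /=; rewrite in_itv/= => /andP[s0 sT]; rewrite lee_fin /inv_fun !div1r lef_pV2 ?posrE//.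
  exact: ltW.
- move=> t t0; rewrite -NN wint_invE; apply: ge0_subset_integral => //; [exact: mtail|exact: tsub].
move=> N' NN'; apply: contrapT => H'; have : wint (EFin \o inv_fun) <= N'%:E.
  rewrite wint_invE; apply: (integral_tail_le p_gt1 w_meas w_ge0) => t t0.
  by rewrite leNgt; apply/negP => lt; apply: H'; exists t => //; exact: ltW.
by rewrite NN lee_fin leNgt NN'.
Qed.

(** A bump of mass c on [0, T) has integral c over [0, s) for every s >= T, so only the part of the
    dual integral before T is lost. *)
Lemma pairing_step_ge c T : (0 <= c)%R -> (0 < T)%R -> T%:E <= alpha ->
  c%:E * tail T <= pairing alpha (step (c / T) `[0%R, T[%classic) (dual_test alpha p w inv_fun).
Proof.
move=> c0 T0 Ta; set A := `[0%R, T[%classic.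
have AI : A `<=` I by exact: sub_itvI.
have muA : mu A = T%:E by rewrite /A /= lebesgue_measure_itv/= lte_fin T0 sube0.
have mA : measurable A by exact: measurable_itv.
have cT : (0 <= c / T)%R by rewrite divr_ge0// ltW.
set u := step (c / T) A; have mu_ : L0 u by exact: L0_step.
have Ju : \int[mu]_(r in A) `|u r| = c%:E.
  rewrite (eq_integral (cst (c / T)%:E)).
    rewrite integral_cst; last exact: mA.
    by rewrite [X in _ * X]muA -EFinM divfK ?gt_eqF.
  by move=> r /set_mem Ar; rewrite /u step_in// gee0_abs// lee_fin.
rewrite (pairing_dual_test p w_meas w_ge0 mH mu_).
pose B := [set s | (T <= s)%R /\ s%:E < alpha].
have J0 s : 0 <= \int[mu]_(r in `[0%R, s[) `|u r| by exact: integral_ge0.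
have hB s : B s -> c%:E * (s `^ (- p) * w s)%:E <=
    (inv_fun s `^ (p - 1) * (s^-1 * w s))%:E * \int[mu]_(r in `[0%R, s[) `|u r|.
  move=> [ts sa]; have s0 : (0 < s)%R := lt_le_trans T0 ts.
  have Is : I s by exact: (tsub T0).
  have -> : (inv_fun s `^ (p - 1) * (s^-1 * w s) = s `^ (- p) * w s)%R.
    rewrite mulrA /inv_fun div1r [(_ * s^-1)%R]mulrC mulr_powRB1 ?invr_ge0 ?(ltW s0)//.
    by rewrite -[(s^-1)%R in LHS]powR_inv1 ?(ltW s0)// -powRrM mulN1r.
  rewrite muleC; apply: lee_wpmul2l; first exact: tf0.
  rewrite -Ju; apply: ge0_subset_integral.
  - exact: mA.
  - exact: measurable_itv.
  - apply: (measurable_funS mI _ (L0_abs mu_)); apply: sub_itvI; exact: ltW.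
  - by [].
  - by move=> r; rewrite /A /= !in_itv/= => /andP[-> h]; exact: lt_le_trans ts.
clear Ju.
have F0 s : I s -> 0 <= (inv_fun s `^ (p - 1) * (s^-1 * w s))%:E * \int[mu]_(r in `[0%R, s[) `|u r|.
  move=> Is; apply: mule_ge0; last exact: J0.
  by rewrite lee_fin mulr_ge0 ?powR_ge0// mulr_ge0 ?w_ge0// invr_ge0; case: Is.
have mF := measurable_dual_part p w_meas mH mu_.
apply: (@le_trans _ _ (\int[mu]_(s in B) (c%:E * (s `^ (- p) * w s)%:E))).
  rewrite ge0_integralZl//.
  - exact: mtail.
  - exact: (measurable_funS mI (tsub T0) mtf).
  - by move=> s /(tsub T0)/tf0.
apply: (@le_trans _ _ (\int[mu]_(s in B) ((inv_fun s `^ (p - 1) * (s^-1 * w s))%:E * \int[mu]_(r in `[0%R, s[) `|u r|))).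
  apply: ge0_le_integral.
  - exact: mtail.
  - by move=> s /(tsub T0) Is; apply: mule_ge0; [rewrite lee_fin|exact: tf0].
  - by apply: measurable_funeM; exact: (measurable_funS mI (tsub T0) mtf).
  - exact: (measurable_funS mI (tsub T0) mF).
  - exact: hB.
apply: ge0_subset_integral; [exact: mtail|exact: mI|exact: mF|exact: F0|exact: tsub].
Qed.

(** Otherwise bumps of mass slightly above 1 on shrinking intervals approach the minimal norm of a
    half-space, although two of them with very different supports are nearly disjoint. *)
Lemma approx_tail_infty : weight_pos alpha w -> approx_compact alpha X ->
  forall M, exists2 t, (0 < t)%R & M%:E <= tail t.
Proof.
move=> wp aX M; apply: contrapT => nM.
have tM t : (0 < t)%R -> tail t <= (`|M| + 1)%:E.
  move=> t0; apply: (@le_trans _ _ M%:E); last by rewrite lee_fin; have := ler_norm M; lra.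
  by rewrite leNgt; apply/negP => h; apply: nM; exists t => //; exact: ltW.
have [N [N0 NN tN Nsup]] := tail_limit wp tM.
have N0' := ltW N0.
pose dl n : R := (n.+1%:R^-1)%R.
have dl0 n : (0 < dl n)%R by rewrite invr_gt0.
have dl1 n : (dl n <= 1)%R by rewrite invf_le1 ?ler1n.
(* The mass 1 + dl n compensates for the tail at t n falling short of N, and so puts the bump into
   the half-space of level N. *)
have /choice[t Ht] n : exists t, [/\ (0 < t)%R, (t <= dl n)%R & (N / (1 + dl n))%:E <= tail t].
  have Nd : (N / (1 + dl n) < N)%R.
    by have := dl0 n => h; rewrite ltr_pdivrMr ?ltr_pMr//; lra.
  have [t t0 ht] := Nsup _ Nd; exists (Num.min t (dl n)); split.
  - by rewrite lt_min t0 dl0.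
  - by rewrite ge_min lexx orbT.
  by apply: le_trans ht (tail_nincr _ _); rewrite ?lt_min ?t0 ?dl0 ?ge_min ?lexx.
pose A n := `[0%R, t n[%classic.
have t0 n : (0 < t n)%R by have [] := Ht n.
have t1 n : (t n <= 1)%R by have [_ h _] := Ht n; exact: le_trans h (dl1 n).
have mA n : measurable (A n) by exact: measurable_itv.
have AI n : A n `<=` I.
  by apply: sub_itvI; apply: le_trans (one_le_alpha alphaE); rewrite lee_fin.
have muA n : mu (A n) = (t n)%:E.
  by rewrite /A /= lebesgue_measure_itv/= lte_fin t0 sube0.
pose c n := ((1 + dl n) / t n)%R.
have d1 n : (0 < 1 + dl n)%R by have := dl0 n; lra.
have c0 n : (0 < c n)%R by rewrite divr_gt0.
pose u n := step (c n) (A n).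
have mu_ n : L0 (u n) by exact: L0_step.
have gu n : gint (u n) <= ((1 + dl n) `^ p * N)%:E.
  apply: le_trans (wint_inv p_gt1 w_meas w_ge0 (ltW (d1 n)) tN).
  apply: (gint_le_wint p_gt1 w_meas w_ge0 (mu_ n)).
  - exact: measurable_cdiv.
  - by move=> s [s0 _]; rewrite lee_fin divr_ge0// ltW.
  move=> s _ s0; apply: le_trans (Kfun_le_norm1 (mu_ n) (ltW s0)) _.
  rewrite /u (integral_step (ltW (c0 n)) (mA n) (AI n)) muA -!EFinM lee_fin /c.
  by rewrite mulrCA divfK ?gt_eqF// mulfV ?gt_eqF// mulr1.
have guf n : gint (u n) < +oo by apply: le_lt_trans (gu n) (ltry _).
have uX n : carrier X (u n) by apply/(carrierP p_gt1 w_ge0); split; [exact: mu_|exact: guf].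
have Nu n : N%:E <= pairing alpha (u n) (dual_test alpha p w inv_fun).
  have [_ _ tn] := Ht n.
  have ta : (t n)%:E <= alpha by apply: le_trans (one_le_alpha alphaE); rewrite lee_fin.
  apply: le_trans (pairing_step_ge (ltW (d1 n)) (t0 n) ta).
  apply: (@le_trans _ _ ((1 + dl n)%:E * (N / (1 + dl n))%:E)).
    by rewrite -EFinM lee_fin mulrCA mulfV ?gt_eqF// mulr1.
  by apply: lee_wpmul2l => //; rewrite lee_fin ltW.
have uC n : pos_test alpha p w (dual_test alpha p w inv_fun) N (u n).
  split; first exact: uX.
  by split; [apply: aeI_all => s _; apply: step_ge0; exact: ltW|exact: Nu].
have young x : L0 x ->
    p%:E * pairing alpha x (dual_test alpha p w inv_fun) <= gint x + (p - 1)%:E * N%:E.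
  by move=> mx; rewrite -NN; exact: half_space_young.
have uN e : (0 < e)%R -> exists K, forall n, (K <= n)%N -> gint (u n) <= (N + e)%:E.
  move=> e0; have q0 : (0 < 2 `^ p * N)%R by rewrite mulr_gt0// powR_gt0.
  have i0 : (0 <= (e / (2 `^ p * N))^-1)%R by rewrite invr_ge0 ltW// divr_gt0.
  exists (Num.truncn (e / (2 `^ p * N))^-1).+1 => n Kn.
  have de : (dl n * (2 `^ p * N) <= e)%R.
    rewrite -ler_pdivlMr// /dl invf_ple ?posrE ?divr_gt0//.
    have /andP[_ /ltW h] := truncn_itv i0; apply: (le_trans h); rewrite ler_nat.
    exact: leqW.
  apply: le_trans (gu n) _; rewrite lee_fin.
  have b01 : (0 <= dl n <= 1)%R by rewrite ltW//=.
  have := powR_conv p_gt1 b01 (ler0n _ 2) ler01; rewrite powR1 !mulr1.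
  have -> : (dl n * 2 + (1 - dl n) = 1 + dl n)%R by ring.
  move=> h; apply: (@le_trans _ _ ((dl n * 2 `^ p + (1 - dl n)) * N)%R).
    by rewrite ler_pM2r.
  have := dl0 n; have := N0; rewrite mulrDl mulrBl mul1r -mulrA => *.
  have : (0 <= dl n * N)%R by rewrite mulr_ge0// ltW.
  by move: de; lra.
have mg := L0_dual_test p w_meas w_ge0 mH.
have [phi [phi1 uc]] := half_space_cauchy p_gt1 w_meas w_ge0 wp aX mg N0' young uC uN.
have [k k0 Hk] := gint_ge_Kfun wp ltr01.
have d0 : (0 < k * 2^-1 `^ p / 2)%R by rewrite divr_gt0// mulr_gt0// powR_gt0.
have [K HK] := uc _ d0.
have phik j : (j <= phi j)%N.
  elim: j => // j IH; apply: leq_ltn_trans IH _; exact: phi1.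
pose T := t (phi K).
have T0 : (0 < T)%R := t0 _.
(* A later bump supported in the first quarter of [0, T): on [T / 4, T) only the bump of index phi K
   remains, with mass at least 3 / 4. *)
pose m := maxn K (Num.truncn (T / 4)^-1).+1.
have tm : (t (phi m) <= T / 4)%R.
  have [_ h _] := Ht (phi m); apply: (le_trans h); rewrite /dl invf_ple ?posrE ?divr_gt0//.
  have i0 : (0 <= (T / 4)^-1)%R by rewrite invr_ge0 ltW// divr_gt0.
  have /andP[_ /ltW h'] := truncn_itv i0; apply: (le_trans h'); rewrite ler_nat.
  by apply: leqW; apply: leq_trans (phik m); exact: leq_maxr.
have mub : L0 (u (phi m) \- u (phi K)) by apply: L0_sub; exact: mu_.
have := HK m K (leq_maxl _ _) (leqnn K); apply/negP; rewrite -ltNge.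
apply: (@lt_le_trans _ _ (k * 2^-1 `^ p)%:E); first by rewrite lte_fin; lra.
apply: (Hk _ _ mub) => //.
pose B := `[(T / 4)%R, T[%classic.
have muB : mu B = (3 / 4 * T)%:E.
  rewrite /B /= lebesgue_measure_itv/= lte_fin ltr_pdivrMr//.
  have -> : (T < T * 4)%R = true by lra.
  by rewrite -EFinD; congr (_%:E); lra.
have BI : B `<=` I.
  move=> s; rewrite /B /= in_itv/= => /andP[h1 h2]; apply: (AI (phi K)).
  by rewrite /A /= in_itv/= h2 andbT; apply: le_trans h1; rewrite divr_ge0// ltW.
have mB : measurable B by exact: measurable_itv.
have muB1 : mu B <= 1%:E by rewrite muB lee_fin; have := t1 (phi K); rewrite -/T; lra.
apply: le_trans (integral_le_Kfun mub ltr01 mB BI muB1).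
rewrite (eq_integral (cst (c (phi K))%:E)); last first.
  move=> s /set_mem Bs.
  have /andP[h1 h2] : (T / 4 <= s)%R && (s < T)%R by move: Bs; rewrite /B /= in_itv.
  have e1 : u (phi m) s = 0.
    by apply: step_notin; rewrite /A /= in_itv/= => /andP[_]; rewrite ltNge (le_trans tm h1).
  have e2 : u (phi K) s = (c (phi K))%:E.
    by apply: step_in; rewrite /A /= in_itv/= h2 andbT; apply: le_trans h1; rewrite divr_ge0// ltW.
  by rewrite e1 e2 sub0e abseN gee0_abs// lee_fin ltW.
rewrite integral_cst// [X in _ * X]muB -EFinM lee_fin /c -/T.
have -> : ((1 + dl (phi K)) / T * (3 / 4 * T) = (1 + dl (phi K)) * (3 / 4))%R.
  by field; rewrite gt_eqF.
have := dl0 (phi K); lra.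
Qed.

End necessary_tail.

(** * Functions of equal norm over a flat piece of W *)

Section flat_weight.
Context (R : realType) (alpha : \bar R) (p : R) (w : R -> R).
Hypothesis p_gt1 : (1 < p)%R.
Hypothesis w_meas : measurable_fun (itvI alpha) w.
Hypothesis w_ge0 : forall t, itvI alpha t -> (0 <= w t)%R.
Hypothesis wD : class_D alpha p w.
Local Open Scope ereal_scope.
Local Notation mu := (@lebesgue_measure R).
Local Notation I := (itvI alpha).
Local Notation L0 := (@L0 R alpha).
Local Notation aeI := (aeI alpha).
Local Notation gint := (gint alpha p w).
Local Notation wint := (wint alpha p w).
Local Notation Kfun := (Kfun alpha).
Local Notation X := (Gamma alpha p w).
Local Notation tail := (tail alpha p w).
Implicit Types (x y z g u : R -> \bar R) (s t c e d M : R).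

Let p_gt0 : (0 < p)%R. Proof. by rewrite (lt_trans _ p_gt1). Qed.
Let mI : measurable I. Proof. exact: measurable_itvI. Qed.

Variables (a b : R).
Hypothesis a0 : (0 <= a)%R.
Hypothesis ab : (a < b)%R.
Hypothesis ba : b%:E <= alpha.

Let b0 : (0 < b)%R. Proof. exact: le_lt_trans ab. Qed.
Let A := `[0%R, a[%classic.
Let B := `[a, b[%classic.

Let mA : measurable A. Proof. exact: measurable_itv. Qed.
Let mB : measurable B. Proof. exact: measurable_itv. Qed.

Let AI : A `<=` I.
Proof. by apply: sub_itvI; apply: le_trans ba; rewrite lee_fin ltW. Qed.

Let BI : B `<=` I.
Proof.
by move=> s; rewrite /B /= in_itv/= => /andP[as_ sb]; apply: (sub_itvI ba); rewrite /= in_itv/= sb (le_trans a0).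
Qed.

(* When W is flat on [a, b], the norm does not depend on the profile r: the test
   function [face_level] equals [(face r) **] outside (a, b), for every admissible r. *)
Definition face (r : R -> R) : R -> \bar R := fun s => (2 * \1_A s + (1 + r s) * \1_B s)%:E.

Arguments face : simpl never.

(** The bound 1 / 2 keeps 1 + r positive and below the value 2 taken on [0, a); the integral
    condition fixes the total mass of the face to a + b. *)
Definition face_data (r : R -> R) : Prop :=
  [/\ measurable_fun setT r, forall s, (`|r s| <= 2^-1)%R
    & \int[mu]_(s in B) (1 + r s)%:E = (b - a)%:E].

Lemma face_lt r s : A s -> face r s = 2%:E.
Proof.
move=> As; rewrite /face !indicE (mem_set As) memNset ?mulr1 ?mulr0 ?addr0//.
by move: As; rewrite /A /B /= !in_itv/= => /andP[_ sa] /andP[]; rewrite leNgt sa.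
Qed.

Lemma face_mid r s : B s -> face r s = (1 + r s)%:E.
Proof.
move=> Bs; rewrite /face !indicE (mem_set Bs) memNset ?mulr1 ?mulr0 ?add0r//.
by move: Bs; rewrite /A /B /= !in_itv/= => /andP[sa _] /andP[_]; rewrite ltNge sa.
Qed.

Lemma face_out r s : ~ A s -> ~ B s -> face r s = 0.
Proof. by move=> As Bs; rewrite /face !indicE !memNset// !mulr0 addr0. Qed.

Lemma L0_face r : measurable_fun setT r -> L0 (face r).
Proof.
move=> mr; apply/measurable_EFinP; apply: measurable_funD; apply: measurable_funM => //.
by apply: measurable_funD => //; exact: measurable_funTS.
Qed.

Section one_face.
Variable r : R -> R.
Hypothesis Hr : face_data r.

Let mr : measurable_fun setT r. Proof. by case: Hr. Qed.
Let r_bnd s : (`|r s| <= 2^-1)%R. Proof. by case: Hr. Qed.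

Lemma mid_bounds s : (2^-1 <= 1 + r s <= 2)%R.
Proof. by have := r_bnd s; rewrite ler_norml => /andP[h1 h2]; apply/andP; split; lra. Qed.

Lemma face_bounds s : 0 <= face r s <= 2%:E.
Proof.
have [As|As] := pselect (A s); first by rewrite face_lt// !lee_fin lexx ler0n.
have [Bs|Bs] := pselect (B s); last by rewrite face_out// !lee_fin lexx ler0n.
by rewrite face_mid// !lee_fin; have /andP[h1 h2] := mid_bounds s; apply/andP; split; lra.
Qed.

Lemma face_abs s : `|face r s| = face r s.
Proof. by rewrite gee0_abs//; case/andP: (face_bounds s). Qed.

Lemma integral_face_lt t : (0 <= t)%R -> (t <= a)%R -> \int[mu]_(s in `[0%R, t[) `|face r s| = (2 * t)%:E.
Proof.
move=> t0 ta; rewrite -(integral_itv_cst _ t0); apply: eq_integral => s /set_mem Ts.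
have /andP[s0 st] : (0 <= s < t)%R by move: Ts; rewrite /= in_itv.
 rewrite face_abs face_lt// /A /= in_itv/= s0/=.
exact: lt_le_trans ta.
Qed.

Lemma integral_face : \int[mu]_(s in `[0%R, b[) `|face r s| = (a + b)%:E.
Proof.
rewrite (_ : `[0%R, b[%classic = A `|` B); last by rewrite /A /B -itv_bndbnd_setU// bnd_simp// ltW.
rewrite ge0_integral_setU//=.
- have [_ _ e] := Hr; have := integral_face_lt a0 (lexx a); rewrite -/A => ->.
  have -> : \int[mu]_(s in B) `|face r s| = (b - a)%:E.
    by rewrite -e; apply: eq_integral => s /set_mem Bs; rewrite face_abs face_mid.
  by rewrite -EFinD; congr (_%:E); ring.
- by apply: (measurable_funS mI _ (L0_abs (L0_face mr))); rewrite subUset; split.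
- by apply/disj_setPRL => s; rewrite /A /B /= !in_itv/= => /andP[as_ _]; rewrite ltNge as_ andbF.
Qed.

Lemma integral_face_I : \int[mu]_(s in I) `|face r s| = (a + b)%:E.
Proof.
rewrite -integral_face; have sub := sub_itvI ba.
rewrite -[in RHS](setIidr sub) [RHS]integral_mkcondr; apply: eq_integral => s _.
rewrite patchE; case: ifPn => // /negP sb.
rewrite face_out ?abse0// => h; apply: sb; apply/mem_set; move: h; rewrite /A /B /= !in_itv/=.
  by move=> /andP[-> sa]; exact: lt_trans ab.
by move=> /andP[as_ ->]; rewrite (le_trans a0).
Qed.

Lemma face_Kfun_le t : (0 <= t)%R -> Kfun (face r) t <= (2 * t)%:E.
Proof.
move=> t0; apply: Kfun_le_sup => // [|s _]; first exact: L0_face.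
by rewrite face_abs; case/andP: (face_bounds s).
Qed.

Lemma face_Kfun_le_sum t : (0 <= t)%R -> Kfun (face r) t <= (a + b)%:E.
Proof. by move=> t0; rewrite -integral_face_I; apply: Kfun_le_norm1 => //; exact: L0_face. Qed.

Lemma face_Kfun_ge_sum t : (b <= t)%R -> (a + b)%:E <= Kfun (face r) t.
Proof.
move=> bt; rewrite -integral_face; apply: integral_le_Kfun => //.
- exact: L0_face.
- exact: lt_le_trans bt.
- exact: sub_itvI.
- by rewrite /= lebesgue_measure_itv/= lte_fin b0 sube0 lee_fin.
Qed.

End one_face.

(** The two bounds for the maximal function of a face, by its supremum 2 and by its integral a + b
    divided by t. Every profile reaches the first up to a and the second from b on. *)
Definition face_level t : R := (Num.min 2 ((a + b) / t))%R.

Lemma face_level_ge0 t : I t -> (0 <= face_level t)%R.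
Proof. by move=> [t0 _]; rewrite le_min ler0n divr_ge0// addr_ge0// ltW. Qed.

Lemma measurable_face_level : measurable_fun I face_level.
Proof.
by apply: measurable_minr => //; apply/measurable_EFinP; exact: measurable_cdiv.
Qed.

Lemma face_level_le t : (0 < t)%R -> (t <= a)%R -> (t * face_level t = 2 * t)%R.
Proof.
move=> t0 ta; rewrite /face_level min_l; first by rewrite mulrC.
by have := ab; rewrite ler_pdivlMr//; lra.
Qed.

Lemma face_level_ge t : (b <= t)%R -> (t * face_level t = a + b)%R.
Proof.
move=> bt; have t0 : (0 < t)%R := lt_le_trans b0 bt.
rewrite /face_level min_r; first by rewrite mulrCA mulfV ?mulr1 ?gt_eqF.
by rewrite ler_pdivrMr//; have := ab; lra.
Qed.

(** Class D at b: W b controls [0, b), where the level is at most 2, and [Wp b] controls the rest,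
    where it is at most (a + b) / t. *)
Lemma wint_face_level : wint (EFin \o face_level) < +oo.
Proof.
have [Wb Wpb] := wD b0 ba.
have tb : tail b < +oo.
  have := Wpb; rewrite /Wp -/(tail b); case: (tail b) => [c||]; rewrite ?ltry ?ltNyr//.
  by rewrite gt0_muley// lte_fin powR_gt0.
have mF := measurable_wint p w_meas ((measurable_EFinP _ _).2 measurable_face_level).
have F0 t := @wint_part_ge0 _ _ p w w_ge0 (EFin \o face_level) t.
pose T := [set s | (b <= s)%R /\ s%:E < alpha].
have TI : T `<=` I by move=> s [bs sa]; split => //; apply: le_trans bs; exact: ltW.
have mT : measurable T.
  rewrite (_ : T = I `&` `[b, +oo[%classic); first exact: measurableI.
  apply/seteqP; split => s /=; rewrite in_itv/= andbT; last by move=> [[]].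
  by move=> Ts; split; [exact: TI|case: Ts].
have sub := sub_itvI ba.
have mwb := measurable_w w_meas (measurable_itv `[0%R, b[) sub.
have IE : I = `[0%R, b[%classic `|` T.
  apply/seteqP; split => s; last by move=> [/sub|/TI].
  move=> [s0 sa]; have [bs|sb] := leP b s; [by right|left].
  by rewrite /= in_itv/= s0.
rewrite /wint [X in \int[_]_(_ in X) _]IE ge0_integral_setU//; last 3 first.
- by apply: measurable_funS mF => //; rewrite subUset.
- by move=> s; rewrite -IE => /F0.
- by apply/disj_setPRL => s [bs _]; rewrite /= in_itv/= => /andP[_]; rewrite ltNge bs.
apply: lte_add_pinfty.
  apply: (@le_lt_trans _ _ (\int[mu]_(s in `[0%R, b[) ((2 `^ p)%:E * (w s)%:E))).
    apply: ge0_le_integral => //.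
    - by move=> s /sub /F0.
    - exact: (measurable_funS mI sub mF).
    - by apply: measurable_funeM; exact: mwb.
    move=> s /sub Is; rewrite poweR_EFin; apply: lee_wpmul2r; first by rewrite lee_fin w_ge0.
    rewrite lee_fin; apply: ge0_ler_powR; rewrite ?nnegrE ?(ltW p_gt0) ?face_level_ge0//.
    by rewrite /face_level ge_min lexx.
  rewrite ge0_integralZl//; last by move=> s /sub /w_ge0; rewrite lee_fin.
  by apply: lte_mul_pinfty; rewrite ?lee_fin ?powR_ge0.
apply: (@le_lt_trans _ _ (\int[mu]_(s in T) (((a + b) `^ p)%:E * (s `^ (- p) * w s)%:E))).
  have mt := measurable_tail_fun p w_meas.
  apply: ge0_le_integral => //.
  - by move=> s /TI /F0.
  - exact: (measurable_funS mI TI mF).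
  - by apply: measurable_funeM; exact: (measurable_funS mI TI mt).
  move=> s Ts; have Is := TI _ Ts; have s0 : (0 < s)%R := lt_le_trans b0 Ts.1.
  rewrite poweR_EFin EFinM muleA; apply: lee_wpmul2r; first by rewrite lee_fin w_ge0.
  rewrite -EFinM lee_fin; apply: (@le_trans _ _ (((a + b) / s) `^ p)%R).
    apply: ge0_ler_powR; rewrite ?nnegrE ?(ltW p_gt0) ?face_level_ge0//.
      by rewrite divr_ge0 ?addr_ge0// ltW.
    by rewrite /face_level ge_min lexx orbT.
  rewrite powRM ?addr_ge0 ?invr_ge0 ?(ltW b0) ?(ltW s0)//.
  by rewrite -[(s^-1)%R]powR_inv1 ?(ltW s0)// -powRrM mulN1r.
have mtT := measurable_funS mI TI (measurable_tail_fun p w_meas).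
rewrite ge0_integralZl//; last 2 first.
- by move=> s /TI Is; rewrite lee_fin mulr_ge0 ?powR_ge0 ?w_ge0.
- by rewrite lee_fin powR_ge0.
by apply: lte_mul_pinfty; rewrite ?lee_fin ?powR_ge0.
Qed.

Hypothesis Wflat : W w b <= W w a.

Lemma flat_ae : aeI (fun t => (a < t)%R -> (t < b)%R -> w t = 0%R).
Proof.
have aa : a%:E <= alpha by apply: le_trans ba; rewrite lee_fin ltW.
have Wa : W w a < +oo.
  have := a0; rewrite le_eqVlt => /orP[/eqP <-|a0']; last by case: (wD a0' aa).
  by rewrite /W set_itvco0 integral_set0 ltry.
have [k k0 kE] := ge0_fin_real (W_ge0 w_ge0 aa) Wa.
have sub : `]a, b[%classic `<=` I by apply: subset_trans BI; exact: subset_itv_oo_co.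
have i0 : 0 <= \int[mu]_(s in `]a, b[) (w s)%:E.
  by apply: integral_ge0 => s /sub /w_ge0; rewrite lee_fin.
have iE : \int[mu]_(s in `]a, b[) `|(EFin \o w) s| = 0.
  have -> : \int[mu]_(s in `]a, b[) `|(EFin \o w) s| = \int[mu]_(s in `]a, b[) (w s)%:E.
    by apply: eq_integral => s /set_mem /sub /w_ge0 h; rewrite /= ger0_norm.
  apply/eqP; rewrite eq_le i0 andbT; have := Wflat.
  rewrite (W_split w_meas w_ge0 a0 (ltW ab) ba) kE.
  move: i0; case: (\int[mu]_(s in _) _) => [c||]//; rewrite -?EFinD ?lee_fin; lra.
have mo : measurable (`]a, b[%classic : set R) by exact: measurable_itv.
have /(ae_eq_integral_abs mu mo (measurable_w w_meas mo sub)) h := iE.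
clear iE; rewrite /Defs.aeI; apply: filterS h => s h _ as_ sb.
by have /= := h _; rewrite in_itv/= as_ sb => /(_ isT)[].
Qed.

Section one_face'.
Variable r : R -> R.
Hypothesis Hr : face_data r.
Let mr : measurable_fun setT r. Proof. by case: Hr. Qed.

Lemma gint_face_le : gint (face r) <= wint (EFin \o face_level).
Proof.
apply: (gint_le_dual p_gt1 w_meas w_ge0 measurable_face_level (L0_face mr)).
move: flat_ae (aeI_neq0 alpha); apply: aeIS2 => t [t0 _] wt tn0.
have t0' : (0 < t)%R by rewrite lt_neqAle eq_sym tn0.
have [ta|at_] := leP t a; first by right; rewrite (face_level_le t0' ta); exact: face_Kfun_le.
have [bt|tb] := leP b t; last by left; exact: wt.
by right; rewrite (face_level_ge bt); exact: face_Kfun_le_sum.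
Qed.

Lemma pairing_face_ge : wint (EFin \o face_level) <= pairing alpha (face r) (dual_test alpha p w face_level).
Proof.
apply: (dual_test_ge p_gt1 w_meas w_ge0 measurable_face_level face_level_ge0 (L0_face mr)).
move: flat_ae (aeI_neq0 alpha); apply: aeIS2 => t [t0 ta'] wt tn0.
have t0' : (0 < t)%R by rewrite lt_neqAle eq_sym tn0.
have [ta|at_] := leP t a.
  by right; rewrite (face_level_le t0' ta) (integral_face_lt Hr t0 ta).
have [bt|tb] := leP b t; last by left; exact: wt.
right; rewrite (face_level_ge bt) -(integral_face Hr); apply: ge0_subset_integral => //.
  by apply: (measurable_funS mI _ (L0_abs (L0_face mr))); apply: sub_itvI; exact: ltW.
by move=> s; rewrite /= !in_itv/= => /andP[-> sb]; exact: lt_le_trans bt.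
Qed.

Lemma face_carrier : carrier X (face r).
Proof.
apply/(carrierP p_gt1 w_ge0); split; first exact: L0_face.
exact: le_lt_trans gint_face_le wint_face_level.
Qed.

End one_face'.

End flat_weight.

(** * Flat pieces of the weight *)

Section cosines.
Context (R : realType) (a b : R).
Hypothesis ab : a < b.
Local Notation mu := (@lebesgue_measure R).
Implicit Types (f g : R -> R) (c k : R).

(** Carrying a primitive along makes integrals of trigonometric sums linear, with a single use of
    the fundamental theorem. *)
Definition has_int f c : Prop :=
  continuous f /\ exists2 F : R -> R, (forall s : R, is_derive s (1 : R) F (f s)) & F b - F a = c.

Lemma has_int_integral f c : has_int f c -> (\int[mu]_(s in `[a, b[) (f s)%:E = c%:E)%E.
Proof.
move=> [cf [F dF FE]].
have cF : continuous F.
  by move=> s; apply: differentiable_continuous; apply/derivable1_diffP; have [] := dF s.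
rewrite integral_itv_bndo_bndc; last first.
  by apply/measurable_EFinP; apply: measurable_funTS; exact: continuous_measurable_fun.
rewrite (continuous_FTC2 (F := F) ab) -?EFinB ?FE//.
- exact: continuous_subspaceT.
- split; first by move=> s _; have [] := dF s.
    by apply: cvg_at_right_filter; exact: cF.
  by apply: cvg_at_left_filter; exact: cF.
- by move=> s _; rewrite derive1E; have [_ ->] := dF s.
Qed.

Lemma has_int_cst c : has_int (cst c) (c * (b - a)).
Proof.
split; first by move=> s; exact: cvg_cst.
exists (fun s => c * s); last by rewrite mulrBr.
by move=> s; have := is_deriveZ c (is_derive_id s (1 : R)); rewrite /= => h; apply: is_derive_eq h _; rewrite /GRing.scale/= mulr1.
Qed.

Lemma has_intD f g c d : has_int f c -> has_int g d -> has_int (fun s => f s + g s) (c + d).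
Proof.
move=> [cf [F dF <-]] [cg [G dG <-]]; split.
  by move=> s; apply: continuousD; [exact: cf|exact: cg].
by exists (F + G) => [s|]; [exact: is_deriveD|rewrite !fctE; ring].
Qed.

Lemma has_intZ f k c : has_int f c -> has_int (fun s => k * f s) (k * c).
Proof.
move=> [cf [F dF <-]]; split.
  by move=> s; apply: continuousM; [exact: cst_continuous|exact: cf].
by exists (k \*: F) => [s|]; [exact: is_deriveZ|rewrite /GRing.scale/= mulrBr].
Qed.

Lemma has_int_cos k : k != 0 -> sin (k * (b - a)) = 0 -> has_int (fun s => cos (k * (s - a))) 0.
Proof.
move=> k0 sk; split.
  move=> s; apply: (@continuous_comp _ _ _ (fun s => k * (s - a)) cos); last exact: continuous_cos.
  apply: continuousM; first exact: cst_continuous.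
  by apply: continuousB; [exact: id|exact: cst_continuous].
exists (fun s => k^-1 * sin (k * (s - a))); last first.
  by rewrite sk subrr [k * 0]mulr0 sin0 !mulr0 subrr.
move=> s.
have d1 : is_derive s (1 : R) (fun s => k * (s - a)) k.
  have := is_deriveZ k (is_deriveB (is_derive_id s (1 : R)) (is_derive_cst a s (1 : R))).
  by move=> h; apply: is_derive_eq h _; rewrite subr0 /GRing.scale/= mulr1.
have := is_deriveZ k^-1 (@is_derive1_comp _ sin (fun s => k * (s - a)) s _ _ (is_derive_sin (k * (s - a))) d1).
by move=> h; apply: is_derive_eq h _; rewrite /GRing.scale/= mulrCA mulVf// mulr1.
Qed.

(** Multiples of pi / (b - a) make the sine primitives vanish at both ends, so the cosines have mean
    0; n + 1 excludes the constant. *)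
Definition wave (n : nat) s : R := cos (n.+1%:R * (pi / (b - a)) * (s - a)).

Let ba0 : b - a != 0. Proof. by rewrite subr_eq0 gt_eqF. Qed.

Lemma sin_natpi (n : nat) : sin (n%:R * pi) = 0 :> R.
Proof.
elim: n => [|n IH]; first by rewrite mul0r sin0.
by rewrite -addn1 natrD mulrDl mul1r sinDpi IH oppr0.
Qed.

Let freq (n : nat) : R := n%:R * (pi / (b - a)).

Let has_int_freq n : (0 < n)%N -> has_int (fun s => cos (freq n * (s - a))) 0.
Proof.
move=> n0; apply: has_int_cos.
  by rewrite /freq mulf_neq0// ?pnatr_eq0 -?lt0n// mulf_neq0 ?invr_eq0// gt_eqF// pi_gt0.
by rewrite /freq -mulrA mulfVK// sin_natpi.
Qed.

Lemma continuous_wave n : continuous (wave n).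
Proof. by have [] := has_int_freq (ltn0Sn n). Qed.

Lemma wave_le1 n s : `|wave n s| <= 1.
Proof. by rewrite ler_norml cos_geN1 cos_le1. Qed.

Lemma integral_wave n : (\int[mu]_(s in `[a, b[) (1 + wave n s / 2)%:E = (b - a)%:E)%E.
Proof.
have := has_intD (has_int_cst 1) (has_intZ 2^-1 (has_int_freq (ltn0Sn n))).
rewrite mulr0 addr0 mul1r => /has_int_integral <-.
by apply: eq_integral => s _; rewrite /wave /freq [_ / 2]mulrC.
Qed.

(** (cos A - cos B)^2 = 1 + cos (2 A) / 2 + cos (2 B) / 2 - cos (A + B) - cos (A - B), and every
    cosine on the right has mean 0. *)
Lemma wave_orthogonal m n : (m < n)%N ->
  (\int[mu]_(s in `[a, b[) ((wave n s - wave m s) ^+ 2)%:E = (b - a)%:E)%E.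
Proof.
move=> mn.
have h := has_intD (has_intD (has_int_cst 1)
   (has_intD (has_intZ 2^-1 (has_int_freq (_ : 0 < n.+1 + n.+1)%N))
             (has_intZ 2^-1 (has_int_freq (_ : 0 < m.+1 + m.+1)%N))))
   (has_intD (has_intZ (-1) (has_int_freq (_ : 0 < n.+1 + m.+1)%N))
             (has_intZ (-1) (has_int_freq (_ : 0 < n - m)%N))).
have := h isT isT isT; rewrite subn_gt0 => /(_ mn).
rewrite !mulr0 !addr0 mul1r => /has_int_integral <-.
apply: eq_integral => s _; congr (_%:E); rewrite /wave /=.
have nm : (n - m)%:R = n.+1%:R - m.+1%:R :> R by rewrite -(natrB _ (leqW mn)) subSS.
rewrite /freq !natrD nm; move: (n.+1%:R) (m.+1%:R) (pi / (b - a)) => x y z.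
rewrite !mulrDl !mulNr.
set A := x * z * (s - a); set B := y * z * (s - a).
rewrite !cosD cosN sinN -/A -/B.
have := cos2Dsin2 A; have := cos2Dsin2 B; rewrite !expr2.
move: (cos A) (cos B) (sin A) (sin B) => cA cB sA sB h1 h2; lra.
Qed.

End cosines.

Section flat_contradictions.
Context (R : realType) (alpha : \bar R) (p : R) (w : R -> R).
Hypothesis p_gt1 : (1 < p)%R.
Hypothesis w_meas : measurable_fun (itvI alpha) w.
Hypothesis w_ge0 : forall t, itvI alpha t -> (0 <= w t)%R.
Hypothesis wD : class_D alpha p w.
Local Open Scope ereal_scope.
Local Notation mu := (@lebesgue_measure R).
Local Notation I := (itvI alpha).
Local Notation L0 := (@L0 R alpha).
Local Notation gint := (gint alpha p w).
Local Notation wint := (wint alpha p w).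
Local Notation Kfun := (Kfun alpha).
Local Notation X := (Gamma alpha p w).
Implicit Types (x y z g u : R -> \bar R) (s t c e d M : R).

Let p_gt0 : (0 < p)%R. Proof. by rewrite (lt_trans _ p_gt1). Qed.
Let mI : measurable I. Proof. exact: measurable_itvI. Qed.

Variables (a b : R).
Hypothesis a0 : (0 <= a)%R.
Hypothesis ab : (a < b)%R.
Hypothesis ba : b%:E <= alpha.
Hypothesis Wflat : W w b <= W w a.

Let b0 : (0 < b)%R. Proof. exact: le_lt_trans ab. Qed.
Let c := ((a + b) / 2)%R.
Let ac : (a < c)%R. Proof. by rewrite /c; have := ab; lra. Qed.
Let cb : (c < b)%R. Proof. by rewrite /c; have := ab; lra. Qed.

Let level := face_level a b.

(** One bound is [gint_face_le]. For the other, the pairing with the dual function is at least n,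
    the p-th power of the norm of [level], and Young's inequality p n <= gint + (p - 1) n gives gint
    >= n. *)
Lemma gint_face r : face_data a b r -> gint (face a b r) = wint (EFin \o level).
Proof.
move=> Hr; have Hr' := Hr; have [mr _ _] := Hr'.
apply/eqP; rewrite eq_le (gint_face_le p_gt1 w_meas w_ge0 wD a0 ab ba Wflat Hr)/=.
have N := wint_face_level p_gt1 w_meas w_ge0 wD a0 ab ba.
have [n n0 nE] := ge0_fin_real (wint_ge0 p w_ge0 _) N.
have h1 := pairing_face_ge p_gt1 w_meas w_ge0 wD a0 ab ba Wflat Hr.
have h2 := half_space_young p_gt1 w_meas w_ge0 (measurable_face_level a b)
  (face_level_ge0 a0 ab) (L0_face (alpha := alpha) a b mr).
have h3 : p%:E * n%:E <= gint (face a b r) + (p - 1)%:E * n%:E.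
  rewrite -nE; apply: le_trans h2; apply: lee_wpmul2l; [by rewrite lee_fin ltW|exact: h1].
rewrite /level nE; move: (gint _) h3 => [k||]//; rewrite -?EFinM ?leey// -?EFinD ?lee_fin; lra.
Qed.

(** Moves mass from the right half of [a, b) to the left half: the face takes the values 3 / 2 and 1
    / 2 there, instead of 1. *)
Let half s : R := (\1_`]-oo, c[%classic s - 2^-1)%R.

Let half_lt s : (s < c)%R -> half s = (2^-1)%R.
Proof.
move=> sc; have -> : half s = (1 - 2^-1)%R by rewrite /half indicE mem_set//= in_itv.
lra.
Qed.

Let half_ge s : (c <= s)%R -> half s = (- 2^-1)%R.
Proof.
move=> cs; have -> : half s = (0 - 2^-1)%R by rewrite /half indicE memNset//= in_itv/= ltNge cs.
lra.
Qed.

Lemma face_data0 : face_data a b (fun=> 0%R).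
Proof.
split; first exact: measurable_cst.
  by move=> s; rewrite normr0.
rewrite (eq_integral (cst 1)) ?integral_cst//; last by move=> s _; rewrite addr0.
by rewrite mul1e /= lebesgue_measure_itv/= lte_fin ab.
Qed.

Lemma face_data_half : face_data a b half.
Proof.
split.
- by apply: measurable_funB => //; exact: measurable_indic.
- move=> s; have [sc|cs] := ltP s c; first by rewrite half_lt// ger0_norm.
  by rewrite half_ge// normrN ger0_norm.
rewrite (_ : `[a, b[%classic = `[a, c[ `|` `[c, b[); last first.
  by rewrite -itv_bndbnd_setU// bnd_simp// ltW.
have mh : measurable_fun setT (fun s => (1 + half s)%:E).
  apply/measurable_EFinP; apply: measurable_funD => //; exact: measurable_funB.
rewrite ge0_integral_setU//=.
- rewrite (eq_integral (cst (3 / 2)%:E)); last first.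
    move=> s /set_mem; rewrite /= in_itv/= => /andP[_ sc]; rewrite half_lt//; congr (_%:E); lra.
  rewrite integral_cst//= lebesgue_measure_itv/= lte_fin ac -EFinB -EFinM.
  rewrite (eq_integral (cst (1 / 2)%:E)); last first.
    move=> s /set_mem; rewrite /= in_itv/= => /andP[cs _]; rewrite half_ge//; congr (_%:E); lra.
  rewrite integral_cst//= lebesgue_measure_itv/= lte_fin cb -EFinB -EFinM -EFinD /c.
  by congr (_%:E); field.
- exact: measurable_funTS.
- move=> s _; rewrite lee_fin; have [sc|cs] := ltP s c; [rewrite half_lt//|rewrite half_ge//]; lra.
- by apply/disj_setPRL => s /=; rewrite !in_itv/= => /andP[cs _]; rewrite ltNge cs andbF.
Qed.

Let x := face a b (fun=> 0%R).
Let y := face a b half.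

Let mx : L0 x. Proof. by have [mr _ _] := face_data0; exact: L0_face. Qed.
Let my : L0 y. Proof. by have [mr _ _] := face_data_half; exact: L0_face. Qed.

Let Kfun_y_a t : (0 < t)%R -> (t <= a)%R -> (2 * t)%:E <= Kfun y t.
Proof.
move=> t0 ta; rewrite -(integral_face_lt face_data_half (ltW t0) ta).
apply: integral_le_Kfun => //.
  by apply: sub_itvI; apply: le_trans ba; rewrite lee_fin; apply: le_trans ta (ltW ab).
by rewrite /= lebesgue_measure_itv/= lte_fin t0 sube0.
Qed.

Let Kfun_x_mid t : (0 <= t)%R -> Kfun x t <= (a + t)%:E.
Proof.
move=> t0; apply: le_trans (Kfun_le mx ler01 t0) _.
rewrite mul1r addrC EFinD; apply: leeD => //.
have AI : `[0%R, a[%classic `<=` I.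
  by apply: sub_itvI; apply: le_trans ba; rewrite lee_fin ltW.
have -> : a%:E = \int[mu]_(s in I) `|step 1 `[0%R, a[%classic s|.
  rewrite integral_step// mul1e /= lebesgue_measure_itv/= lte_fin sube0.
  by case: ifPn => // na; congr (_%:E); apply/eqP; rewrite eq_le a0 leNgt na.
apply: ge0_le_integral => //.
- by move=> s _; exact: excess_part_ge0.
- exact: measurable_excess_fun.
- by apply: L0_abs; exact: L0_step.
move=> s [s0 _]; have [sa|as_] := ltP s a.
  rewrite step_in; last by rewrite /= in_itv/= s0.
  rewrite (face_abs face_data0) face_lt; last by rewrite /= in_itv/= s0.
  by rewrite abse1 ge_max lee01 andbT -EFinB lee_fin; lra.
rewrite ge_max abse_ge0 andbT; apply: le_trans (abse_ge0 _); rewrite sube_le0.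
rewrite (face_abs face_data0); have [sb|bs] := ltP s b.
  by rewrite face_mid ?addr0// /= in_itv/= as_.
rewrite face_out ?lee01// /= in_itv/= => /andP[h1 h2].
  by move: h2; rewrite ltNge (le_trans (ltW ab) bs).
by move: h2; rewrite ltNge bs.
Qed.

(* Kfun y is concave, at least 2a at a and at least a + b at b. *)
Let Kfun_y_mid t : (a < t)%R -> (t < b)%R -> (a + t)%:E <= Kfun y t.
Proof.
move=> at_ tb; have t0 : (0 < t)%R := le_lt_trans a0 at_.
have [|l [l0 _ KE]] := Kfun_attained my t0.
  by apply: le_lt_trans (face_Kfun_le alpha face_data_half (ltW t0)) (ltry _).
have Eb := le_trans (face_Kfun_ge_sum a0 ab ba face_data_half (lexx b)) (Kfun_le my l0 (ltW b0)).
have Ea : (2 * a)%:E <= (l * a)%:E + excess alpha l y.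
  apply: le_trans (Kfun_le my l0 a0); have := a0; rewrite le_eqVlt => /orP[/eqP <-|a0'].
    by rewrite mulr0; exact: Kfun_ge0.
  exact: Kfun_y_a.
rewrite KE; move: (excess alpha l y) Ea Eb => [E||]//; rewrite ?leey// -!EFinD !lee_fin => Ea Eb.
have h1 : (0 <= (b - t) * (l * a + E - 2 * a))%R by rewrite mulr_ge0//; lra.
have h2 : (0 <= (t - a) * (l * b + E - (a + b)))%R by rewrite mulr_ge0//; lra.
have h3 : (0 <= (b - a) * (l * t + E - (a + t)))%R by lra.
by move: h3; rewrite pmulr_rge0; lra.
Qed.

(** Passing from x to y changes K only inside (a, b), where w vanishes a.e., so the norms agree. The
    rearrangements differ at t = a, with a value at most 1 for x and more than 1 for y. *)
Lemma strictly_K_monotone_not_flat : ~ strictly_K_monotone alpha X.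
Proof.
move=> sK.
have xX : carrier X x := face_carrier p_gt1 w_meas w_ge0 wD a0 ab ba Wflat face_data0.
have yX : carrier X y := face_carrier p_gt1 w_meas w_ge0 wD a0 ab ba Wflat face_data_half.
have xy : maj alpha x y.
  move=> t t0; rewrite !max_rearrE; apply: lee_wpmul2l; first by rewrite lee_fin invr_ge0 ltW.
  have [ta|at_] := leP t a.
    exact: le_trans (face_Kfun_le alpha face_data0 (ltW t0)) (Kfun_y_a t0 ta).
  have [bt|tb] := leP b t.
    apply: le_trans (face_Kfun_le_sum a0 ab ba face_data0 (ltW t0)) _.
    exact: face_Kfun_ge_sum a0 ab ba _ face_data_half _ bt.
  exact: le_trans (Kfun_x_mid (ltW t0)) (Kfun_y_mid at_ tb).
have rx : rearr alpha x a <= 1.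
  rewrite rearr_leE//; apply: (@le_trans _ _ (mu `[0%R, a[%classic)).
    apply: le_measure; rewrite ?inE//.
      exact: measurable_distr.
    move=> s [[s0 _] xs]; rewrite /= in_itv/= s0/= ltNge; apply/negP => as_.
    move: xs; rewrite (face_abs face_data0); have [sb|bs] := ltP s b.
      by rewrite face_mid ?addr0 ?ltxx// /= in_itv/= as_.
    rewrite face_out ?lte_fin ?ltr10// /= in_itv/= => /andP[h1 h2].
      by move: h2; rewrite ltNge as_.
    by move: h2; rewrite ltNge bs.
  by rewrite /= lebesgue_measure_itv/= sube0; case: ifP => // _; rewrite lee_fin.
have ry : 1 < rearr alpha y a.
  rewrite lt_rearr//; apply: (@lt_le_trans _ _ (mu `[0%R, c[%classic)).
    by rewrite /= lebesgue_measure_itv/= lte_fin (le_lt_trans a0 ac) sube0 lte_fin.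
  apply: le_measure; rewrite ?inE//; first exact: measurable_distr.
  move=> s Ss; have /andP[s0 sc] : (0 <= s < c)%R by move: Ss; rewrite /= in_itv.
  split.
    by apply: (sub_itvI ba); rewrite /= in_itv/= s0; exact: lt_trans cb.
  rewrite (face_abs face_data_half); have [sa|as_] := ltP s a.
    by rewrite face_lt ?lte_fin ?ltr1n// /= in_itv/= s0.
  rewrite face_mid ?half_lt ?lte_fin; [lra|by []|].
  by rewrite /= in_itv/= as_; exact: lt_trans cb.
have ne : exists2 t, (0 <= t)%R & rearr alpha x t <> rearr alpha y t.
  by exists a => // e; move: ry; rewrite -e; apply/negP; rewrite -leNgt.
have := sK x y xX yX xy ne; rewrite !gamma_normE.
have -> : gint x = wint (EFin \o level) := gint_face face_data0.
have -> : gint y = wint (EFin \o level) := gint_face face_data_half.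
by rewrite ltxx.
Qed.

Let ripple n s : R := (wave a b n s / 2)%R.

Lemma face_data_ripple n : face_data a b (ripple n).
Proof.
split.
- by apply: measurable_funM => //; apply: continuous_measurable_fun; exact: (continuous_wave ab).
- move=> s; rewrite /ripple normrM [X in (_ * X)%R]ger0_norm//.
  by have := wave_le1 a b n s; lra.
exact: (integral_wave ab).
Qed.

(** Two values of waves differ by d with |d| <= 2, so |d| / 2 >= d^2 / 4, and orthogonality bounds
    the L^1 distance on [a, b) from below. *)
Lemma ripple_dist m n : (m < n)%N ->
  ((b - a) / 4)%:E <= Kfun (face a b (ripple n) \- face a b (ripple m)) b.
Proof.
move=> mn.
have mn1 k : L0 (face a b (ripple k)) by have [mr _ _] := face_data_ripple k; exact: L0_face.
have md : L0 (face a b (ripple n) \- face a b (ripple m)) by exact: L0_sub.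
have BI : `[a, b[%classic `<=` I.
  move=> s; rewrite /= in_itv/= => /andP[as_ sb]; apply: (sub_itvI ba).
  by rewrite /= in_itv/= sb (le_trans a0).
have mB : mu `[a, b[%classic <= b%:E.
  by rewrite /= lebesgue_measure_itv/= lte_fin ab -EFinB lee_fin lerBlDr lerDl.
have mB' : measurable (`[a, b[%classic : set R) by exact: measurable_itv.
apply: le_trans (integral_le_Kfun md b0 mB' BI mB).
have -> : ((b - a) / 4)%:E = \int[mu]_(s in `[a, b[) ((4^-1)%:E * ((wave a b n s - wave a b m s) ^+ 2)%:E).
  rewrite ge0_integralZl//.
  - by rewrite (wave_orthogonal ab mn) -EFinM mulrC.
  - apply/measurable_EFinP; apply: measurable_funX; apply: measurable_funTS.
    by apply: measurable_funB; apply: continuous_measurable_fun; exact: (continuous_wave ab).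
  - by move=> s _; rewrite lee_fin sqr_ge0.
apply: ge0_le_integral => //.
- by move=> s _; rewrite -EFinM lee_fin mulr_ge0// sqr_ge0.
- apply: measurable_funeM; apply/measurable_EFinP; apply: measurable_funX; apply: measurable_funTS.
  by apply: measurable_funB; apply: continuous_measurable_fun; exact: (continuous_wave ab).
- exact: (measurable_funS mI BI (L0_abs md)).
move=> s Bs; rewrite (face_mid _ Bs) (face_mid _ Bs) -EFinB -EFinM abse_EFin lee_fin /ripple.
have := wave_le1 a b n s; have := wave_le1 a b m s.
move: (wave a b n s) (wave a b m s) => x1 x2; rewrite !ler_norml => /andP[h1 h2] /andP[h3 h4].
have -> : (1 + x1 / 2 - (1 + x2 / 2) = (x1 - x2) / 2)%R by field.
rewrite normrM [X in (_ <= _ * X)%R]ger0_norm// -real_normK ?num_real//.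
have : (`|x1 - x2| <= 2)%R by rewrite ler_norml; apply/andP; split; lra.
have := normr_ge0 (x1 - x2)%R; move: `|x1 - x2|%R => d d0 d2.
by rewrite expr2; nra.
Qed.

(** All rippled faces minimize the norm on one half-space, while [ripple_dist] keeps any two of them
    apart. *)
Lemma approx_compact_not_flat : weight_pos alpha w -> ~ approx_compact alpha X.
Proof.
move=> wp aX.
have N := wint_face_level p_gt1 w_meas w_ge0 wD a0 ab ba.
have [k k0 kE] := ge0_fin_real (wint_ge0 p w_ge0 _) N.
have mg := L0_dual_test p w_meas w_ge0 (measurable_face_level a b).
have young z : L0 z -> p%:E * pairing alpha z (dual_test alpha p w level) <= gint z + (p - 1)%:E * k%:E.
  move=> mz; rewrite -kE; apply: (half_space_young p_gt1 w_meas w_ge0) => //.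
    exact: measurable_face_level.
  exact: face_level_ge0.
have uC n : pos_test alpha p w (dual_test alpha p w level) k (face a b (ripple n)).
  split; first exact: (face_carrier p_gt1 w_meas w_ge0 wD a0 ab ba Wflat (face_data_ripple n)).
  split; first by apply: aeI_all => s _; case/andP: (face_bounds (face_data_ripple n) s).
  by rewrite -kE; exact: (pairing_face_ge p_gt1 w_meas w_ge0 wD a0 ab ba Wflat (face_data_ripple n)).
have uN e : (0 < e)%R -> exists K, forall n, (K <= n)%N -> gint (face a b (ripple n)) <= (k + e)%:E.
  move=> e0; exists 0%N => n _.
  apply: le_trans (gint_face_le p_gt1 w_meas w_ge0 wD a0 ab ba Wflat (face_data_ripple n)) _.
  by rewrite kE lee_fin; lra.
have [phi [phi1 uc]] := half_space_cauchy p_gt1 w_meas w_ge0 wp aX mg k0 young uC uN.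
have [c1 c10 Hc1] := gint_ge_Kfun p_gt1 w_meas w_ge0 wp b0.
have q0 : (0 < (b - a) / 4)%R by rewrite divr_gt0// subr_gt0.
have d0 : (0 < c1 * ((b - a) / 4) `^ p / 2)%R by rewrite divr_gt0// mulr_gt0// powR_gt0.
have [K HK] := uc _ d0.
have := HK K.+1 K (leqnSn K) (leqnn K); apply/negP; rewrite -ltNge.
apply: (@lt_le_trans _ _ (c1 * ((b - a) / 4) `^ p)%:E); first by rewrite lte_fin; lra.
apply: Hc1.
- by apply: L0_sub; [case: (uC (phi K.+1)) => -[]|case: (uC (phi K)) => -[]].
- exact: ltW.
- by apply: ripple_dist; exact: phi1.
Qed.

End flat_contradictions.

(** * Bounded W on the half-line *)

Section necessary_infty.
Context (R : realType) (alpha : \bar R) (p : R) (w : R -> R).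
Hypothesis p_gt1 : (1 < p)%R.
Hypothesis w_meas : measurable_fun (itvI alpha) w.
Hypothesis w_ge0 : forall t, itvI alpha t -> (0 <= w t)%R.
Hypothesis aoo : alpha = +oo%E.
Local Open Scope ereal_scope.
Local Notation mu := (@lebesgue_measure R).
Local Notation I := (itvI alpha).
Local Notation L0 := (@L0 R alpha).
Local Notation gint := (gint alpha p w).
Local Notation wint := (wint alpha p w).
Local Notation Kfun := (Kfun alpha).
Local Notation X := (Gamma alpha p w).
Local Notation distr := (distr_fun alpha).
Implicit Types (x y z g u : R -> \bar R) (s t c e d M l : R).

Let p_gt0 : (0 < p)%R. Proof. by rewrite (lt_trans _ p_gt1). Qed.
Let mI : measurable I. Proof. exact: measurable_itvI. Qed.

Let It t : I t <-> (0 <= t)%R.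
Proof. by rewrite aoo; split => [[]|t0]//; split => //; exact: ltry. Qed.

Lemma wint_cst l : (0 <= l)%R -> wint (cst l%:E) = (l `^ p)%:E * \int[mu]_(t in I) (w t)%:E.
Proof.
move=> l0; rewrite -ge0_integralZl//.
- exact/measurable_EFinP.
- by rewrite lee_fin powR_ge0.
Qed.

Lemma gint_ge_rearr z l : L0 z -> (0 <= l)%R -> (forall s, (0 <= s)%R -> l%:E <= rearr alpha z s) ->
  (l `^ p)%:E * \int[mu]_(t in I) (w t)%:E <= gint z.
Proof.
move=> mz l0 lz; rewrite -wint_cst//; apply: ae_ge0_le_integral => //.
- by move=> t Itt; exact: (wint_part_ge0 p w_ge0).
- by apply: measurable_wint => //; exact: measurable_cst.
- by move=> t Itt; exact: (wint_part_ge0 p w_ge0).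
- exact: (measurable_wint p w_meas (measurable_max_rearr mz)).
move: (aeI_neq0 alpha); apply: aeIS => t Itt tn0.
have t0 : (0 < t)%R by rewrite lt_neqAle eq_sym tn0; apply/It.
apply: lee_wpmul2r; first by rewrite lee_fin w_ge0.
apply: (le_poweR p_gt1); first by rewrite lee_fin.
apply: max_rearr_ge => //; rewrite -EFinM mulrC -(integral_itv_cst l (ltW t0)).
apply: ge0_le_integral => //.
- by apply: measurable_rearr; exact: interval_is_interval.
- by move=> s; rewrite /= in_itv/= => /andP[s0 _]; exact: lz.
Qed.

Lemma gint_ge_distr z l : L0 z -> (0 <= l)%R -> distr z l = +oo ->
  (l `^ p)%:E * \int[mu]_(t in I) (w t)%:E <= gint z.
Proof.
move=> mz l0 dz; apply: gint_ge_rearr => // s s0.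
by apply: ltW; rewrite lt_rearr// dz ltry.
Qed.

(* If W is bounded, this set is closed and its elements 1_[n, oo) all have the
   minimal norm, although they are at distance bounded below. *)
Definition asymp1 : set (R -> \bar R) :=
  [set x | carrier X x /\ forall e, (0 < e)%R -> distr (x \- cst 1) e < +oo].

Let L1 x : L0 x -> L0 (x \- cst 1).
Proof. by move=> mx; apply: L0_sub => //; exact: measurable_cst. Qed.

Let distr_cover x y z e d c : L0 x -> L0 y -> L0 z ->
  (forall s, I s -> `|x s| <= e%:E -> `|y s| <= d%:E -> `|z s| <= c%:E) ->
  distr z c <= distr x e + distr y d.
Proof.
move=> mx my mz H.
apply: (@le_trans _ _ (mu ([set s | I s /\ e%:E < `|x s|] `|` [set s | I s /\ d%:E < `|y s|]))); last first.
  by apply: measureU2; exact: measurable_distr.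
apply: le_measure; rewrite ?inE; [exact: measurable_distr|by apply: measurableU; exact: measurable_distr|].
move=> s [Is cz]; apply: contrapT => /not_orP[h1 h2]; move: cz; rewrite ltNge H//.
  by rewrite leNgt; apply/negP => h; exact: h1.
by rewrite leNgt; apply/negP => h; exact: h2.
Qed.

(** x is within e / 2 of 1 off a set of finite measure, so |x| exceeds 1 - e on a set of infinite
    measure, and x^* >= 1 - e everywhere. *)
Lemma asymp1_gint x : asymp1 x -> \int[mu]_(t in I) (w t)%:E <= gint x.
Proof.
move=> [xX x1]; have mx := xX.1.
have -> : \int[mu]_(t in I) (w t)%:E = (1 `^ p)%:E * \int[mu]_(t in I) (w t)%:E.
  by rewrite powR1 mul1e.
apply: gint_ge_rearr => // s s0; apply/lee_addgt0Pr => e e0.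
have [e1|e1] := leP 1%R e.
  by apply: (@le_trans _ _ e%:E); [rewrite lee_fin|rewrite leeDr// rearr_ge0].
suff h : (1 - e)%:E <= rearr alpha x s.
  apply: (@le_trans _ _ ((1 - e)%:E + e%:E)); last exact: leeD2r.
  by rewrite -EFinD subrK.
have l0 : (0 <= 1 - e)%R by lra.
apply: ltW; rewrite lt_rearr//.
have e20 : (0 < e / 2)%R by rewrite divr_gt0.
have d1 := x1 _ e20.
have : distr (cst 1) (2^-1)%R <= distr x (1 - e) + distr (x \- cst 1) (e / 2).
  apply: (distr_cover mx (L1 mx) (measurable_cst _)) => r _ /=.
  by case: (x r) => [v||]//=; rewrite -?EFinB ?lee_fin// !ler_norml => /andP[h1 h2] /andP[h3 h4]; exfalso; lra.
have -> : distr (cst 1) (2^-1)%R = +oo.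
  rewrite /distr_fun (_ : [set s | _] = I).
    by rewrite aoo lebesgue_measure_itvI// leey.
  apply/seteqP; split => [r []//|r Ir]; split => //; rewrite /= lte_fin normr1; lra.
have d0 : 0 <= distr (x \- cst 1) (e / 2) by exact: measure_ge0.
rewrite leye_eq => /eqP h; rewrite ltNge; apply/negP => hs; move: h => /eqP; apply/negP.
by rewrite lt_eqF// lte_add_pinfty//; exact: le_lt_trans hs (ltry _).
Qed.

Lemma asymp1_convex : convex_in asymp1.
Proof.
move=> x y c [xX x1] [yX y1] /andP[c0 c1].
have c1' : (0 <= 1 - c)%R by lra.
have cX := carrier_scale p_gt1 w_meas w_ge0 c xX.
have cY := carrier_scale p_gt1 w_meas w_ge0 (1 - c)%R yX.
have cc := carrier_add p_gt1 w_meas w_ge0 cX cY.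
split; first exact: cc.
move=> e e0; apply: (@le_lt_trans _ _ (distr (x \- cst 1) e + distr (y \- cst 1) e)).
  apply: (distr_cover (L1 xX.1) (L1 yX.1) (L1 cc.1)) => s _; rewrite /= /fscale.
  move: (x s) (y s) => [v||]// [v'||]//; rewrite -?EFinB -?EFinM -?EFinD -?EFinB ?lee_fin //=.
  rewrite -?EFinB ?lee_fin !ler_norml => /andP[h1 h2] /andP[h3 h4].
  have k1 : (0 <= c * (v - 1 + e))%R by apply: mulr_ge0 => //; lra.
  have k2 : (0 <= c * (e - (v - 1)))%R by apply: mulr_ge0 => //; lra.
  have k3 : (0 <= (1 - c) * (v' - 1 + e))%R by apply: mulr_ge0 => //; lra.
  have k4 : (0 <= (1 - c) * (e - (v' - 1)))%R by apply: mulr_ge0 => //; lra.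
  by apply/andP; split; lra.
by apply: lte_add_pinfty; [exact: x1|exact: y1].
Qed.

(** An element y closer to x than (e / 4) N^(1 / p) cannot differ from x by more than e / 2 on a set
    of infinite measure: this would cost (e / 2)^p N. *)
Lemma asymp1_closed N : (0 < N)%R -> \int[mu]_(t in I) (w t)%:E = N%:E -> closed_in X asymp1.
Proof.
move=> N0 NE x xX H; split => // e e0.
have e40 : (0 < e / 4)%R by rewrite divr_gt0.
have Np0 : (0 < N `^ p^-1)%R by rewrite powR_gt0.
have d0 : (0 < (e / 4) * N `^ p^-1)%R by rewrite mulr_gt0.
have [y [yX y1] yx] := H _ d0.
have yxX := carrier_sub p_gt1 w_meas w_ge0 yX xX.
have e20 : (0 < e / 2)%R by rewrite divr_gt0.
have g : gint (y \- x) <= ((e / 4) `^ p * N)%:E.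
  have /(gamma_norm_leP p_gt1 w_ge0 _ (ltW d0)) := ltW yx.
  by rewrite (powRM _ (ltW e40) (ltW Np0)) -powRrM mulVf ?gt_eqF// powRr1// ltW.
have dyx : distr (y \- x) (e / 2) < +oo.
  rewrite ltey; apply/eqP => h.
  have := le_trans (gint_ge_distr yxX.1 (ltW e20) h) g.
  rewrite NE -EFinM lee_fin ler_pM2r// leNgt => /negP; apply.
  by apply: gt0_ltr_powR; rewrite ?nnegrE//; lra.
have le1 : distr (x \- cst 1) e <= distr (y \- cst 1) (e / 2) + distr (y \- x) (e / 2).
  apply: (distr_cover (L1 yX.1) yxX.1 (L1 xX.1)) => s _ /=.
  move: (x s) (y s) => [v||]// [v'||]//; rewrite -?EFinB ?lee_fin // !ler_norml => /andP[h1 h2] /andP[h3 h4].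
  by apply/andP; split; lra.
by apply: le_lt_trans le1 _; apply: lte_add_pinfty => //; exact: y1.
Qed.

Lemma approx_W_infty : weight_pos alpha w -> approx_compact alpha X ->
  forall M, exists2 t, (0 < t)%R & M%:E <= W w t.
Proof.
move=> wp aX M; apply: contrapT => H.
have WM t : (0 < t)%R -> W w t <= M%:E.
  by move=> t0; rewrite leNgt; apply/negP => h; apply: H; exists t => //; exact: ltW.
have [N N0' NE] : exists2 N, (0 <= N)%R & \int[mu]_(t in I) (w t)%:E = N%:E.
  apply: ge0_fin_real; first by apply: integral_ge0 => t /w_ge0; rewrite lee_fin.
  exact: le_lt_trans (integral_w_le w_meas w_ge0 aoo WM) (ltry _).
have N0 : (0 < N)%R.
  have [T T0 [Ta WT]] := wp; rewrite -lte_fin -NE; apply: (lt_le_trans WT).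
  apply: ge0_subset_integral; [exact: measurable_itv|exact: mI|exact/measurable_EFinP| |exact: sub_itvI].
  by move=> t /w_ge0; rewrite lee_fin.
pose A n := `[n%:R : R, +oo[%classic.
pose u n := step 1 (A n).
have mu_ n : L0 (u n) by apply: L0_step; exact: measurable_itv.
have g1 n : gint (u n) <= N%:E.
  apply: (@le_trans _ _ (wint (cst 1%:E))); last by rewrite (wint_cst ler01) powR1 mul1e NE.
  apply: (gint_le_wint p_gt1 w_meas w_ge0 (mu_ n)) => [|t _|t _ t0].
  - exact: measurable_cst.
  - by rewrite lee_fin.
  rewrite -EFinM mulrC; apply: Kfun_le_sup => //; first exact: ltW.
  move=> s _; have h : 0 <= u n s by exact: step_ge0.
  rewrite (gee0_abs h) /u /step mul1r lee_fin indicE.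
  by case: (_ \in _); rewrite ?lexx ?ler01.
have uX n : carrier X (u n).
  by apply/(carrierP p_gt1 w_ge0); split; [exact: mu_|exact: le_lt_trans (g1 n) (ltry _)].
have uC n : asymp1 (u n).
  split; first exact: uX.
  move=> e e0; apply: (@le_lt_trans _ _ (mu `[0%R, n%:R[%classic)).
    apply: le_measure; rewrite ?inE//; first by apply: measurable_distr; exact: L1.
    move=> s [/It s0 es]; rewrite /= in_itv/= s0/= ltNge; apply/negP => ns; move: es.
    have e1 : u n s = 1 by apply: step_in; rewrite /A /= in_itv/= ns.
    by rewrite e1 /cst subee// abse0 lte_fin ltNge ltW.
  by rewrite /= lebesgue_measure_itv/= sube0; case: ifP => _; rewrite ltry.
have sub : asymp1 `<=` carrier X by move=> x [].
have lo x : asymp1 x -> N%:E <= gint x by move=> Cx; rewrite -NE; exact: asymp1_gint.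
have uN e : (0 < e)%R -> exists K, forall n, (K <= n)%N -> gint (u n) <= (N + e)%:E.
  by move=> e0; exists 0%N => n _; apply: le_trans (g1 n) _; rewrite lee_fin; lra.
have [phi [phi1 uc]] := approx_min_cauchy p_gt1 w_ge0 aX N0' sub asymp1_convex
  (asymp1_closed N0 NE) lo uC uN.
have [k k0 Hk] := gint_ge_Kfun p_gt1 w_meas w_ge0 wp ltr01.
have d0 : (0 < k / 2)%R by rewrite divr_gt0.
have [K HK] := uc _ d0.
have := HK K.+1 K (leqnSn K) (leqnn K); apply/negP; rewrite -ltNge.
apply: (@lt_le_trans _ _ k%:E); first by rewrite lte_fin; lra.
have md : L0 (u (phi K.+1) \- u (phi K)) by apply: L0_sub.
suff h : 1%:E <= Kfun (u (phi K.+1) \- u (phi K)) 1.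
  by have := Hk _ 1%R md ler01 h; rewrite powR1 mulr1.
(* On [n, n + 1) the earlier indicator is 1 and the later one, which starts at phi (K + 1) >= n + 1,
   is 0. *)
pose n := phi K; pose B := `[n%:R : R, (n%:R + 1)%R[%classic.
have BI : B `<=` I.
  by move=> s; rewrite /B /= in_itv/= => /andP[ns _]; apply/It; apply: le_trans ns.
have mB : measurable B by exact: measurable_itv.
have muB : mu B = 1.
  by rewrite /B /= lebesgue_measure_itv/= lte_fin ltrDl ltr01 -EFinB; congr (_%:E); ring.
have muB1 : mu B <= 1%:E by rewrite muB.
apply: le_trans (integral_le_Kfun md ltr01 mB BI muB1).
rewrite (eq_integral (cst 1)); first by rewrite integral_cst// mul1e [leRHS]muB.
move=> s /set_mem Bs.
have /andP[h1 h2] : ((n%:R : R) <= s)%R && (s < (n%:R : R) + 1)%R by move: Bs; rewrite /B /= in_itv.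
have e1 : u (phi K.+1) s = 0.
  apply: step_notin; rewrite /A /= in_itv/= andbT => h; move: h2; rewrite ltNge => /negP; apply.
  by apply: le_trans h; rewrite natr1 ler_nat; exact: phi1.
have e2 : u (phi K) s = 1 by apply: step_in; rewrite /A /= in_itv/= h1.
by rewrite e1 e2 sub0e abseN abse1.
Qed.

End necessary_infty.

(** * Good weights give reflexivity and strict monotonicity *)

Section reflexivity.
Context (R : realType) (alpha : \bar R) (p : R) (w : R -> R).
Hypothesis p_gt1 : (1 < p)%R.
Hypothesis w_meas : measurable_fun (itvI alpha) w.
Hypothesis w_ge0 : forall t, itvI alpha t -> (0 <= w t)%R.
Hypothesis alphaE : alpha = 1%:E \/ alpha = +oo%E.
Local Open Scope ereal_scope.
Local Notation I := (itvI alpha).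
Local Notation L0 := (@L0 R alpha).
Local Notation aeI := (aeI alpha).
Local Notation gint := (gint alpha p w).
Local Notation Kfun := (Kfun alpha).
Local Notation max_rearr := (max_rearr alpha).
Local Notation excess := (excess alpha).
Local Notation X := (Gamma alpha p w).
Local Notation pairing := (pairing alpha).
Implicit Types (x y z g : R -> \bar R) (u : nat -> R -> \bar R) (s t c e d M l : R).

Hypothesis gw : good_weight alpha p w.

Let mI : measurable I. Proof. exact: measurable_itvI. Qed.
Let wp : weight_pos alpha w. Proof. exact: good_weight_pos alphaE gw. Qed.

Lemma excess_fin x l : L0 x -> gint x < +oo -> (0 < l)%R -> excess l x < +oo.
Proof.
move=> mx xf l0; have [w1 w2 w3 w4] := gw.
have [B B0 BE] := ge0_fin_real (gint_ge0 p w_ge0 x) xf.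
have [t t0 Ht] := Kfun_nearoo p_gt1 w_meas w_ge0 alphaE w1 w2 w3 B0 l0.
have Kx : Kfun x t <= (l * t)%:E by apply: Ht => //; rewrite BE.
exact: le_lt_trans (le_trans (excess_le_Kfun mx t0 Kx) Kx) (ltry _).
Qed.

(** Above a positive level the excess of x is integrable, so dominated convergence applies although
    x need not be integrable. *)
Lemma excess_cvg0 x u l : L0 x -> gint x < +oo -> (0 < l)%R -> (forall n, L0 (u n)) ->
  (forall n, aeI (fun s => `|u n s| <= `|x s|)) ->
  aeI (fun s => u n s @[n --> \oo] --> 0) -> excess l (u n) @[n --> \oo] --> 0.
Proof.
move=> mx xf l0 mu_ ux u0.
apply: (@ge0_dominated_cvg0 _ _ (fun n s => maxe (`|u n s| - l%:E) 0) (fun s => maxe (`|x s| - l%:E) 0)).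
- by move=> n; exact: measurable_excess_fun.
- exact: measurable_excess_fun.
- by move=> n s _; exact: excess_part_ge0.
- by move=> s _; exact: excess_part_ge0.
- have := aeI_forall ux; apply: aeIS => s _ h n.
  by apply: excess_part_le; [exact: excess_part_ge0|exact: le_trans (h n) (le_excess_part _ _)].
- exact: excess_fin.
move: u0; apply: aeIS => s _ us; apply/cvge0P => [n|e e0]; first exact: excess_part_ge0.
have au : `|u n s| @[n --> \oo] --> 0 by rewrite -[X in _ --> X]abse0; exact: cvg_abse.
have l0' : 0 < l%:E by rewrite lte_fin.
have [N _ HN] := au _ (open_ereal_lt' l0').
exists N => n Nn; apply: excess_part_le; first by rewrite lee_fin ltW.
have h : `|u n s| <= l%:E by apply: ltW; apply: HN.
by apply: (le_trans h); rewrite leeDl// lee_fin ltW.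
Qed.

(** K is tested at the fixed small level e / 2 instead of the optimal one. *)
Lemma max_rearr_cvg0 x u t : L0 x -> gint x < +oo -> (0 < t)%R -> (forall n, L0 (u n)) ->
  (forall n, aeI (fun s => `|u n s| <= `|x s|)) ->
  aeI (fun s => u n s @[n --> \oo] --> 0) -> max_rearr (u n) t @[n --> \oo] --> 0.
Proof.
move=> mx xf t0 mu_ ux u0; apply/cvge0P => [n|e e0]; first exact: max_rearr_ge0 (ltW t0).
have e20 : (0 < e / 2)%R by rewrite divr_gt0.
have et0 : (0 < e / 2 * t)%R by rewrite mulr_gt0.
have /cvge0P := excess_cvg0 mx xf e20 mu_ ux u0.
have ge0 n : 0 <= excess (e / 2) (u n) by exact: excess_ge0.
move=> /(_ ge0 _ et0)[N HN]; exists N => n Nn.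
apply: max_rearr_le => //; apply: le_trans (Kfun_le (mu_ n) (ltW e20) (ltW t0)) _.
apply: (@le_trans _ _ ((e / 2 * t)%:E + (e / 2 * t)%:E)); first by apply: leeD => //; exact: HN.
by rewrite -EFinD -EFinM lee_fin; lra.
Qed.

Lemma good_order_continuous : order_continuous alpha X.
Proof.
move=> x u xX uX ux u0.
have [mx xf] := (carrierP p_gt1 w_ge0 x).1 xX.
have mu_ n : L0 (u n) by have [] := uX n.
have ux' n : aeI (fun s => `|u n s| <= `|x s|).
  by move: (ux n); apply: aeIS => s _ /andP[h1 h2]; rewrite gee0_abs.
apply/(fnorm_cvg0P p_gt1 w_ge0); apply/cvge0P => [n|]; first exact: (gint_ge0 p w_ge0).
apply: (wint_cvg0 p_gt1 w_meas w_ge0 (g := max_rearr x)).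
- by move=> n; exact: measurable_max_rearr.
- exact: measurable_max_rearr.
- by move=> n t; exact: max_rearr_ge0I.
- by move=> n t [t0 _]; exact: le_max_rearr.
- exact: xf.
- by move=> t _ t0; exact: max_rearr_cvg0 mx xf t0 mu_ ux' u0.
Qed.

Lemma pairing_le2 x g h : L0 x -> L0 g -> L0 h -> aeI (fun s => `|g s| <= `|h s|) ->
  pairing x g <= pairing x h.
Proof.
move=> mx mg mh gh; apply: ae_ge0_le_integral => //.
- by apply: L0_abs; exact: L0_mul.
- by apply: L0_abs; exact: L0_mul.
by move: gh; apply: aeIS => s _ h'; rewrite !abseM; exact: lee_wpmul2l.
Qed.

Lemma decreasing_pairing_cvg0 x y (V : nat -> R -> \bar R) : carrier X x ->
  L0 y -> (forall n, L0 (V n)) -> (forall n, aeI (fun s => `|V n s| <= `|y s|)) ->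
  aeI (fun s => V n s @[n --> \oo] --> 0) -> pairing x y < +oo ->
  pairing x (V n) @[n --> \oo] --> 0.
Proof.
move=> xX my mV Vy V0 xy.
have mx : L0 x := xX.1.
have xfin : aeI (fun s => x s \is a fin_num).
  exact: bs_fin (gamma_banach p_gt1 w_meas w_ge0 wp) _ xX.
apply: (@ge0_dominated_cvg0 _ _ (fun n s => `|x s * V n s|) (fun s => `|x s * y s|)).
- by move=> n; apply: L0_abs; exact: L0_mul.
- by apply: L0_abs; exact: L0_mul.
- by [].
- by [].
- have := aeI_forall Vy; apply: aeIS => s _ h n; rewrite !abseM; exact: lee_wpmul2l.
- exact: xy.
move: V0 xfin; apply: aeIS2 => s _ Vs xs.
rewrite -[X in _ --> X]abse0; apply: cvg_abse.
by rewrite -[X in _ --> X](mule0 (x s)); apply: cvgeZl.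
Qed.

Lemma norm_midpoint0 x y : L0 x -> L0 y -> aeI (fun s => x s \is a fin_num) ->
    aeI (fun s => y s \is a fin_num) ->
  fnorm X (x \+ y) = 2%:E * fnorm X (fscale (2^-1)%R x \+ fscale (1 - 2^-1)%R y).
Proof.
move=> mx my xf yf.
have fin0 : aeI (fun s => (cst 0 : R -> \bar R) s \is a fin_num) by apply: aeI_all => s _.
have m0 : L0 (cst 0) by exact: L0_0.
have := norm_midpoint p_gt1 w_meas w_ge0 mx my m0 xf yf fin0.
have -> : (x \- cst 0) \+ (y \- cst 0) = x \+ y by apply/funext => s; rewrite /= !sube0.
by have -> : (fscale 2^-1 x \+ fscale (1 - 2^-1) y) \- cst 0 = fscale 2^-1 x \+ fscale (1 - 2^-1) y
  by apply/funext => s; rewrite /= sube0.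
Qed.

(* If the dual norms of a decreasing dominated sequence stayed above e, the almost
   norm-minimal elements z_N of {z >= 0 : int z V_N >= e} would be Cauchy. *)
Lemma decreasing_dual_small (V : nat -> R -> \bar R) y e : (0 < e)%R ->
  (forall n, L0 (V n)) -> L0 y -> (forall z, carrier X z -> pairing z y < +oo) ->
  (forall n, aeI (fun s => `|V n s| <= `|y s|)) ->
  (forall m n, (m <= n)%N -> aeI (fun s => `|V n s| <= `|V m s|)) ->
  aeI (fun s => V n s @[n --> \oo] --> 0) ->
  exists n, forall x, carrier X x -> fnorm X x <= 1 -> pairing x (V n) < e%:E.
Proof.
move=> e0 mV my yX Vy Vdec V0; apply: contrapT => H.
have bX := gamma_banach p_gt1 w_meas w_ge0 wp.
pose C n := pos_test alpha p w (V n) e.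
have C1 n : exists2 z, C n z & fnorm X z <= 1.
  apply: contrapT => Hn; apply: H; exists n => x xX x1.
  rewrite ltNge; apply/negP => ex; apply: Hn.
  have max : L0 (fun s => `|x s|) by apply: L0_abs; exact: xX.1.
  have nx : fnorm X (fun s => `|x s|) = fnorm X x.
    by apply: (eq_fnorm p_gt1 w_meas w_ge0 max xX.1); apply: aeI_all => s _; rewrite abse_id.
  exists (fun s => `|x s|); last by rewrite nx.
  split; first by split; [exact: max|move: xX.2; rewrite -[Gamma_norm _ _ _ x]nx].
  split; first by apply: aeI_all.
  apply: (le_trans ex); apply: (pairing_le xX.1 max (mV n)).
  by apply: aeI_all => s _; rewrite abse_id.
have Cdec m n : (m <= n)%N -> C n `<=` C m.
  move=> mn z [zX [z0 ez]]; split => //; split => //; apply: (le_trans ez).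
  by apply: pairing_le2 => //; [exact: zX.1|exact: Vdec].
have Cconv n := pos_test_convex p_gt1 w_meas w_ge0 (mV n) (ltW e0).
(* The sets C n decrease, so their distances from 0 increase, and they are at most 1; their supremum
   D plays the role of the minimal norm in [min_seq_cauchy]. *)
pose dd n := ereal_inf [set fnorm X z | z in C n].
have ddle n z : C n z -> dd n <= fnorm X z.
  by move=> Cz; apply: ge_ereal_inf; exists (fnorm X z) => //; exists z.
have dd0 n : 0 <= dd n by apply/ereal_infP => _ [z _ <-]; exact: gamma_norm_ge0.
have dd1 n : dd n <= 1 by have [z Cz z1] := C1 n; exact: le_trans (ddle _ _ Cz) z1.
have ddfin n : dd n \is a fin_num by rewrite ge0_fin_numE// (le_lt_trans (dd1 n))// ltry.
pose d n : R := fine (dd n).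
have dE n : dd n = (d n)%:E by rewrite /d fineK.
have d0 n : (0 <= d n)%R by rewrite -lee_fin -dE.
have hsup : has_sup (range d).
  split; first by exists (d 0%N), 0%N.
  by exists 1%R => _ [n _ <-]; rewrite -lee_fin -dE.
pose D := sup (range d).
have dD n : (d n <= D)%R by apply: ub_le_sup; [case: hsup|exists n].
have D0 : (0 <= D)%R := le_trans (d0 0%N) (dD 0%N).
have dinc m n : (m <= n)%N -> (d m <= d n)%R.
  move=> mn; have : dd m <= dd n.
    by apply/ereal_infP => _ [z Cz <-]; apply: ddle; exact: Cdec mn _ Cz.
  by rewrite !dE lee_fin.
have /choice[z Hz] n : exists z, C n z /\ fnorm X z <= (d n + n.+1%:R^-1)%:E.
  have i0 : (0 < n.+1%:R^-1 :> R)%R by rewrite invr_gt0.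
  have [_ [z Cz <-] lt] := lb_ereal_inf_adherent i0 (ddfin n).
  by exists z; split => //; move: (ltW lt); rewrite -/(dd n) dE -EFinD.
have zX n : carrier X (z n) by have [[]] := Hz n.
have zc : gint_cauchy alpha p w z.
  apply: (min_seq_cauchy p_gt1 w_meas w_ge0 alphaE gw D0 zX) => r r0.
    have i0 : (0 <= r^-1)%R by rewrite invr_ge0 ltW.
    exists (Num.truncn r^-1) => n Nn; have [_ h] := Hz n; apply: (le_trans h).
    rewrite lee_fin lerD// invf_ple ?posrE//.
    have /andP[_ /ltW h'] := truncn_itv i0; apply: (le_trans h'); rewrite ler_nat; exact: Nn.
  (* For m and n beyond N the midpoint of z m and z n still lies in C N, so its norm is at least d N
     > D - r. *)
  have [_ [N _ <-] DN] := sup_adherent r0 hsup.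
  exists N => m n Nm Nn.
  have Cm : C N (z m) by apply: Cdec Nm _ _; case: (Hz m).
  have Cn : C N (z n) by apply: Cdec Nn _ _; case: (Hz n).
  have h2 : (0 <= (2^-1 : R) <= 1)%R by apply/andP; split; lra.
  have Cmid := Cconv N _ _ _ Cm Cn h2.
  have mid := norm_midpoint0 (zX m).1 (zX n).1 (bs_fin bX (zX m)) (bs_fin bX (zX n)).
  apply: (@le_trans _ _ (2%:E * fnorm X (fscale (2^-1)%R (z m) \+ fscale (1 - 2^-1)%R (z n)))); last first.
    by rewrite -mid.
  rewrite EFinM; apply: lee_wpmul2l => //.
  by apply: le_trans (ddle _ _ Cmid); rewrite dE lee_fin; apply: ltW.
(* One h dominates a subsequence of z, and its pairings with V n tend to 0; but they dominate those
   of z (phi N) with V (phi N), which are at least e. *)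
have [phi [phik [h hX zh]]] := dominated_subseq p_gt1 w_meas w_ge0 wp zX zc.
have cv := decreasing_pairing_cvg0 hX my mV Vy V0 (yX _ hX).
have g n : 0 <= pairing h (V n) by exact: pairing_ge0.
have e20 : (0 < e / 2)%R by rewrite divr_gt0.
have [N /(_ N (leqnn N))] := (cvge0P g).1 cv _ e20; apply/negP; rewrite -ltNge.
apply: (@lt_le_trans _ _ e%:E); first by rewrite lte_fin; lra.
have [[_ [_ ez]] _] := Hz (phi N); apply: (le_trans ez).
apply: (@le_trans _ _ (pairing h (V (phi N)))).
  apply: (pairing_le (zX _).1 hX.1 (mV _)); move: zh; apply: aeIS => s _ hs.
  by apply: (le_trans (hs N)); exact: lee_abs.
apply: (pairing_le2 hX.1 (mV _) (mV _)); apply: Vdec; exact: phik.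
Qed.

Lemma good_dual_order_continuous : order_continuous alpha (associate alpha X).
Proof.
move=> y u [my yX] uX uy u0.
have mu_ n : L0 (u n) by have [] := uX n.
have g n : 0 <= fnorm (associate alpha X) (u n).
  apply: ereal_sup_ge; exists (pairing (cst 0) (u n)); last exact: pairing_ge0.
  exists (cst 0) => //; split; last first.
    by apply/(gamma_norm_leP p_gt1 w_ge0 _ ler01); rewrite gint_cst0// lee_fin powR_ge0.
  by apply/(carrierP p_gt1 w_ge0); rewrite gint_cst0//; split; [exact: L0_0|exact: ltry].
apply/(cvge0P g) => e e0.
(* Suprema of tails are decreasing and still dominated by y, and one of them bounds all later terms
   at once. *)
pose V n s := esups (fun k => `|u k s|) n.
have mV n : L0 (V n).
  by apply: (measurable_fun_esups (f := fun k s => `|u k s|)) => k; exact: L0_abs.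
have uV n k s : (n <= k)%N -> `|u k s| <= V n s by move=> nk; apply: ereal_sup_ubound; exists k.
have V0' n s : 0 <= V n s by exact: le_trans (abse_ge0 (u n s)) (uV n n s (leqnn n)).
have Vy n : aeI (fun s => `|V n s| <= `|y s|).
  move: (aeI_forall uy); apply: aeIS => s _ h; rewrite gee0_abs//.
  apply: ge_ereal_sup => _ [k _ <-]; have /andP[h1 h2] := h k; by rewrite gee0_abs.
have Vdec m n : (m <= n)%N -> aeI (fun s => `|V n s| <= `|V m s|).
  by move=> mn; apply: aeI_all => s _; rewrite !gee0_abs//; exact: nonincreasing_esups.
have Vc : aeI (fun s => V n s @[n --> \oo] --> 0).
  move: u0; apply: aeIS => s _ us; apply: cvg_esups.
  by rewrite -[X in _ --> X]abse0; exact: cvg_abse.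
have [N HN] := decreasing_dual_small e0 mV my yX Vy Vdec Vc.
exists N => n Nn; apply: ge_ereal_sup => _ [x [xX x1] <-].
apply: le_trans (ltW (HN x xX x1)).
apply: (pairing_le2 xX.1 (mu_ n) (mV N)); apply: aeI_all => s _.
by rewrite [leRHS]gee0_abs//; exact: uV.
Qed.

End reflexivity.

(** * Strict K-monotonicity from a strictly increasing W *)

Lemma le_of_eqs (R : realType) (a b a' b' : \bar R) : a = a' -> b = b' -> (a <= b -> a' <= b')%E.
Proof. by move=> -> ->. Qed.

(** A concave function with values a at t0 and b at t1 > t0 cannot have a supporting line of slope l
    at t0 and one of larger slope m at t1. *)
Lemma slopes_absurd (R : realType) (a b c d : \bar R) (l m t0 t1 : R) : l < m -> t0 < t1 ->
  (a < +oo -> b < +oo -> 0 <= c -> 0 <= d -> a = (l * t0)%:E + c -> b <= (l * t1)%:E + c ->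
   a <= (m * t0)%:E + d -> b = (m * t1)%:E + d -> False)%E.
Proof.
move=> lm t01; case: c => [c||]//; last by move=> af _ _ _ aE; rewrite aE addey// ltxx in af.
case: d => [d||]//; last by move=> _ bf _ _ _ _ _ bE; rewrite bE addey// ltxx in bf.
move=> _ _ _ _ aE + + bE; rewrite aE bE -!EFinD !lee_fin => h1 h2.
have : 0 < (m - l) * (t1 - t0) by rewrite mulr_gt0; lra.
lra.
Qed.

Section strict_monotonicity.
Context (R : realType) (alpha : \bar R) (p : R) (w : R -> R).
Hypothesis p_gt1 : (1 < p)%R.
Hypothesis w_meas : measurable_fun (itvI alpha) w.
Hypothesis w_ge0 : forall t, itvI alpha t -> (0 <= w t)%R.
Hypothesis alphaE : alpha = 1%:E \/ alpha = +oo%E.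
Local Open Scope ereal_scope.
Local Notation I := (itvI alpha).
Local Notation L0 := (@L0 R alpha).
Local Notation gint := (gint alpha p w).
Local Notation wint := (wint alpha p w).
Local Notation Kfun := (Kfun alpha).
Local Notation rearr := (rearr alpha).
Local Notation max_rearr := (max_rearr alpha).
Local Notation X := (Gamma alpha p w).
Implicit Types (x y : R -> \bar R) (s t : R).

(** K x determines x^*, whose values are slopes of K x. If x^*(t0) < y^*(t0), then y^* still exceeds
    x^*(t0) at some t1 > t0, so the slopes of the common concave function would increase. *)
Lemma eq_Kfun_le_rearr x y : L0 x -> L0 y -> (forall t, (0 < t)%R -> Kfun x t = Kfun y t) ->
  (forall t, (0 < t)%R -> Kfun y t < +oo) -> forall t, (0 <= t)%R -> rearr y t <= rearr x t.
Proof.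
move=> mx my xy yf t0 t00; rewrite leNgt; apply/negP => lt.
have [l l0 lE] := ge0_fin_real (rearr_ge0 alpha x t0) (lt_le_trans lt (leey _)).
have dy : t0%:E < distr_fun alpha y l by rewrite -lt_rearr// -lE.
have [t1 t01 t1d] : exists2 t1, (t0 < t1)%R & t1%:E < distr_fun alpha y l.
  move: dy; case: (distr_fun _ _ _) => [d||]//; last first.
    by move=> _; exists (t0 + 1)%R; [lra|exact: ltry].
  by rewrite lte_fin => td; exists ((t0 + d) / 2)%R; rewrite ?lte_fin; lra.
have t10 : (0 < t1)%R := le_lt_trans t00 t01.
have [m [m0 mE Ky1]] := Kfun_attained my t10 (yf _ t10).
have lm : (l < m)%R by rewrite -lte_fin -mE lt_rearr.
have Kx0 := Kfun_rearr mx l0 t00 lE.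
have Kx1 := Kfun_le mx l0 (ltW t10).
have Ky0 := Kfun_le my m0 t00.
have e0 : Kfun x t0 = Kfun y t0.
  by move: t00; rewrite le_eqVlt => /orP[/eqP <-|/xy//]; rewrite !Kfun0.
have f1 := yf _ t10.
have f0 : Kfun y t0 < +oo by apply: le_lt_trans f1; exact: Kfun_nd (ltW t01).
rewrite e0 in Kx0; rewrite (xy _ t10) in Kx1.
have g0 := excess_ge0 alpha x l; have g1 := excess_ge0 alpha y m.
exact: slopes_absurd lm t01 f0 f1 g0 g1 Kx0 Kx1 Ky0 Ky1.
Qed.

Lemma Kfun_lt_witness x y t0 : L0 x -> L0 y -> (forall t, (0 < t)%R -> Kfun x t < +oo) ->
  (forall t, (0 < t)%R -> Kfun y t < +oo) -> (forall t, (0 < t)%R -> Kfun x t <= Kfun y t) ->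
  (0 <= t0)%R -> rearr x t0 <> rearr y t0 ->
  exists2 t, (0 < t)%R & t%:E <= alpha /\ Kfun x t < Kfun y t.
Proof.
move=> mx my Kxf Kyf Kle t00 ne; apply: contrapT => H; apply: ne.
have Keq' t : (0 < t)%R -> t%:E <= alpha -> Kfun x t = Kfun y t.
  move=> t0' ta; apply: le_anti; apply/andP; split; first exact: Kle.
  by rewrite leNgt; apply/negP => h; apply: H; exists t.
have Keq t : (0 < t)%R -> Kfun x t = Kfun y t.
  move=> /(Kfun_alpha alphaE)[t' [t'0 t'a _ Kt']].
  have e := Keq' _ t'0 t'a; have ex := Kt' x mx; have ey := Kt' y my.
  rewrite ex ey; exact: e.
apply: le_anti; apply/andP; split.
  exact: (eq_Kfun_le_rearr my mx (fun t tp => esym (Keq t tp)) Kxf t00).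
exact: (eq_Kfun_le_rearr mx my Keq Kyf t00).
Qed.

(** f^p + (g - f)^p <= g^p, so the distance of f and g in L^p(w) bounds the gain from below. *)
Lemma wint_strict (f g : R -> \bar R) (d : R) : measurable_fun I f -> measurable_fun I g ->
  (forall t, I t -> 0 <= f t < +oo) -> (forall t, I t -> f t <= g t < +oo) -> wint f < +oo ->
  (0 < d)%R -> d%:E <= wint (fun t => `|g t - f t|) -> wint f < wint g.
Proof.
move=> mf mg f0 fg ff d0 gap.
have mdiff : measurable_fun I (fun t => `|g t - f t|).
  by apply: (measurableT_comp (f := abse)) => //; exact: emeasurable_funB.
have sum : 1%:E * wint f + 1%:E * wint (fun t => `|g t - f t|) <= 1%:E * wint g + 0%:E * wint g.
  apply: (wint_lin2 w_meas w_ge0 mf mdiff mg mg ler01 ler01 ler01 (lexx 0%R)) => t It.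
  rewrite !mul1e mul0e adde0; have /andP[f1 f2] := f0 _ It; have /andP[g1 g2] := fg _ It.
  apply: le_trans (poweRD_super p_gt1 f1 (abse_ge0 _)) _; apply: (le_poweR p_gt1).
    by apply: adde_ge0.
  move: (f t) (g t) f1 f2 g1 g2 => [a||]// [b||]// _ _ + _.
  by rewrite -EFinB -EFinD !lee_fin => ab; rewrite ger0_norm; lra.
move: sum; rewrite !mul1e mul0e adde0.
have [a a0 aE] := ge0_fin_real (wint_ge0 p w_ge0 f) ff.
move=> sum; apply: lt_le_trans (le_trans (leeD2l _ gap) sum).
by rewrite aE -EFinD lte_fin; lra.
Qed.

(** Different rearrangements give K x t < K y t at one time t; [wint_gap] makes of it a positive
    distance in L^p(w), as w has mass immediately to the left of t. *)
Lemma W_incr_strictly_K_monotone :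
  (forall t, (0 < t)%R -> t%:E <= alpha -> W w t < +oo) ->
  (forall s t, (0 <= s)%R -> (s < t)%R -> t%:E <= alpha -> W w s < W w t) ->
  strictly_K_monotone alpha X.
Proof.
move=> w1 w2 x y xX yX xy [t0 t00 ne].
have wp : weight_pos alpha w by exact: W_incr_pos alphaE w2.
have [mx xf] := (carrierP p_gt1 w_ge0 x).1 xX.
have [my yf] := (carrierP p_gt1 w_ge0 y).1 yX.
have Kxf t : (0 < t)%R -> Kfun x t < +oo := Kfun_fin p_gt1 w_meas w_ge0 wp mx xf.
have Kyf t : (0 < t)%R -> Kfun y t < +oo := Kfun_fin p_gt1 w_meas w_ge0 wp my yf.
have Kle t : (0 < t)%R -> Kfun x t <= Kfun y t.
  move=> t0'; have := xy _ t0'; rewrite !max_rearrE lee_pmul2l// lte_fin invr_gt0//.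
have [t1 t10 [t1a K1]] := Kfun_lt_witness mx my Kxf Kyf Kle t00 ne.
have fx t : (0 <= t)%R -> 0 <= max_rearr x t < +oo := max_rearr_fin p_gt1 w_meas w_ge0 wp mx xf.
have fy t : (0 <= t)%R -> 0 <= max_rearr y t < +oo := max_rearr_fin p_gt1 w_meas w_ge0 wp my yf.
have m1 : max_rearr x t1 < max_rearr y t1.
  by rewrite !max_rearrE lte_pmul2l// ?lte_fin ?invr_gt0// ge0_fin_numE.
have /andP[fx0 fx1] := fx _ (ltW t10); have /andP[fy0 fy1] := fy _ (ltW t10).
have [B B0 BE] := ge0_fin_real fx0 fx1.
have [e e0 eE] : exists2 e : R, (0 < e)%R & max_rearr x t1 + e%:E <= max_rearr y t1.
  move: m1; rewrite BE; have [b b0 ->] := ge0_fin_real fy0 fy1.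
  by rewrite lte_fin => Bb; exists (b - B)%R; [lra|rewrite lee_fin; lra].
have mfx := measurable_max_rearr mx; have mfy := measurable_max_rearr my.
have [d d0 Hd] := wint_gap p_gt1 w_meas w_ge0 w1 w2 t10 t1a B0 e0.
have gap : d%:E <= wint (fun t => `|max_rearr y t - max_rearr x t|).
  apply: Hd.
  - exact: mfy.
  - exact: mfx.
  - by move=> t tp tt; exact: (max_rearr_nincr my tp tt).
  - by move=> t tp tt; exact: (max_rearr_quasi alpha x tp tt).
  - exact: fx0.
  - by rewrite BE.
  - exact: eE.
have lt : gint x < gint y.
  apply: (wint_strict mfx mfy _ _ xf d0 gap) => t [tp ta]; first exact: fx.
  have /andP[y0 ->] := fy _ tp; rewrite andbT.
  move: tp; rewrite le_eqVlt => /orP[/eqP <-|]; first by rewrite !max_rearr0.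
  exact: xy.
rewrite ltNge; apply/negP => h.
have h2 := le_poweR p_gt1 (gamma_norm_ge0 alpha p w y) h.
have e1 := gamma_normX p_gt1 w_ge0 x; have e2 := gamma_normX p_gt1 w_ge0 y.
have h3 := le_of_eqs e2 e1 h2.
by move: h3; rewrite leNgt lt.
Qed.

End strict_monotonicity.

(** * Good weights as the common condition *)

Section equivalences.
Context (R : realType) (alpha : \bar R) (p : R) (w : R -> R).
Hypothesis alphaE : alpha = 1%:E \/ alpha = +oo%E.
Hypothesis p_gt1 : (1 < p)%R.
Hypothesis w_meas : measurable_fun (itvI alpha) w.
Hypothesis w_ge0 : forall t, itvI alpha t -> (0 <= w t)%R.
Hypothesis wD : class_D alpha p w.
Local Open Scope ereal_scope.
Local Notation I := (itvI alpha).
Local Notation X := (Gamma alpha p w).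
Implicit Types (s t : R).

Lemma W_nondecreasing s t : (0 <= s)%R -> (s <= t)%R -> t%:E <= alpha -> W w s <= W w t.
Proof.
move=> s0 st ta; rewrite (W_split w_meas w_ge0 s0 st ta) leeDl//.
apply: integral_ge0 => r; rewrite /= in_itv/= => /andP[sr rt].
by rewrite lee_fin w_ge0//; apply: (sub_itvI ta); rewrite /= in_itv/= rt (le_trans s0)// ltW.
Qed.

(** The end t = alpha is outside the interval; strictness there comes from the midpoint of s and
    t. *)
Lemma W_incr_closed : (forall s t, I s -> I t -> (s < t)%R -> W w s < W w t) ->
  forall s t, (0 <= s)%R -> (s < t)%R -> t%:E <= alpha -> W w s < W w t.
Proof.
move=> H s t s0 st ta.
have h : (s < (s + t) / 2)%R by lra.
have h' : ((s + t) / 2 < t)%R by lra.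
have Is : I s by split => //; apply: lt_le_trans ta; rewrite lte_fin.
have It : I ((s + t) / 2)%R by split; [lra|apply: lt_le_trans ta; rewrite lte_fin].
apply: lt_le_trans (H _ _ Is It h) _; apply: W_nondecreasing => //; [lra|exact: ltW].
Qed.

Lemma W_incr_of_not_flat : (forall a b : R, (0 <= a)%R -> (a < b)%R -> b%:E <= alpha -> ~ W w b <= W w a) ->
  forall s t, I s -> I t -> (s < t)%R -> W w s < W w t.
Proof.
move=> H s t [s0 _] [_ ta] st; rewrite ltNge; apply/negP; exact: H s0 st (ltW ta).
Qed.

(** If w vanished a.e., the indicator of [0, 1) would have norm 0. *)
Lemma banach_weight_pos : banach_space alpha X -> weight_pos alpha w.
Proof.
move=> bX; apply: contrapT => H.
have one := one_le_alpha alphaE.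
have W0 t : (0 < t)%R -> t%:E <= alpha -> W w t <= 0.
  by move=> t0 ta; rewrite leNgt; apply/negP => h; apply: H; exists t.
have w0 : \int[lebesgue_measure]_(t in I) (w t)%:E <= 0.
  case: alphaE => aE; last first.
    by apply: (integral_w_le w_meas w_ge0 aE) => t t0; apply: W0 => //; rewrite aE leey.
  rewrite (_ : I = `[0%R, 1%R[%classic); first exact: (W0 1%R).
  by rewrite aE; apply/seteqP; split => s; rewrite /itvI/= in_itv/= lte_fin => /andP.
pose A := `[0%R, 1%R[%classic : set R.
have mA : measurable A by exact: measurable_itv.
have mx : L0 alpha (step 1 A) by exact: L0_step.
have g0 : gint alpha p w (step 1 A) <= 0.
  apply: (@le_trans _ _ (wint alpha p w (cst 1%:E))).
    apply: (gint_le_wint p_gt1 w_meas w_ge0 mx) => [|t _|t _ t0].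
    - exact: measurable_cst.
    - by rewrite lee_fin.
    rewrite -EFinM mulrC; apply: Kfun_le_sup => //; first exact: ltW.
    move=> s _; have h : 0 <= step 1 A s by exact: step_ge0.
    by rewrite (gee0_abs h) /step mul1r lee_fin indicE; case: (_ \in _); rewrite ?lexx ?ler01.
  by rewrite (wint_cst p w_meas w_ge0 ler01) powR1 mul1e.
have g0' : gint alpha p w (step 1 A) = 0.
  by apply: le_anti; rewrite g0 (gint_ge0 p w_ge0).
have xX : carrier X (step 1 A).
  by apply/(carrierP p_gt1 w_ge0); split; [exact: mx|rewrite g0' ltry].
have nx : fnorm X (step 1 A) = 0.
  by rewrite gamma_normE g0' poweR0r// invr_neq0// gt_eqF// (lt_trans _ p_gt1).
have [N [mN N0 AN]] := (bs_norm_eq0 bX xX).1 nx.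
have AsubN : A `<=` N.
  move=> s As; apply: AN => /= h; have Is : I s by exact: (sub_itvI one).
  by have := h Is; rewrite step_in// => /eqP; rewrite onee_eq0.
have : lebesgue_measure A <= lebesgue_measure N by apply: le_measure; rewrite ?inE.
by rewrite N0 /A /= lebesgue_measure_itv/= lte_fin ltr01 sube0 lee_fin ler10.
Qed.

Lemma approx_compact_good_weight : approx_compact alpha X -> good_weight alpha p w.
Proof.
move=> aX; have wp := banach_weight_pos aX.1; split.
- by move=> t t0 ta; case: (wD t0 ta).
- apply: W_incr_closed; apply: W_incr_of_not_flat => a b a0 ab ba Wab.
  exact: (approx_compact_not_flat p_gt1 w_meas w_ge0 wD a0 ab ba Wab wp aX).
- by move=> aE; exact: (approx_W_infty p_gt1 w_meas w_ge0 aE wp aX).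
- exact: (approx_tail_infty p_gt1 w_meas w_ge0 alphaE wp aX).
Qed.

(** Order continuity of the space gives the condition at infinity, that of the associate space the
    condition at 0. *)
Lemma reflexive_good_weight : reflexive_space alpha X ->
  (forall s t, I s -> I t -> (s < t)%R -> W w s < W w t) -> good_weight alpha p w.
Proof.
move=> [oc oc'] Wi; have Wi' := W_incr_closed Wi.
have wp := W_incr_pos alphaE Wi'; split.
- by move=> t t0 ta; case: (wD t0 ta).
- exact: Wi'.
- exact: (oc_W_infty p_gt1 w_meas w_ge0 wp oc).
- exact: (oc_tail_infty p_gt1 w_meas w_ge0 alphaE wp oc').
Qed.

Lemma good_weight_reflexive : good_weight alpha p w -> reflexive_space alpha X.
Proof.
by move=> gw; split;
  [exact: good_order_continuous alphaE gw|exact: good_dual_order_continuous alphaE gw].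
Qed.

End equivalences.

Theorem theorem6p3 (R : realType) (alpha : \bar R) (p : R) (w : R -> R)
  (alphaE : alpha = 1%:E \/ alpha = +oo%E)
  (p_gt1 : 1 < p)
  (w_meas : measurable_fun (itvI alpha) w)
  (w_ge0 : forall t, itvI alpha t -> 0 <= w t)
  (wD : class_D alpha p w) :
  (approx_compact alpha (Gamma alpha p w) <->
     reflexive_space alpha (Gamma alpha p w) /\
     strictly_K_monotone alpha (Gamma alpha p w)) /\
  (reflexive_space alpha (Gamma alpha p w) /\
     strictly_K_monotone alpha (Gamma alpha p w) <->
   reflexive_space alpha (Gamma alpha p w) /\
     (forall s t, itvI alpha s -> itvI alpha t -> s < t ->
        (W w s < W w t)%E)).
Proof.
have i_iii : approx_compact alpha (Gamma alpha p w) -> reflexive_space alpha (Gamma alpha p w) /\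
    (forall s t, itvI alpha s -> itvI alpha t -> s < t -> (W w s < W w t)%E).
  move=> aX; have gw := approx_compact_good_weight alphaE p_gt1 w_meas w_ge0 wD aX.
  split; first exact: good_weight_reflexive.
  by case: gw => _ Wi _ _ s t [s0 _] [_ ta] st; exact: Wi s0 st (ltW ta).
have iii_i : reflexive_space alpha (Gamma alpha p w) /\
    (forall s t, itvI alpha s -> itvI alpha t -> s < t -> (W w s < W w t)%E) ->
    approx_compact alpha (Gamma alpha p w).
  move=> [rX Wi]; apply: (good_approx_compact p_gt1 w_meas w_ge0 alphaE).
  exact: reflexive_good_weight.
have ii_iii : reflexive_space alpha (Gamma alpha p w) /\
      strictly_K_monotone alpha (Gamma alpha p w) <->
    reflexive_space alpha (Gamma alpha p w) /\
      (forall s t, itvI alpha s -> itvI alpha t -> s < t -> (W w s < W w t)%E).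
  split=> -[rX h]; split => //.
    apply: (W_incr_of_not_flat) => a b a0 ab ba Wab.
    exact: (strictly_K_monotone_not_flat p_gt1 w_meas w_ge0 wD a0 ab ba Wab h).
  apply: (W_incr_strictly_K_monotone p_gt1 w_meas w_ge0 alphaE).
    by move=> t t0 ta; case: (wD t t0 ta).
  exact: (W_incr_closed w_meas w_ge0 h).
split; last exact: ii_iii.
split; first by move=> /i_iii /ii_iii.
by move=> /ii_iii /iii_i.
Qed.
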